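(* Let $n\ge 1$, let $1\le p_1,p_2<\infty$, let $0<r\le 1$, and let $p_1'$ be the conjugate exponent of $p_1$, i.e. $\frac{1}{p_1}+\frac{1}{p_1'}=1$. Let $m:\mathbb{R}^n\times\mathbb{N}_0^n\to\mathbb{C}$ be a function with $m(\cdot,\nu)$ measurable for every $\nu\in\mathbb{N}_0^n$, and let $T_m$ be the associated Hermite pseudo-multiplier, $T_mf(x)=\sum_{\nu\in\mathbb{N}_0^n}m(x,\nu)\widehat{f}(\phi_\nu)\phi_\nu(x)$. Then $T_m$ extends to an $r$-nuclear operator from $L^{p_1}(\mathbb{R}^n)$ into $L^{p_2}(\mathbb{R}^n)$ if and only if there exist sequences $\{g_k\}_{k\ge 1}$ in $L^{p_1'}(\mathbb{R}^n)$ and $\{h_k\}_{k\ge 1}$ in $L^{p_2}(\mathbb{R}^n)$ satisfying $$\sum_{k=1}^{\infty}\Vert g_k\Vert^r_{L^{p_1'}}\Vert h_k\Vert^r_{L^{p_2}}<\infty$$ such that, for every $\nu\in\mathbb{N}_0^n$, $$m(x,\nu)\phi_\nu(x)=\sum_{k=1}^{\infty}h_k(x)\,\widehat{g_k}(\phi_\nu)\quad\text{for a.e. } x\in\mathbb{R}^n.$$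
   Context: $\mathbb{N}_0=\{0,1,2,\dots\}$, and all $L^p$ spaces are complex Lebesgue spaces on $\mathbb{R}^n$ with Lebesgue measure. Hermite functions: for $\nu=(\nu_1,\dots,\nu_n)\in\mathbb{N}_0^n$ and $x\in\mathbb{R}^n$, $\phi_\nu(x)=\prod_{j=1}^n\phi_{\nu_j}(x_j)$, where $\phi_{\nu_j}(x_j)=(2^{\nu_j}\nu_j!\sqrt{\pi})^{-1/2}H_{\nu_j}(x_j)e^{-x_j^2/2}$ and $H_{\nu_j}$ is the (physicists') Hermite polynomial of degree $\nu_j$. The $\phi_\nu$ are real-valued Schwartz functions and form an orthonormal basis of $L^2(\mathbb{R}^n)$. Fourier-Hermite coefficients: $\widehat{f}(\phi_\nu)=\int_{\mathbb{R}^n}f(y)\phi_\nu(y)\,dy$ for $f\in L^q(\mathbb{R}^n)$, $1\le q\le\infty$. Hermite pseudo-multiplier: the operator $T_m$ with symbol $m$ is given by $T_mf(x)=\sum_{\nu\in\mathbb{N}_0^n}m(x,\nu)\widehat{f}(\phi_\nu)\phi_\nu(x)$; in particular $T_m\phi_\nu=m(\cdot,\nu)\phi_\nu$. ''$T_m$ extends to an $r$-nuclear operator from $L^{p_1}(\mathbb{R}^n)$ into $L^{p_2}(\mathbb{R}^n)$'' means: there is an $r$-nuclear operator $T:L^{p_1}(\mathbb{R}^n)\to L^{p_2}(\mathbb{R}^n)$ such that for every Schwartz function $f$ on $\mathbb{R}^n$ the functions $m(\cdot,\nu)\widehat{f}(\phi_\nu)\phi_\nu$ belong to $L^{p_2}(\mathbb{R}^n)$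 for all $\nu$ and the series defining $T_mf$ converges unconditionally in $L^{p_2}(\mathbb{R}^n)$ to $Tf$. $r$-nuclear operator: for Banach spaces $E,F$ and $0<r\le1$, a linear operator $T:E\to F$ is $r$-nuclear if there are sequences $(e_k')$ in the dual $E'$ and $(y_k)$ in $F$ such that $Tf=\sum_k e_k'(f)y_k$ for all $f\in E$ and $\sum_k\Vert e_k'\Vert_{E'}^r\Vert y_k\Vert_F^r<\infty$. *)

(* Defs.v *)
From HB Require Import structures.
From mathcomp Require Import all_boot all_order all_algebra finmap complex.
From mathcomp Require Import all_classical all_reals all_analysis.
From mathcomp Require Import measurable_realfun ess_sup_inf ring_quotient summability.

Set Implicit Arguments.
Unset Strict Implicit.
Unset Printing Implicit Defensive.

Import Order.TTheory GRing.Theory Num.Theory.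
Import numFieldNormedType.Exports.

Local Open Scope classical_set_scope.
Local Open Scope ring_scope.

(* The modulus of a complex number as an element of [R]; the norm [`|z|] of the
   library takes its values in [R[i]]. *)
Notation normc := Normc.normc.

Lemma normc_ge0 (R : rcfType) (z : R[i]) : 0 <= normc z.
Proof. by case: z => a b; exact: sqrtr_ge0. Qed.

Lemma normcD (R : rcfType) (a z : R[i]) : normc (a + z) <= normc a + normc z.
Proof. by have := ler_normD a z; rewrite -lecR rmorphD. Qed.

Lemma normcN (R : rcfType) (z : R[i]) : normc (- z) = normc z.
Proof. by case: z => a b /=; rewrite !sqrrN. Qed.

Lemma normcB (R : rcfType) (a z : R[i]) : normc a <= normc z + normc (a - z).
Proof. by rewrite -[a in leLHS](subrKC z) normcD. Qed.

Section complex_Lfun.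
Context d (T : measurableType d) (R : realType).
Variable mu : {measure set T -> \bar R}.
Implicit Types (p : \bar R) (f g : T -> R[i]).

Definition cmeasurable f :=
  measurable_fun [set: T] (fun x => complex.Re (f x)) /\
  measurable_fun [set: T] (fun x => complex.Im (f x)).

Definition cLnorm p f : \bar R := 'N[mu]_p[EFin \o (fun x => normc (f x))].

Lemma cmeasurable_normc f :
  cmeasurable f -> measurable_fun [set: T] (fun x => normc (f x)).
Proof.
move=> [mr mi].
have -> : (fun x => normc (f x)) =
  Num.sqrt \o (fun x => complex.Re (f x) ^+ 2 + complex.Im (f x) ^+ 2).
  by apply/funext => x /=; case: (f x).
apply: measurableT_comp.
  by apply: continuous_measurable_fun; exact: sqrt_continuous.
by apply: measurable_funD; exact: measurable_funX.
Qed.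

Lemma cmeasurable0 : cmeasurable 0.
Proof. by split; exact: measurable_cst. Qed.

Lemma cmeasurableZD (a : R[i]) f g :
  cmeasurable f -> cmeasurable g -> cmeasurable (a *: f + g).
Proof.
move=> [fr fi] [gr gi]; split.
  rewrite (_ : (fun x => _) = (fun x =>
    complex.Re a * complex.Re (f x) - complex.Im a * complex.Im (f x) +
    complex.Re (g x))); last first.
    apply/funext => x; rewrite /GRing.add/= /GRing.scale/=.
    by case: a (f x) (g x) => ? ? [? ?] [? ?].
  by apply: measurable_funD => //; apply: measurable_funB;
    apply: measurable_funM.
rewrite (_ : (fun x => _) = (fun x =>
  complex.Re a * complex.Im (f x) + complex.Im a * complex.Re (f x) +
  complex.Im (g x))); last first.
  apply/funext => x; rewrite /GRing.add/= /GRing.scale/=.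
  by case: a (f x) (g x) => ? ? [? ?] [? ?].
by apply: measurable_funD => //; apply: measurable_funD;
  apply: measurable_funM.
Qed.

Lemma measurable_normr_powR (w : T -> R) (r : R) :
  measurable_fun [set: T] w ->
  measurable_fun [set: T] (fun x => `|(EFin \o w) x| `^ r)%E.
Proof.
move=> mw; apply: (measurableT_comp (measurable_poweR _)).
by apply: measurableT_comp => //; exact/measurable_EFinP.
Qed.

Lemma le_Lnorm p (u v : T -> R) :
    measurable_fun [set: T] u -> measurable_fun [set: T] v -> (1 <= p)%E ->
    (forall x, 0 <= u x <= v x) ->
  ('N[mu]_p[EFin \o u] <= 'N[mu]_p[EFin \o v])%E.
Proof.
move=> mu_ mv + uv; rewrite unlock; case: p => [r r1| _|//].
- have r0 : 0 <= r by rewrite (le_trans ler01).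
  apply: gt0_ler_poweR; rewrite ?invr_ge0 ?in_itv/= ?leey ?andbT//.
  + by apply: integral_ge0 => x _; rewrite lee_fin powR_ge0.
  + by apply: integral_ge0 => x _; rewrite lee_fin powR_ge0.
  apply: ge0_le_integral => //.
  + exact: measurable_normr_powR.
  + exact: measurable_normr_powR.
  move=> x _; have /andP[u0 le_uv] := uv x.
  by rewrite lee_fin ge0_ler_powR ?nnegrE// !ger0_norm// (le_trans u0).
- case: ifPn => // _; apply/le_ess_sup/nearW => x /=.
  by have /andP[u0 le_uv] := uv x; rewrite lee_fin !ger0_norm// (le_trans u0).
Qed.

Lemma cLnormD p f g : (1 <= p)%E -> cmeasurable f -> cmeasurable g ->
  (cLnorm p (f + g)%R <= cLnorm p f + cLnorm p g)%E.
Proof.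
move=> p1 /[dup] mf /cmeasurable_normc nf /[dup] mg /cmeasurable_normc ng.
have nfg : measurable_fun [set: T] (fun x => normc ((f + g) x)).
  by apply: cmeasurable_normc; rewrite -[f]scale1r; exact: cmeasurableZD.
apply: le_trans (eminkowski mu nf ng p1).
apply: le_Lnorm => //; first exact: measurable_funD.
by move=> x; rewrite normc_ge0 normcD.
Qed.

Lemma cLnormZ p (a : R[i]) f : (1 <= p)%E -> cmeasurable f ->
  (cLnorm p f < +oo)%E -> cLnorm p (a *: f) = ((normc a)%:E * cLnorm p f)%E.
Proof.
move=> p1 /cmeasurable_normc nf ffin.
have nfP : (fun x => normc (f x)) \in Lfun mu p.
  by rewrite inE; apply/andP; rewrite !inE.
have := LnormZ (Lfun_Sub p1 nfP) (normc a).
rewrite ger0_norm ?normc_ge0// => <-; congr Lnorm.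
by apply/funext => x /=; rewrite Normc.normcM.
Qed.

Lemma cLnorm0 p : (1 <= p)%E -> cLnorm p 0 = 0%E.
Proof.
move=> p1; rewrite /cLnorm (_ : EFin \o _ = cst 0%E).
  by rewrite Lnorm0// gt_eqF// (lt_le_trans _ p1).
by apply/funext => x /=; rewrite expr0n/= addr0 sqrtr0.
Qed.

Lemma cLnorm_ae p f g : cmeasurable f -> cmeasurable g ->
  f = g %[ae mu] -> cLnorm p f = cLnorm p g.
Proof.
move=> /cmeasurable_normc nf /cmeasurable_normc ng fg.
have Nfg : EFin \o (fun x => normc (f x)) =
           EFin \o (fun x => normc (g x)) %[ae mu].
  by apply: filterS fg => x /= /(_ I) ->.
rewrite /cLnorm unlock; case: p => [r| |]; last 2 first.
- case: ifPn => // _; apply: eq_ess_sup.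
  by apply: filterS Nfg => x /= /(_ I) [->].
- case: ifPn => // _; rewrite !ess_infEN; congr (- _)%E; apply: eq_ess_sup.
  by apply: filterS Nfg => x /= /(_ I) [->].
congr poweR.
apply: ge0_ae_eq_integral => //; try exact: measurable_normr_powR.
- by move=> x _; exact: poweR_ge0.
- by move=> x _; exact: poweR_ge0.
by apply: filterS Nfg => x /= /(_ I) [->].
Qed.

End complex_Lfun.

Section complex_Lspace.
Context d (T : measurableType d) (R : realType).
Variables (mu : {measure set T -> \bar R}) (p : \bar R) (p1 : (1 <= p)%E).

Definition cLfun_pred : {pred T -> R[i]} :=
  mem [set f | cmeasurable f /\ (cLnorm mu p f < +oo)%E].

Lemma cLfun_submod_closed : submod_closed cLfun_pred.
Proof.
split; first by rewrite inE/=; split; [exact: cmeasurable0|rewrite cLnorm0].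
move=> a f g; rewrite !inE/= => -[mf ff] [mg fg]; split.
  exact: cmeasurableZD.
have maf : cmeasurable (a *: f).
  by rewrite -[_ *: _]addr0; apply: cmeasurableZD => //; exact: cmeasurable0.
apply: (le_lt_trans (cLnormD mu p1 maf mg)).
rewrite lte_add_pinfty// cLnormZ// lte_mul_pinfty// lee_fin.
exact: normc_ge0.
Qed.

(* Measurable functions with finite norm, before identification a.e. *)
Record cLfunType := CLfun {
  cLfun_val :> T -> R[i] ;
  cLfun_valP : cLfun_val \in cLfun_pred }.

HB.instance Definition _ := [isSub for cLfun_val].
HB.instance Definition _ := [Choice of cLfunType by <:].
HB.instance Definition _ :=
  GRing.isSubmodClosed.Build _ _ cLfun_pred cLfun_submod_closed.
HB.instance Definition _ := [SubChoice_isSubLmodule of cLfunType by <:].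

Definition cLfun_null : {pred cLfunType} :=
  mem [set f : cLfunType | (f : T -> R[i]) = (fun=> 0) %[ae mu]].

Lemma cLfun_null_zmod_closed : zmod_closed cLfun_null.
Proof.
split; first by rewrite inE/=; apply: nearW.
move=> f g; rewrite !inE/= => f0 g0.
apply: filterS2 f0 g0 => x /(_ I) f0 /(_ I) g0 _.
by rewrite -[LHS]/(f x - g x) f0 g0 subrr.
Qed.

HB.instance Definition _ :=
  GRing.isZmodClosed.Build _ cLfun_null cLfun_null_zmod_closed.

Definition cLspace : Type := Quotient.quot cLfun_null.

HB.instance Definition _ := GRing.Zmodule.on cLspace.
HB.instance Definition _ := EqQuotient.on cLspace.

(* A representative of an element of [cLspace]. *)
Definition cLspace_fun (u : cLspace) : T -> R[i] := repr u.
Coercion cLspace_fun : cLspace >-> Funclass.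

Local Open Scope quotient_scope.

Lemma cLspace_piP (f g : cLfunType) :
  \pi_cLspace f = \pi_cLspace g <-> (f : T -> R[i]) = g %[ae mu].
Proof.
split=> [/eqP|fg].
  rewrite -Quotient.idealrBE inE/= => fg.
  apply: filterS fg => x /(_ I) fg _.
  by apply/eqP; rewrite -subr_eq0; apply/eqP.
apply/eqP; rewrite -Quotient.idealrBE inE/=.
apply: filterS fg => x /(_ I) fg _.
by rewrite -[LHS]/(f x - g x) fg subrr.
Qed.

Lemma cLspace_repr_ae (f : cLfunType) :
  cLspace_fun (\pi_cLspace f) = f %[ae mu].
Proof. by apply/cLspace_piP; rewrite reprK. Qed.

Definition cLspace_scale (a : R[i]) (u : cLspace) : cLspace :=
  \pi_cLspace (a *: repr u).

Lemma cLspace_scale_pi a f :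
  cLspace_scale a (\pi_cLspace f) = \pi_cLspace (a *: f).
Proof.
apply/cLspace_piP; have := cLspace_repr_ae f.
apply: filterS => x /(_ I) fx _.
by rewrite -[LHS]/(a * (repr (\pi_cLspace f)) x) -[RHS]/(a * f x) -fx.
Qed.

Lemma cLspace_piD (f g : cLfunType) :
  \pi_cLspace (f + g) = \pi_cLspace f + \pi_cLspace g.
Proof. exact: raddfD. Qed.

Lemma cLspace_scaleA a b u :
  cLspace_scale a (cLspace_scale b u) = cLspace_scale (a * b) u.
Proof. by rewrite cLspace_scale_pi scalerA. Qed.

Lemma cLspace_scale1 : left_id 1 cLspace_scale.
Proof. by move=> u; rewrite /cLspace_scale scale1r reprK. Qed.

Lemma cLspace_scaleDr : right_distributive cLspace_scale +%R.
Proof.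
move=> a u v; rewrite -[u]reprK -[v]reprK -cLspace_piD !cLspace_scale_pi.
by rewrite scalerDr cLspace_piD.
Qed.

Lemma cLspace_scaleDl u : {morph cLspace_scale^~ u : a b / a + b}.
Proof. by move=> a b; rewrite /cLspace_scale scalerDl cLspace_piD. Qed.

HB.instance Definition _ := GRing.Zmodule_isLmodule.Build R[i] cLspace
  cLspace_scaleA cLspace_scale1 cLspace_scaleDr cLspace_scaleDl.

Definition cLspace_norm (u : cLspace) : R[i] := (fine (cLnorm mu p u))%:C%C.

Lemma cLfun_meas (f : cLfunType) : cmeasurable f.
Proof. by have := cLfun_valP f; rewrite inE => -[]. Qed.

Lemma cLfun_fin (f : cLfunType) : cLnorm mu p f \is a fin_num.
Proof.
by have := cLfun_valP f; rewrite inE => -[_ ?]; rewrite ge0_fin_numE ?Lnorm_ge0.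
Qed.

Lemma cLspace_norm_pi (f : cLfunType) :
  cLspace_norm (\pi_cLspace f) = (fine (cLnorm mu p f))%:C%C.
Proof.
rewrite /cLspace_norm (cLnorm_ae p _ _ (cLspace_repr_ae f))//;
  exact: cLfun_meas.
Qed.

Lemma cLspace_normD u v :
  cLspace_norm (u + v) <= cLspace_norm u + cLspace_norm v.
Proof.
rewrite -[u]reprK -[v]reprK -cLspace_piD !cLspace_norm_pi -rmorphD lecR.
rewrite -fineD ?cLfun_fin// fine_le ?fin_numD ?cLfun_fin//.
by apply: cLnormD => //; exact: cLfun_meas.
Qed.

Lemma cLspace_normZ a u :
  cLspace_norm (a *: u) = `|a| * cLspace_norm u.
Proof.
rewrite -[u]reprK [a *: _]cLspace_scale_pi !cLspace_norm_pi.
rewrite (_ : cLfun_val (a *: repr u) = a *: (repr u : T -> R[i]))//.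
rewrite cLnormZ//; last 2 first.
- exact: cLfun_meas.
- by rewrite ltey_eq cLfun_fin.
by rewrite fineM ?cLfun_fin// rmorphM.
Qed.

Lemma cLspace_norm0_eq0 u : cLspace_norm u = 0 -> u = 0.
Proof.
rewrite -[u]reprK cLspace_norm_pi => -[] u0.
have /Lnorm_eq0_eq0 : cLnorm mu p (repr u) = 0%E.
  by rewrite -[LHS]fineK ?cLfun_fin// u0.
have p0 : (0 < p)%E by rewrite (lt_le_trans _ p1).
have mn : measurable_fun [set: T] (EFin \o (fun x => normc (repr u x))).
  by apply/measurable_EFinP/cmeasurable_normc/cLfun_meas.
move=> /(_ mn p0) h; have <- : \pi_cLspace 0 = 0 by exact: raddf0.
apply/cLspace_piP; apply: filterS h => x /(_ I) /= [] /Normc.eq0_normc.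
by move=> ->.
Qed.

HB.instance Definition _ := Lmodule_isNormed.Build R[i] cLspace
  cLspace_normD cLspace_normZ cLspace_norm0_eq0.

End complex_Lspace.

Definition rV_display : measure_display. Proof. exact: default_measure_display. Qed.

Section measurable_rV.
Context (R : realType) (n : nat).

(* The sigma-algebra generated by the coordinates, i.e. the Borel sets. *)
Let coord (i : 'I_n) (x : 'rV[R]_n) : R := x ord0 i.

Let rV_set0 : g_sigma_preimage coord set0.
Proof. exact: sigma_algebra0. Qed.

Let rV_setC A : g_sigma_preimage coord A -> g_sigma_preimage coord (~` A).
Proof. exact: sigma_algebraC. Qed.

Let rV_bigcup (F : (set 'rV[R]_n)^nat) :
  (forall i, g_sigma_preimage coord (F i)) ->
  g_sigma_preimage coord (\bigcup_i (F i)).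
Proof. exact: sigma_algebra_bigcup. Qed.

HB.instance Definition _ := @isMeasurable.Build rV_display
  'rV[R]_n (g_sigma_preimage coord) rV_set0 rV_setC rV_bigcup.

Lemma measurable_coord (i : 'I_n) :
  measurable_fun [set: 'rV[R]_n] (fun x : 'rV[R]_n => x ord0 i).
Proof.
move=> _ Y mY; rewrite setTI; apply: sub_sigma_algebra => /=.
rewrite -bigcup_seq/=; exists i => /=; first by rewrite mem_index_enum.
by exists Y => //; rewrite setTI.
Qed.

Lemma measurable_fun_rVP d (T : measurableType d) (f : T -> 'rV[R]_n) :
  measurable_fun [set: T] f <->
  forall i, measurable_fun [set: T] (fun t => f t ord0 i).
Proof.
split=> [mf i|mf].
  exact: (measurableT_comp (measurable_coord i)).
have sub : g_sigma_preimage (fun i => coord i \o f) `<=` measurable.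
  apply: smallest_sub; first exact: sigma_algebra_measurable.
  rewrite -bigcup_seq; apply: bigcup_sub => i _ A [B mB <-].
  exact: mf.
move=> _ A mA; apply: sub.
by rewrite g_sigma_preimage_comp; exists A.
Qed.

End measurable_rV.

Section rV_cons.
Context (R : realType) (n : nat).

Definition rV_cons (z : R * 'rV[R]_n) : 'rV[R]_n.+1 :=
  row_mx (z.1)%:M z.2 : 'rV[R]_(1 + n).

Definition rV_uncons (x : 'rV[R]_n.+1) : R * 'rV[R]_n :=
  (x ord0 ord0, rsubmx (x : 'rV[R]_(1 + n))).

Lemma rV_consK : cancel rV_cons rV_uncons.
Proof.
move=> [t x]; rewrite /rV_uncons /rV_cons row_mxKr; congr pair.
transitivity (row_mx t%:M x ord0 (lshift n (ord0 : 'I_1))).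
  by congr (row_mx _ _ _ _); exact/val_inj.
by rewrite row_mxEl mxE eqxx.
Qed.

Lemma measurable_rV_cons : measurable_fun [set: R * 'rV[R]_n] rV_cons.
Proof.
apply/measurable_fun_rVP => i.
case: (split_ordP (i : 'I_(1 + n))) => j ->.
  rewrite (_ : (fun z => _) = fst)//; apply/funext => z.
  by rewrite [LHS]row_mxEl mxE !ord1 eqxx.
rewrite (_ : (fun z => _) = (fun x : 'rV[R]_n => x ord0 j) \o snd).
  by apply: measurableT_comp; first exact: measurable_coord.
by apply/funext => z; rewrite [LHS]row_mxEr.
Qed.

Lemma measurable_rV_uncons : measurable_fun [set: 'rV[R]_n.+1] rV_uncons.
Proof.
apply/measurable_fun_pairP; split; first exact: measurable_coord.
apply/measurable_fun_rVP => i.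
rewrite (_ : (fun z => _) = (fun x : 'rV[R]_n.+1 => x ord0 (rshift 1 i))).
  exact: measurable_coord.
by apply/funext => z; rewrite /= mxE.
Qed.

Variable mu : {sigma_finite_measure set 'rV[R]_n -> \bar R}.

Definition rV_cons_measure : set 'rV[R]_n.+1 -> \bar R :=
  pushforward (@lebesgue_measure R \x mu)%E rV_cons.

Let measurable_preimage A : measurable A -> measurable (rV_cons @^-1` A).
Proof.
by move=> mA; rewrite -[X in measurable X]setTI; exact: measurable_rV_cons.
Qed.

Let rV_cons0 : rV_cons_measure set0 = 0%E.
Proof. by rewrite /rV_cons_measure /pushforward preimage_set0 measure0. Qed.

Let rV_cons_ge0 A : (0 <= rV_cons_measure A)%E.
Proof. by rewrite /rV_cons_measure /pushforward; apply: measure_ge0. Qed.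

Let rV_cons_sigma_additive : semi_sigma_additive rV_cons_measure.
Proof.
move=> F mF tF mUF; rewrite /rV_cons_measure /pushforward preimage_bigcup.
apply: measure_semi_sigma_additive.
- by move=> k; exact: measurable_preimage.
- apply/trivIsetP => /= i j _ _ ij; rewrite -preimage_setI.
  by move/trivIsetP : tF => /(_ _ _ _ _ ij) ->//; rewrite preimage_set0.
- by rewrite -preimage_bigcup; exact: measurable_preimage.
Qed.

HB.instance Definition _ := isMeasure.Build _ _ _ rV_cons_measure
  rV_cons0 rV_cons_ge0 rV_cons_sigma_additive.

Let rV_cons_sigma_finite : sigma_finite setT rV_cons_measure.
Proof.
have /sigma_finiteP[F [TF ndF Foo]] := sigma_finiteT (@lebesgue_measure R).
have /sigma_finiteP[G [TG ndG Goo]] := sigma_finiteT mu.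
exists (fun k => rV_uncons @^-1` (F k `*` G k)).
  rewrite -preimage_bigcup (_ : \bigcup_k _ = setT)//.
  rewrite -setXTT TF TG predeqE => -[x y]; split.
    by move=> [k _ []/= ? ?]; split; exists k.
  move=> [/= [k _ Fkx] [l _ Gly]]; exists (maxn k l) => //; split.
  - by move: x Fkx; exact/subsetPset/ndF/leq_maxl.
  - by move: y Gly; exact/subsetPset/ndG/leq_maxr.
move=> k; have [mF Ffin] := Foo k; have [mG Gfin] := Goo k; split.
  rewrite -[X in measurable X]setTI; apply: measurable_rV_uncons => //.
  exact: measurableX.
rewrite /rV_cons_measure /pushforward -comp_preimage.
rewrite (_ : rV_uncons \o rV_cons = id); last exact/funext/rV_consK.
by rewrite preimage_id product_measure1E// lte_mul_pinfty// ge0_fin_numE.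
Qed.

HB.instance Definition _ := Measure_isSigmaFinite.Build _ _ _ rV_cons_measure
  rV_cons_sigma_finite.

End rV_cons.

(* [lebesgue_rV R n] is the n-fold product of the Lebesgue measure of [R]. *)
Fixpoint lebesgue_rV (R : realType) (n : nat) :
    {sigma_finite_measure set 'rV[R]_n -> \bar R} :=
  match n with
  | 0 => \d_(0 : 'rV[R]_0)
  | k.+1 => rV_cons_measure (lebesgue_rV R k)
  end.

Definition cintegral d (T : measurableType d) (R : realType)
    (mu : {measure set T -> \bar R}) (f : T -> R[i]) : R[i] :=
  Complex (\int[mu]_x complex.Re (f x))%R (\int[mu]_x complex.Im (f x))%R.

(* [L^p(R^n)], with complex scalars *)
Notation Lp n p1 := (cLspace (lebesgue_rV _ n) p1).

(* Measurability with respect to the Lebesgue sets, i.e. the completion of the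
   Borel sets, rather than the Borel sets only. *)
Definition lebesgue_measurable (R : realType) (n : nat) (f : 'rV[R]_n -> R[i]) :=
  forall A : set R, measurable A ->
    completed_algebra_gen (lebesgue_rV R n) [set x | A (complex.Re (f x))] /\
    completed_algebra_gen (lebesgue_rV R n) [set x | A (complex.Im (f x))].

Section schwartz.
Context (R : realType) (n : nat).

Definition partial (i : 'I_n) (f : 'rV[R]_n -> R) : 'rV[R]_n -> R :=
  fun x => 'D_(delta_mx ord0 i) f x.

(* [s] lists the coordinates of differentiation, so that all mixed partial
   derivatives of all orders are covered. *)
Definition partials (s : seq 'I_n) (f : 'rV[R]_n -> R) : 'rV[R]_n -> R :=
  foldr partial f s.

Definition smooth (f : 'rV[R]_n -> R) :=
  forall s, continuous (partials s f) /\
    forall i x, derivable (partials s f) x (delta_mx ord0 i).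

Definition real_schwartz (f : 'rV[R]_n -> R) :=
  smooth f /\
  forall (a : {ffun 'I_n -> nat}) (s : seq 'I_n), exists M : R,
    forall x : 'rV[R]_n, `|(\prod_i x ord0 i ^+ a i) * partials s f x| <= M.

Definition schwartz (f : 'rV[R]_n -> R[i]) :=
  real_schwartz (fun x => complex.Re (f x)) /\
  real_schwartz (fun x => complex.Im (f x)).

End schwartz.

Section hermite.
Context (R : realType).

(* Rodrigues' formula [H_k = (-1)^k e^(x^2) (d/dx)^k e^(-x^2)], unfolded one
   derivative at a time. *)
Fixpoint hermite_poly (k : nat) : {poly R} :=
  match k with
  | 0 => 1
  | j.+1 => 'X *+ 2 * hermite_poly j - (hermite_poly j)^`()
  end.

Definition hermite_fun1 (k : nat) (t : R) : R :=
  (Num.sqrt (2 ^+ k * k`!%:R * Num.sqrt pi))^-1 *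
  (hermite_poly k).[t] * expR (- (t ^+ 2 / 2)).

Context (n : nat).

Definition hermite_fun (nu : {ffun 'I_n -> nat}) (x : 'rV[R]_n) : R :=
  \prod_(j < n) hermite_fun1 (nu j) (x ord0 j).

Definition hermite_coef (f : 'rV[R]_n -> R[i]) (nu : {ffun 'I_n -> nat}) :
    R[i] :=
  cintegral (lebesgue_rV R n) (fun y => f y * (hermite_fun nu y)%:C%C).

Definition pseudo_multiplier_term (m : 'rV[R]_n -> {ffun 'I_n -> nat} -> R[i])
    (f : 'rV[R]_n -> R[i]) (nu : {ffun 'I_n -> nat}) : 'rV[R]_n -> R[i] :=
  fun x => m x nu * hermite_coef f nu * (hermite_fun nu x)%:C%C.

End hermite.

Section nuclear.
Context (R : realType).

(* The norm of a complex normed space as a real number. *)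
Definition rnorm (E : normedModType R[i]) (x : E) : R := complex.Re `|x|.

Definition dual_norm (E : normedModType R[i]) (e : {linear E -> R[i]^o}) : R :=
  sup [set normc (e x) | x in [set x : E | rnorm x <= 1]].

Definition nuclear (r : R) (E F : normedModType R[i]) (T : {linear E -> F}) :=
  exists (e : nat -> {linear E -> R[i]^o}) (y : nat -> F),
    [/\ forall k, continuous (e k),
        forall f, series (fun k => e k f *: y k) @ \oo --> T f
      & (\sum_(k <oo) (dual_norm (e k) `^ r * rnorm (y k) `^ r)%:E < +oo)%E].

End nuclear.

(* Unconditional convergence of a series is convergence of the net of its
   finite partial sums. *)
Definition unconditional_sum (R : realType) (F : normedModType R[i])
    (I : choiceType) (u : I -> F) (l : F) :=
  partial_sum u @ totally --> l.

(* [F] is the class in [L^p1] of the Schwartz function [f], which exists since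
   Schwartz functions are in every [L^p]; [u nu], a class in [L^p2] of
   [pseudo_multiplier_term m f nu], expresses the membership of the terms. *)
Definition extends_to_nuclear (R : realType) (n : nat) (p1 p2 : \bar R)
    (hp1 : (1 <= p1)%E) (hp2 : (1 <= p2)%E) (r : R)
    (m : 'rV[R]_n -> {ffun 'I_n -> nat} -> R[i]) :=
  exists2 T : {linear Lp n hp1 -> Lp n hp2}, nuclear r T &
    forall (f : 'rV[R]_n -> R[i]) (F : Lp n hp1), schwartz f ->
      cLspace_fun F = f %[ae lebesgue_rV R n] ->
      exists2 u : {ffun 'I_n -> nat} -> Lp n hp2,
        forall nu, cLspace_fun (u nu) = pseudo_multiplier_term m f nu %[ae lebesgue_rV R n] &
        unconditional_sum u (T F).

(* Main.v *)
Require Import Defs.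
From HB Require Import structures.
From mathcomp Require Import all_boot all_order all_algebra complex.
From mathcomp Require Import all_classical all_reals all_analysis.
From mathcomp Require Import ring lra zify measurable_realfun ess_sup_inf.

Set Implicit Arguments.
Unset Strict Implicit.
Unset Printing Implicit Defensive.

Import Order.TTheory GRing.Theory Num.Theory.
Import numFieldNormedType.Exports.

Local Open Scope classical_set_scope.
Local Open Scope ring_scope.

(** A nuclear operator from L^p1 to L^p2 is an integral operator with kernel
    [sum_k h_k(x) g_k(y)], because the functionals of its decomposition are given
    by functions [g_k] of the dual space L^q1 ([complex_riesz_representation]). Such
    an operator maps the Hermite function [phi_nu] to [sum_k <g_k, phi_nu> h_k], and
    the pseudo-multiplier maps it to [m(., nu) phi_nu]. The condition of the theorem
    is the equality of these two functions for all [nu], and the point is to pass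
    from Hermite functions to Schwartz functions and from convergence in norm to
    convergence almost everywhere.

    Suppose that [T_m] extends to a nuclear operator [T]. On [phi_nu], by
    orthonormality, the series defining [T_m] has a single nonzero term, so that
    [T phi_nu = m(., nu) phi_nu]. Since [r <= 1], the series
    [sum_k <g_k, phi_nu> h_k] converges absolutely in L^p2, hence also almost
    everywhere, to the same limit ([absolutely_convergent_series]).

    Conversely, the [g_k] and [h_k] define a nuclear operator [T] by an absolutely
    convergent series, and [T phi_nu = m(., nu) phi_nu]. A Schwartz function [f] is
    the unconditional sum in L^p1 of its Hermite series [sum_nu <f, phi_nu> phi_nu],
    and [T], being continuous, maps this series to the series defining [T_m f].

    The convergence of Hermite series ([schwartz_expansion]) is proved in the norm
    [sup |f(x)| / W(x)], where the weight [W] is the product of the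
    [1 / (1 + x_i^2)], which lies in every L^p. The ladder relations, which express
    [x phi_k] and [phi_k'] by [phi_(k-1)] and [phi_(k+1)], give orthonormality, the
    bound [|phi_nu| <= c_nu W] with [c_nu] polynomial in [nu], and, by integration
    by parts, the rapid decay of the Hermite coefficients of [f]; so the series
    converges absolutely. Its sum is [f] because a continuous function dominated by
    [W] and orthogonal to all Hermite functions is zero ([orthogonal_eq0]): it is
    orthogonal to uniform limits of combinations of Hermite functions, among which
    there are arbitrarily concentrated Gaussians.

    The Riesz representation is obtained from the Radon-Nikodym theorem, applied to
    [A |-> e (W 1_A)], whose density is [W g]. Treating real and imaginary parts
    separately loses a factor 2 in the norms, which does not affect summability. *)

(** * Integration of dominated functions *)

Section dominated.
Context d (T : measurableType d) (R : realType).
Variable mu : {measure set T -> \bar R}.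
Implicit Types f g : T -> R.

Lemma integrable_dominated f g : measurable_fun setT f ->
  mu.-integrable setT (EFin \o g) -> (forall x, `|f x| <= g x) ->
  mu.-integrable setT (EFin \o f).
Proof.
move=> mf ig fg; apply: le_integrable ig => //; first exact/measurable_EFinP.
by move=> x _ /=; rewrite lee_fin (le_trans (fg x))// ler_norm.
Qed.

Lemma Rdominated_cvg (f_ : nat -> T -> R) f g :
  (forall n, measurable_fun setT (f_ n)) ->
  mu.-integrable setT (EFin \o g) -> (forall n x, `|f_ n x| <= g x) ->
  (forall x, f_ n x @[n --> \oo] --> f x) ->
  \int[mu]_x f_ n x @[n --> \oo] --> \int[mu]_x f x.
Proof.
move=> mf ig fg ff.
have mlim : measurable_fun setT f.
  by apply: (measurable_fun_cvg (h := f_)) => // x _; exact: ff.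
have fgl x : `|f x| <= g x.
  have : `|f_ n x| @[n --> \oo] --> `|f x| by apply: cvg_norm; exact: ff.
  move=> /cvg_lim <-//; apply: limr_le.
    by apply: is_cvg_norm; apply/cvg_ex; exists (f x); exact: ff.
  by apply: nearW => n; exact: fg.
have -> : \int[mu]_x f x = fine (\int[mu]_x (EFin \o f) x)%E by [].
apply: fine_cvg; rewrite fineK; last first.
  by apply: integrable_fin_num => //; apply: integrable_dominated ig fgl.
apply: (@dominated_cvg _ _ _ mu setT measurableT (fun n => EFin \o f_ n)
  (EFin \o f) (EFin \o g)) => //.
- by move=> n; exact/measurable_EFinP.
- by move=> x _; apply: cvg_EFin; [exact: nearW|exact: ff].
- by move=> n x _ /=; rewrite lee_fin.
Qed.

Lemma Rintegral_sum I (s : seq I) (h : I -> T -> R) :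
  (forall i, mu.-integrable setT (EFin \o h i)) ->
  \int[mu]_x (\sum_(i <- s) h i x) = \sum_(i <- s) \int[mu]_x h i x.
Proof.
move=> ih; elim: s => [|i s IH].
  by under eq_Rintegral do rewrite big_nil; rewrite big_nil Rintegral_cst// mul0r.
under eq_Rintegral do rewrite big_cons.
rewrite RintegralD//; first by rewrite IH big_cons.
have := integrable_sum measurableT s (P := xpredT) (fun i _ => ih i).
by congr (_ .-integrable setT _); apply/funext => x /=; rewrite sumEFin.
Qed.

End dominated.

(** The exponential series converges geometrically fast once the exponent is
    doubled in the bound: [X^k / k! = 2^-k (2 X)^k / k!], and the latter terms
    sum up to [expR (2 X)]. *)
Lemma expR_series_tail (R : realType) (x : R) N :
  `|expR x - \sum_(k < N) x ^+ k / k`!%:R| <= 2^-1 ^+ N * expR (2 * `|x|).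
Proof.
pose S (y : R) M : R := \sum_(k < M) y ^+ k / k`!%:R.
have SE y : S y @ \oo --> expR y.
  rewrite (_ : S y = series (exp_coeff y)).
    exact: is_cvg_series_exp_coeff.
  by apply/funext => M; rewrite /S /series/= big_mkord.
have le_S y M : 0 <= y -> S y M <= expR y.
  move=> y0; have <- := cvg_lim (@Rhausdorff R) (SE y).
  apply: nondecreasing_cvgn_le; last by apply/cvg_ex; eexists; exact: SE.
  apply/nondecreasing_seqP => k; rewrite /S big_ord_recr/= lerDl.
  by rewrite divr_ge0// exprn_ge0.
have tail M : `|S x (N + M)%N - S x N| <= 2^-1 ^+ N * expR (2 * `|x|).
  have -> : S x (N + M)%N - S x N = \sum_(k < M) x ^+ (N + k) / (N + k)`!%:R.
    by rewrite /S big_split_ord/= [X in X - _]addrC addrK.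
  apply: le_trans (ler_norm_sum _ _ _) _.
  apply: (@le_trans _ _ (\sum_(k < M)
    2^-1 ^+ N * ((2 * `|x|) ^+ (N + k) / (N + k)`!%:R))).
    apply: ler_sum => k _; rewrite normrM normrX normfV normr_nat exprMn.
    rewrite !mulrA; apply: ler_wpM2r; first by rewrite invr_ge0.
    apply: ler_peMl; first exact: exprn_ge0.
    rewrite exprD mulrA -exprMn mulVf// expr1n mul1r.
    by rewrite exprn_ege1// ler1n.
  rewrite -mulr_sumr; apply: ler_wpM2l; first by rewrite exprn_ge0.
  apply: (@le_trans _ _ (S (2 * `|x|) (N + M)%N)); last first.
    by apply: le_S; rewrite mulr_ge0.
  rewrite /S big_split_ord/= lerDr; apply: sumr_ge0 => k _ /=.
  by rewrite divr_ge0// exprn_ge0// mulr_ge0.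
have cv : `|S x (N + M)%N - S x N| @[M --> \oo] --> `|expR x - S x N|.
  apply: cvg_norm; apply: cvgB; last exact: cvg_cst.
  rewrite (_ : (fun M => S x (N + M)%N) = (fun M => S x (M + N)%N)).
    by rewrite (cvg_shiftn N (S x)); exact: SE.
  by apply/funext => M; rewrite addnC.
rewrite -/(S x N); have <- := cvg_lim (@Rhausdorff R) cv.
apply: limr_le; first by apply/cvg_ex; eexists; exact: cv.
by apply: nearW => M; exact: tail.
Qed.

(** * Integration on the line *)

(** The Cauchy density (up to normalization) is the majorant against which all
    functions of one variable are integrated. *)
Definition cauchy (R : realType) (t : R) : R := (1 + t ^+ 2)^-1.

Section cauchy.
Context (R : realType).
Implicit Types (t : R) (f g : R -> R).
Local Notation leb := (@lebesgue_measure R).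

Lemma cauchy_gt0 t : 0 < cauchy t.
Proof. by rewrite invr_gt0 ltr_pwDl// sqr_ge0. Qed.

Lemma cauchy_ge0 t : 0 <= cauchy t. Proof. exact/ltW/cauchy_gt0. Qed.

Lemma cauchy_le1 t : cauchy t <= 1.
Proof. by rewrite invf_le1 ?lerDl ?sqr_ge0// ltr_pwDl// sqr_ge0. Qed.

Lemma continuous_cauchy : continuous (@cauchy R).
Proof. exact: continuous_oneDsqrV. Qed.

Lemma measurable_cauchy : measurable_fun setT (@cauchy R).
Proof. by apply: continuous_measurable_fun; exact: continuous_cauchy. Qed.

Lemma integrable_cauchy : leb.-integrable setT (EFin \o @cauchy R).
Proof.
apply/integrableP; split; first by apply/measurable_EFinP; exact measurable_cauchy.
under eq_integral do rewrite /= ger0_norm ?cauchy_ge0//.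
rewrite ge0_symfun_integralT; last 3 first.
- exact: cauchy_ge0.
- exact: continuous_cauchy.
- by move=> t; rewrite /cauchy/= sqrrN.
rewrite (_ : [set x | _] = `[0, +oo[%classic); last first.
  by apply/seteqP; split => x/=; rewrite in_itv/= andbT.
by rewrite integral0y_oneDsqr -EFinM ltry.
Qed.

Lemma integrable_cauchy_bound f (C : R) :
  measurable_fun [set: measurableTypeR R] f ->
  (forall t, `|f t| <= C * cauchy t) -> leb.-integrable setT (EFin \o f).
Proof.
move=> mf fC.
apply: (@integrable_dominated _ _ _ leb f (fun t => C * cauchy t)) => //.
exact: (integrableZl measurableT C integrable_cauchy).
Qed.

Lemma cauchy_bound_ge0 f (C : R) : (forall t, `|f t| <= C * cauchy t) -> 0 <= C.
Proof.
move=> /(_ 0) fC; have := le_trans (normr_ge0 _) fC.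
by rewrite pmulr_lge0// cauchy_gt0.
Qed.

Lemma Rintegral_derive f f' a b : (forall t, is_derive t 1 f (f' t)) ->
  continuous f' -> a < b -> \int[leb]_(t in `[a, b]) f' t = f b - f a.
Proof.
move=> df cf' ab; have cf : continuous f.
  move=> t; apply: differentiable_continuous; apply/derivable1_diffP; exact: ex_derive.
rewrite /Rintegral (@continuous_FTC2 _ f' f)//.
- exact: continuous_subspaceT.
- split; first by move=> x _; apply: ex_derive.
    by apply: cvg_at_right_filter; exact: cf.
  by apply: cvg_at_left_filter; exact: cf.
- by move=> x _; rewrite derive1E; apply: derive_val.
Qed.

(** Since a function below the Cauchy density vanishes at both ends, its
    derivative has zero integral. *)
Lemma Rintegral_derive_eq0 f f' (C : R) :
  (forall t, is_derive t 1 f (f' t)) -> continuous f' ->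
  (forall t, `|f t| <= C * cauchy t) -> (forall t, `|f' t| <= C * cauchy t) ->
  \int[leb]_t f' t = 0.
Proof.
move=> df cf' fC f'C.
have C0 := cauchy_bound_ge0 fC.
have mf' : measurable_fun [set: measurableTypeR R] f'.
  exact: continuous_measurable_fun.
pose F n t := (f' \_ `[- n.+1%:R, n.+1%:R]) t.
have itv n : \int[leb]_t F n t = f n.+1%:R - f (- n.+1%:R).
  by rewrite -Rintegral_mkcond (Rintegral_derive df cf')// gtrN.
have lim1 : \int[leb]_t F n t @[n --> \oo] --> \int[leb]_t f' t.
  apply: (@Rdominated_cvg _ _ _ leb F f' (fun t => C * cauchy t)).
  - move=> n; apply/(measurable_restrictT _ _).1 => //.
    exact: measurable_funTS.
  - exact: (integrableZl measurableT C integrable_cauchy).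
  - move=> n x; rewrite /F patchE; case: ifPn => // _.
    by rewrite normr0 mulr_ge0// cauchy_ge0.
  - move=> x; apply: cvg_near_cst; near=> n.
    rewrite /F patchE mem_set//= in_itv/= -ler_norml.
    rewrite (@le_trans _ _ n%:R)// ?ler_nat//.
    near: n; exact: nbhs_infty_ger.
have lim2 : f n.+1%:R - f (- n.+1%:R) @[n --> \oo] --> (0 : R).
  apply: norm_cvg0; apply: (@squeeze_cvgr _ _ _ _ (cst 0) (fun n => (2 * C) * n.+1%:R^-1)).
  - near=> n; rewrite normr_ge0/= (le_trans (ler_normB _ _))//.
    have b (s : R) : s ^+ 2 = n.+1%:R ^+ 2 -> `|f s| <= C * n.+1%:R^-1.
      move=> sn; rewrite (le_trans (fC s))// ler_wpM2l// /cauchy sn.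
      rewrite lef_pV2 ?posrE ?ltr_pwDl ?sqr_ge0// expr2.
      by rewrite (@le_trans _ _ (n.+1%:R * n.+1%:R))// ?lerDr// ler_peMr// ler1n.
    have := lerD (b n.+1%:R erefl) (b (- n.+1%:R) (sqrrN _)).
    by move=> /le_trans; apply; rewrite -mulrDl mulr_natl mulr2n.
  - exact: cvg_cst.
  - rewrite -(mulr0 (2 * C)); apply: cvgM; first exact: cvg_cst.
    by have := @cvg_harmonic R.
apply: cvg_unique lim1 _ => //.
by rewrite (_ : (fun n => _) = fun n => f n.+1%:R - f (- n.+1%:R))//; exact/funext.
Unshelve. all: by end_near. Qed.

(** The fundamental theorem of calculus between [y] and [x], where [y] is so far to
    the left that the decay of [f] makes [f y] at most 1. *)
Lemma le_Rintegral_derive f f' (C : R) x :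
  (forall t, is_derive t 1 f (f' t)) -> continuous f' ->
  (forall t, `|f t| <= C * cauchy t) -> (forall t, `|f' t| <= C * cauchy t) ->
  f x <= 1 + \int[leb]_t `|f' t|.
Proof.
move=> df cf' fC f'C.
have C0 := cauchy_bound_ge0 fC.
have if' : leb.-integrable setT (EFin \o f').
  by apply: integrable_cauchy_bound f'C; exact: continuous_measurable_fun.
pose y := - (`|x| + C + 1).
have yx : y < x.
  by rewrite ltrNl (le_lt_trans (ler_norm _))// normrN -addrA ltrDl ltr_wpDl.
have fy1 : f y <= 1.
  rewrite (le_trans (ler_norm _))// (le_trans (fC _))// /cauchy.
  rewrite ler_pdivrMr ?mul1r; last by rewrite ltr_pwDl// sqr_ge0.
  rewrite /y sqrrN; have := normr_ge0 x; nra.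
have iS : leb.-integrable `[y, x] (EFin \o f') by apply: integrableS if'.
have : f x - f y <= \int[leb]_t `|f' t|.
  rewrite -(Rintegral_derive df cf' yx) (le_trans (ler_norm _))//.
  rewrite (le_trans (le_normr_Rintegral _ _))//.
  rewrite /Rintegral fine_le//.
  - by apply: integrable_fin_num => //; exact: (integrable_norm iS).
  - by apply: integrable_fin_num => //; exact: (integrable_norm if').
  apply: ge0_subset_integral => //.
  apply/measurable_EFinP; apply: measurableT_comp => //.
  exact: continuous_measurable_fun.
lra.
Qed.

End cauchy.

(** * Hermite functions of one variable *)

Section gauss_poly.
Context (R : realType).
Implicit Types (t c : R) (p : {poly R}).

(** Since [1 + c t^2 <= expR (c t^2)], this reduces to an inequality between
    polynomials in [|t|]. *)
Lemma normr_gauss_le c t : 0 < c ->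
  `|t| * expR (- (c * t ^+ 2)) <= 1 + c^-1.
Proof.
move=> c0; rewrite expRN ler_pdivrMr ?expR_gt0//.
apply: (@le_trans _ _ ((1 + c^-1) * (1 + c * t ^+ 2))); last first.
  by rewrite ler_wpM2l ?expR_ge1Dx// addr_ge0// invr_ge0 ltW.
have ct : c^-1 * (c * t ^+ 2) = t ^+ 2 by rewrite mulKf// gt_eqF.
have c1 : 0 < c^-1 by rewrite invr_gt0.
rewrite mulrDl mul1r mulrDr mulr1 ct -[in leRHS]real_normK ?num_real//.
move: (`|t|) => u; have := sqr_ge0 (u - 1).
have : 0 <= c * u ^+ 2 by rewrite mulr_ge0 ?sqr_ge0 ?ltW.
rewrite sqrrB1; have := sqr_ge0 u; lra.
Qed.

(** One degree at a time: one half of the Gaussian absorbs the factor [t] and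
    the other half the remaining polynomial. *)
Lemma poly_gauss_bounded p c : 0 < c ->
  exists C : R, forall t, `|p.[t]| * expR (- (c * t ^+ 2)) <= C.
Proof.
elim/poly_ind: p c => [|p a IH] c c0.
  by exists 0 => t; rewrite horner0 normr0 mul0r.
have c20 : 0 < c / 2 by rewrite divr_gt0.
have [C pC] := IH _ c20; exists (C * (1 + (c / 2)^-1) + `|a|) => t.
rewrite hornerMXaddC.
apply: (@le_trans _ _ (`|p.[t] * t| * expR (- (c * t ^+ 2)) + `|a|)).
  have e0 := expR_ge0 (- (c * t ^+ 2)).
  have e1 : expR (- (c * t ^+ 2)) <= 1.
    by rewrite -expR0 ler_expR oppr_le0 mulr_ge0 ?sqr_ge0// ltW.
  rewrite (le_trans (ler_wpM2r e0 (ler_normD _ _)))// mulrDl lerD2l.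
  by rewrite ler_piMr.
rewrite lerD2r normrM.
have -> : - (c * t ^+ 2) = - (c / 2 * t ^+ 2) + - (c / 2 * t ^+ 2) by field.
rewrite expRD mulrACA.
by apply: ler_pM; rewrite ?mulr_ge0 ?expR_ge0//; exact: normr_gauss_le.
Qed.

End gauss_poly.

Section hermite1.
Context (R : realType).
Implicit Types (t : R) (k j : nat).
Local Notation leb := (@lebesgue_measure R).
Local Notation phi := (@hermite_fun1 R).

(** The coefficients of the ladder relations; the junk value [k.-1 = 0] at
    [k = 0] is harmless because [ladder 0 = 0]. *)
Definition ladder k : R := Num.sqrt (k%:R / 2).

Lemma ladder0 : ladder 0 = 0. Proof. by rewrite /ladder mul0r sqrtr0. Qed.

Lemma ladder_ge0 k : 0 <= ladder k. Proof. exact: sqrtr_ge0. Qed.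

Lemma ladder_gt0 k : 0 < ladder k.+1.
Proof. by rewrite sqrtr_gt0 divr_gt0. Qed.

Lemma sqr_ladder k : ladder k ^+ 2 = k%:R / 2.
Proof. by rewrite sqr_sqrtr// divr_ge0. Qed.

Lemma ladder_le k : ladder k <= k%:R.
Proof.
rewrite -(ler_pXn2r (n := 2))// ?nnegrE ?ladder_ge0// sqr_ladder.
case: k => [|k]; first by rewrite mul0r sqr_ge0.
rewrite ler_pdivrMr// expr2; have : 1 <= k.+1%:R :> R by rewrite ler1n.
nra.
Qed.

Lemma deriv_hermite_poly k :
  (hermite_poly R k)^`() = (hermite_poly R k.-1) *+ (2 * k).
Proof.
elim: k => [|k IH]; first by rewrite derivC muln0 mulr0n.
rewrite [hermite_poly R k.+1]/= derivB derivM derivMn derivX IH derivMn /=.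
case: k IH => [|k] IH /=; first by rewrite muln0 !mulr0n; ring.
rewrite -/(hermite_poly R k.+1) [hermite_poly R k.+1]/=; ring.
Qed.

Let norm k : R := (Num.sqrt (2 ^+ k * k`!%:R * Num.sqrt pi))^-1.

Let sqrt_pi_gt0 : 0 < Num.sqrt pi :> R.
Proof. by rewrite sqrtr_gt0 pi_gt0. Qed.

Let norm_ladder k : norm k = 2 * ladder k.+1 * norm k.+1.
Proof.
rewrite /norm; set a := 2 ^+ k * _ * _.
have a0 : 0 < a by rewrite !mulr_gt0// ?exprn_gt0// ltr0n fact_gt0.
have -> : 2 ^+ k.+1 * k.+1`!%:R * Num.sqrt pi = (2 * ladder k.+1) ^+ 2 * a.
  by rewrite exprMn sqr_ladder factS natrM exprS /a; field.
have l0 := ladder_gt0 k.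
rewrite [in RHS]sqrtrM ?sqr_ge0//.
have -> : Num.sqrt ((2 * ladder k.+1) ^+ 2) = 2 * ladder k.+1.
  by rewrite sqrtr_sqr gtr0_norm// mulr_gt0.
rewrite invfM mulrA divff ?mul1r// gt_eqF// mulr_gt0//.
Qed.

Let gauss t : R := expR (- (t ^+ 2 / 2)).

Let phiE k t : phi k t = norm k * (hermite_poly R k).[t] * gauss t.
Proof. by []. Qed.

Local Opaque hermite_fun1.

Let ladderS k t :
  ladder k.+1 * phi k.+1 t = norm k / 2 * (hermite_poly R k.+1).[t] * gauss t.
Proof. by rewrite phiE (norm_ladder k); field. Qed.

Let ladderP k t :
  ladder k * phi k.-1 t = norm k / 2 * ((hermite_poly R k)^`()).[t] * gauss t.
Proof.
rewrite deriv_hermite_poly; case: k => [|k].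
  by rewrite ladder0 muln0 mulr0n horner0; ring.
rewrite [k.+1.-1]/= phiE (norm_ladder k) hornerMn -[_.[t] *+ _]mulr_natr natrM.
transitivity (2 * ladder k.+1 ^+ 2 * norm k.+1 * (hermite_poly R k).[t] * gauss t).
  by ring.
by rewrite sqr_ladder; field.
Qed.

Lemma hermite1_mulX k t :
  t * phi k t = ladder k.+1 * phi k.+1 t + ladder k * phi k.-1 t.
Proof.
rewrite ladderS ladderP phiE [hermite_poly R k.+1]/=.
by rewrite hornerD hornerN hornerM hornerMn hornerX; field.
Qed.

Lemma is_derive_hermite1 k t : is_derive t 1 (phi k)
  (ladder k * phi k.-1 t - ladder k.+1 * phi k.+1 t).
Proof.
have d2 : is_derive t 1 (fun t : R => - (t ^+ 2 / 2)) (- t).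
  by apply: is_derive_eq; rewrite /GRing.scale/= mulr1; field.
have dg := @is_derive1_comp _ expR (fun t : R => - (t ^+ 2 / 2)) t _ _ (is_derive_expR (- (t ^+ 2 / 2))) d2.
have dp := is_derive_poly (norm k *: hermite_poly R k) t.
rewrite (_ : phi k = horner (norm k *: hermite_poly R k) * (expR \o (fun t => - (t ^+ 2 / 2)))); last first.
  by apply/funext => u; rewrite phiE /= fctE hornerZ.
apply: is_derive_eq.
rewrite ladderS ladderP [hermite_poly R k.+1]/= derivZ !hornerZ.
rewrite hornerD hornerN hornerM hornerMn hornerX.
by rewrite /GRing.scale/= -/(gauss t); field.
Qed.

Lemma continuous_hermite1 k : continuous (phi k).
Proof.
move=> t; apply: differentiable_continuous; apply/derivable1_diffP.
have ? := is_derive_hermite1 k t.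
exact: ex_derive.
Qed.

Lemma measurable_hermite1 k : measurable_fun [set: measurableTypeR R] (phi k).
Proof. by apply: continuous_measurable_fun; exact: continuous_hermite1. Qed.

Let hermite1_cauchy k : exists C : R, forall t, `|phi k t| <= C * cauchy t.
Proof.
have [C pC] := @poly_gauss_bounded R ((1 + 'X^2) * (norm k *: hermite_poly R k)) _
  (divr_gt0 ltr01 (ltr0n _ 2)).
exists C => t; rewrite /cauchy ler_pdivlMr; last by rewrite ltr_pwDl// sqr_ge0.
apply: le_trans (pC t); rewrite phiE hornerM hornerD hornerXn hornerZ hornerC.
rewrite normrM (ger0_norm (expR_ge0 _)) [in leRHS]normrM.
rewrite (@ger0_norm _ (1 + _)) ?addr_ge0 ?sqr_ge0//.
rewrite [leRHS]mulrAC [leRHS]mulrC mulrA /gauss.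
rewrite (_ : t ^+ 2 / 2 = 1 / 2 * t ^+ 2); last by rewrite mul1r mulrC.
by rewrite mulrAC.
Qed.

Let cauchyM (C D : R) (f g : R -> R) :
  (forall t, `|f t| <= C * cauchy t) -> (forall t, `|g t| <= D * cauchy t) ->
  forall t, `|f t * g t| <= C * D * cauchy t.
Proof.
move=> fC gD t; rewrite normrM.
have c0 := cauchy_gt0 t; have c1 := cauchy_le1 t.
have D0 := cauchy_bound_ge0 gD.
have C0 := cauchy_bound_ge0 fC.
apply: le_trans (ler_pM (normr_ge0 _) (normr_ge0 _) (fC t) (gD t)) _.
rewrite mulrACA ler_wpM2l ?mulr_ge0// ler_piMl// ltW//.
Qed.

Let I j k := \int[leb]_t (phi j t * phi k t).

Let dphi k t := ladder k * phi k.-1 t - ladder k.+1 * phi k.+1 t.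

Let continuous_dphi k : continuous (dphi k).
Proof.
by move=> t; apply: cvgB; apply: cvgM; try exact: cvg_cst; exact: continuous_hermite1.
Qed.

Let dphi_cauchy k : exists C : R, forall t, `|dphi k t| <= C * cauchy t.
Proof.
have [C kC] := hermite1_cauchy k.-1; have [D kD] := hermite1_cauchy k.+1.
exists (ladder k * C + ladder k.+1 * D) => t.
rewrite (le_trans (ler_normB _ _))// mulrDl.
rewrite [`|ladder k * _|]normrM [`|ladder k.+1 * _|]normrM.
by rewrite !(ger0_norm (ladder_ge0 _)) -!mulrA lerD// ler_wpM2l ?ladder_ge0.
Qed.

Let is_derive_phiM j k t : is_derive t 1 (fun t => phi j t * phi k t)
  (phi j t * dphi k t + phi k t * dphi j t).
Proof.
have dj := is_derive_hermite1 j t; have dk := is_derive_hermite1 k t.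
exact: is_deriveM.
Qed.

Let continuous_dphiM j k : continuous (fun t => phi j t * dphi k t + phi k t * dphi j t).
Proof.
by move=> t; apply: cvgD; apply: cvgM; try exact: continuous_hermite1;
  exact: continuous_dphi.
Qed.

Let phiM_cauchy j k : exists2 C : R, forall t, `|phi j t * phi k t| <= C * cauchy t &
  forall t, `|phi j t * dphi k t + phi k t * dphi j t| <= C * cauchy t.
Proof.
have [C1 jC] := hermite1_cauchy j; have [C2 kC] := hermite1_cauchy k.
have [D1 jD] := dphi_cauchy j; have [D2 kD] := dphi_cauchy k.
have C10 := cauchy_bound_ge0 jC; have C20 := cauchy_bound_ge0 kC.
have D10 := cauchy_bound_ge0 jD; have D20 := cauchy_bound_ge0 kD.
exists (C1 * C2 + (C1 * D2 + C2 * D1)) => t.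
  rewrite (le_trans (cauchyM jC kC t))// ler_wpM2r ?cauchy_ge0//.
  by rewrite lerDl addr_ge0 ?mulr_ge0.
rewrite (le_trans (ler_normD _ _))// mulrDl ler_wpDl ?mulr_ge0 ?cauchy_ge0//.
by rewrite mulrDl lerD//; exact: cauchyM.
Qed.

Lemma integrable_hermite1M j k :
  leb.-integrable setT (EFin \o (fun t => phi j t * phi k t)).
Proof.
have [C jkC _] := phiM_cauchy j k; apply: integrable_cauchy_bound jkC.
by apply: measurable_funM; exact: measurable_hermite1.
Qed.

Let lin4 (a b c e : R) (i1 j1 i2 j2 i3 j3 i4 j4 : nat) :
  \int[leb]_t (a * (phi i1 t * phi j1 t) + b * (phi i2 t * phi j2 t) +
    (c * (phi i3 t * phi j3 t) + e * (phi i4 t * phi j4 t))) =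
  a * I i1 j1 + b * I i2 j2 + (c * I i3 j3 + e * I i4 j4).
Proof.
have iZ x i j : leb.-integrable setT (EFin \o (fun t => x * (phi i t * phi j t))).
  exact: (integrableZl measurableT x (integrable_hermite1M i j)).
have iZ2 x y i j i' j' : leb.-integrable setT (EFin \o
    (fun t => x * (phi i t * phi j t) + y * (phi i' t * phi j' t))).
  exact: (integrableD measurableT (iZ x i j) (iZ y i' j')).
by rewrite RintegralD// !RintegralD// !RintegralZl//; exact: integrable_hermite1M.
Qed.

(** The integral of the derivative of [phi j * phi k] vanishes. *)
Let deriv_rel j k : ladder j * I j.-1 k + - ladder j.+1 * I j.+1 k +
  (ladder k * I j k.-1 + - ladder k.+1 * I j k.+1) = 0.
Proof.
have [C jkC bd] := phiM_cauchy j k.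
rewrite -lin4.
rewrite (_ : (fun t => _) = (fun t => phi j t * dphi k t + phi k t * dphi j t)); last first.
  by apply/funext => t; rewrite /dphi; ring.
exact: (Rintegral_derive_eq0 (is_derive_phiM j k) (@continuous_dphiM j k) jkC bd).
Qed.

(** Two expressions of the integral of [t * phi j * phi k], the factor [t] being
    given to [phi j] or to [phi k]. *)
Let mulX_rel j k : ladder j * I j.-1 k + ladder j.+1 * I j.+1 k +
  (- ladder k * I j k.-1 + - ladder k.+1 * I j k.+1) = 0.
Proof.
rewrite -lin4 (_ : (fun t => _) = (fun=> 0)) ?Rintegral_cst ?mul0r//.
apply/funext => t; have := hermite1_mulX j t; have := hermite1_mulX k t.
move=> kt jt.
transitivity (t * phi j t * phi k t - phi j t * (t * phi k t)); last by ring.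
by rewrite kt jt; ring.
Qed.

(** Adding the two relations leaves only two terms, and a recursion that ends
    with a Gaussian integral. *)
Let I_rec j k : ladder j.+1 * I j.+1 k = ladder k * I j k.-1.
Proof. by have := deriv_rel j k; have := mulX_rel j k; lra. Qed.

Let IC j k : I j k = I k j.
Proof. by rewrite /I; under eq_Rintegral do rewrite mulrC. Qed.

Let I0 : I 0 0 = 1.
Proof.
rewrite /I; under eq_Rintegral => t _.
  rewrite (_ : _ * _ = (Num.sqrt pi)^-1 * gauss_fun t); first over.
  rewrite phiE /norm expr0 mul1r fact0 mul1r /= hornerC mulr1 /gauss_fun.
  rewrite (_ : - t ^+ 2 = - (t ^+ 2 / 2) + - (t ^+ 2 / 2)); last by field.
  rewrite expRD /gauss; set e := expR _.
  have -> : (Num.sqrt pi)^-1 = (Num.sqrt (Num.sqrt pi))^-1 ^+ 2 :> R.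
    by rewrite exprVn sqr_sqrtr// ltW.
  by ring.
rewrite RintegralZl//; last exact: integrableT_gauss.
by rewrite /Rintegral integralT_gauss/= mulVf// gt_eqF.
Qed.

Lemma hermite1_orthonormal j k :
  \int[leb]_t (phi j t * phi k t) = (j == k)%:R.
Proof.
rewrite -/(I j k); elim: j k => [|j IH] [|k].
- exact: I0.
- rewrite IC; apply: (mulfI (lt0r_neq0 (ladder_gt0 k))).
  by rewrite I_rec ladder0 mul0r mulr0.
- apply: (mulfI (lt0r_neq0 (ladder_gt0 j))).
  by rewrite I_rec ladder0 mul0r mulr0.
- have [jk|jk] := eqVneq j k.
    subst k; apply: (mulfI (lt0r_neq0 (ladder_gt0 j))).
    by rewrite I_rec /= IH !eqxx.
  apply: (mulfI (lt0r_neq0 (ladder_gt0 j))).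
  by rewrite I_rec /= IH eqSS (negbTE jk) !mulr0.
Qed.

(** [phi^2 <= 1 + \int 2 |phi phi'| <= 1 + \int phi^2 + \int phi'^2], and the
    last integral is known from orthonormality. *)
Lemma hermite1_bound k t : `|phi k t| <= 3 * k.+1%:R.
Proof.
have [C kC bd] := phiM_cauchy k k; have cd := @continuous_dphiM k k.
have := le_Rintegral_derive t (is_derive_phiM k k) cd kC bd.
(* [2 |a d| <= a^2 + d^2] and [(B - Y)^2 <= 2 B^2 + 2 Y^2]; the last summand only
   fills the fourth place of [lin4] *)
have : \int[leb]_u `|phi k u * dphi k u + phi k u * dphi k u| <=
    \int[leb]_u (1 * (phi k u * phi k u) + k%:R * (phi k.-1 u * phi k.-1 u) +
     (k.+1%:R * (phi k.+1 u * phi k.+1 u) + 0 * (phi 0 u * phi 0 u))).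
  have iZ x i j : leb.-integrable setT (EFin \o (fun t => x * (phi i t * phi j t))).
    exact: (integrableZl measurableT x (integrable_hermite1M i j)).
  have iZ2 x y i j i' j' : leb.-integrable setT (EFin \o
      (fun t => x * (phi i t * phi j t) + y * (phi i' t * phi j' t))).
    exact: (integrableD measurableT (iZ x i j) (iZ y i' j')).
  apply: le_Rintegral => //.
  - have /integrable_norm := integrable_cauchy_bound
      (continuous_measurable_fun cd) bd; exact.
  - exact: (integrableD measurableT (iZ2 _ _ _ _ _ _) (iZ2 _ _ _ _ _ _)).
  move=> u _; set a := phi k u; set b := phi k.-1 u; set c := phi k.+1 u.
  rewrite /dphi -/a -/b -/c.
  have := sqr_ladder k; have := sqr_ladder k.+1.
  set x := ladder k; set y := ladder k.+1; rewrite ler_norml.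
  move=> hy hx; have -> : k%:R * (b * b) = 2 * (x * b) ^+ 2.
    by rewrite exprMn hx; field.
  have -> : k.+1%:R * (c * c) = 2 * (y * c) ^+ 2 by rewrite exprMn hy; field.
  move: (x * b) (y * c) => B Y.
  have := sqr_ge0 (a + (B - Y)); have := sqr_ge0 (a - (B - Y)).
  have := sqr_ge0 (B + Y); rewrite !expr2 mul0r => h1 h2 h3; apply/andP; split; nra.
rewrite lin4 -!/(I _ _) /I !hermite1_orthonormal !eqxx.
have -> : k.+1%:R = k%:R + 1 :> R by rewrite natr1.
move=> h1 h2.
rewrite -(ler_pXn2r (n := 2))// ?nnegrE ?mulr_ge0//.
rewrite real_normK ?num_real// expr2.
have k0 : 0 <= k%:R :> R by [].
have := le_trans h2 (lerD (lexx 1) h1).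
rewrite (_ : true%:R = 1 :> R)// !mulr1 addr0.
move: (phi k t * phi k t) => a; nra.
Qed.

Let ladder_hermite1_bound (c : R) (e k : nat) (f : nat -> R -> R) t : 0 <= c ->
  (forall j, `|f j t| <= c * j.+1%:R ^+ e) ->
  `|ladder k.+1 * f k.+1 t + ladder k * f k.-1 t| <=
  c * (2 ^+ e + 1) * k.+1%:R ^+ e.+1.
Proof.
move=> c0 fc; rewrite (le_trans (ler_normD _ _))// !normrM.
rewrite !(ger0_norm (ladder_ge0 _)) mulrDr mulrDl mulr1.
have k1 : 1 <= k.+1%:R :> R by rewrite ler1n.
apply: lerD.
  rewrite exprS mulrCA -!mulrA; apply: ler_pM; rewrite ?ladder_ge0 ?ladder_le//.
  rewrite (le_trans (fc _))// ler_wpM2l// -exprMn.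
  apply: lerXn2r; rewrite ?nnegrE ?mulr_ge0//.
  by rewrite -[k.+2]addn1 natrD; lra.
rewrite exprS mulrCA; apply: ler_pM; rewrite ?ladder_ge0//.
  by rewrite (le_trans (ladder_le _))// ler_nat.
rewrite (le_trans (fc _))// ler_wpM2l//.
by apply: lerXn2r; rewrite ?nnegrE// ler_nat; case: k {k1}.
Qed.

(** By the ladder relation a factor [t] costs one power of [k + 1]. Two of them
    give [|t^2 phi_k| <= 45 (k + 1)^3], with [9 = 3 (2 + 1)] after the first step
    and [45 = 9 (4 + 1)] after the second one; finally [3 + 45 <= 96]. *)
Lemma hermite1_decay k t : `|phi k t| <= 96 * k.+1%:R ^+ 3 * cauchy t.
Proof.
have b0 j : `|phi j t| <= 3 * j.+1%:R ^+ 1 by rewrite expr1; exact: hermite1_bound.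
have b1 j : `|t * phi j t| <= 9 * j.+1%:R ^+ 2.
  rewrite hermite1_mulX (le_trans (ladder_hermite1_bound _ _ b0))//.
  by rewrite ler_wpM2r// expr1; lra.
have b2 : `|t ^+ 2 * phi k t| <= 45 * k.+1%:R ^+ 3.
  rewrite expr2 -mulrA hermite1_mulX mulrDr mulrCA [t * (_ * phi k.-1 t)]mulrCA.
  rewrite (le_trans (ladder_hermite1_bound (f := fun j t => t * phi j t) _ _ b1))//.
  by rewrite ler_wpM2r//; lra.
rewrite /cauchy ler_pdivlMr; last by rewrite ltr_pwDl// sqr_ge0.
rewrite -[X in _ * X]ger0_norm ?addr_ge0 ?sqr_ge0// -normrM mulrDr mulr1.
rewrite (le_trans (ler_normD _ _))// [phi k t * _]mulrC.
have k1 : 1 <= k.+1%:R :> R by rewrite ler1n.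
have : `|phi k t| <= 3 * k.+1%:R ^+ 3.
  rewrite (le_trans (hermite1_bound _ _))// ler_wpM2l// ler_eXnr//.
have : 0 <= k.+1%:R ^+ 3 :> R by [].
move: b2; move: (k.+1%:R ^+ 3) => m; lra.
Qed.

End hermite1.

(** * Integration on [R^n] *)

Section rV_integration.
Context (R : realType).
Local Notation leb := (@lebesgue_measure R).
Local Notation mu n := (lebesgue_rV R n).

Lemma rV_cons0 n (t : R) (x : 'rV[R]_n) : rV_cons (t, x) ord0 ord0 = t.
Proof. by have /(congr1 fst) := rV_consK (t, x). Qed.

Lemma rV_consS n (t : R) (x : 'rV[R]_n) j :
  rV_cons (t, x) ord0 (lift ord0 j) = x ord0 j.
Proof.
rewrite (_ : lift ord0 j = rshift 1 j); last exact/val_inj.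
by rewrite [LHS]row_mxEr.
Qed.

Lemma measurable_fun_slice n d (S : measurableType d) (f : 'rV[R]_n.+1 -> S) t :
  measurable_fun setT f -> measurable_fun setT (fun x => f (rV_cons (t, x))).
Proof.
move=> mf; apply: (measurableT_comp mf).
apply: measurableT_comp; first exact: measurable_rV_cons.
exact: measurable_pair1.
Qed.

Lemma measurable_fun_rV_cons n d (S : measurableType d) (f : 'rV[R]_n.+1 -> S) :
  measurable_fun setT f ->
  measurable_fun [set: measurableTypeR R * 'rV[R]_n] (f \o @rV_cons R n).
Proof.
by move=> mf; apply: (measurableT_comp mf); exact: measurable_rV_cons.
Qed.

Lemma ge0_integral_rV_cons n (f : 'rV[R]_n.+1 -> \bar R) :
  measurable_fun setT f -> (forall x, 0 <= f x)%E ->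
  (\int[mu n.+1]_x f x = \int[leb]_t \int[mu n]_x f (rV_cons (t, x)))%E.
Proof.
move=> mf f0.
rewrite [LHS](@ge0_integral_pushforward _ _ (measurableTypeR R * 'rV[R]_n)%type
  _ R (@rV_cons R n) (@measurable_rV_cons R n) (leb \x mu n)%E)//.
rewrite preimage_setT.
rewrite (@fubini_tonelli1 _ _ (measurableTypeR R) _ R leb (mu n) (f \o @rV_cons R n))//.
  exact: measurable_fun_rV_cons.
by move=> x; exact: f0.
Qed.

Let integrable_cons n (f : 'rV[R]_n.+1 -> \bar R) :
  (mu n.+1).-integrable setT f ->
  (leb \x mu n)%E.-integrable setT (f \o @rV_cons R n).
Proof.
move=> /integrableP[mf foo].
have mf' := measurable_fun_rV_cons mf.
apply/(@integrable12ltyP _ _ (measurableTypeR R) 'rV[R]_n R leb (mu n) _ mf').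
rewrite -(ge0_integral_rV_cons (f := abse \o f))//; first exact: measurableT_comp.
by move=> x; exact: abse_ge0.
Qed.

Lemma integral_rV_cons n (f : 'rV[R]_n.+1 -> \bar R) :
  (mu n.+1).-integrable setT f ->
  (\int[mu n.+1]_x f x = \int[leb]_t \int[mu n]_x f (rV_cons (t, x)))%E.
Proof.
move=> intf; have mf := measurable_int _ intf.
rewrite [LHS](@integral_pushforward _ _ (measurableTypeR R * 'rV[R]_n)%type
  _ R (@rV_cons R n) (@measurable_rV_cons R n) (leb \x mu n)%E _ _ mf)//; last first.
  by rewrite preimage_setT; exact: integrable_cons.
by rewrite preimage_setT -integral12_prod_meas1//; exact: integrable_cons.
Qed.

Lemma integral_rV_cons_swap n (f : 'rV[R]_n.+1 -> \bar R) :
  (mu n.+1).-integrable setT f ->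
  (\int[mu n.+1]_x f x = \int[mu n]_x \int[leb]_t f (rV_cons (t, x)))%E.
Proof.
move=> intf; rewrite integral_rV_cons//.
exact: (Fubini (integrable_cons intf)).
Qed.

Lemma integral_rV0 (f : 'rV[R]_0 -> \bar R) : measurable_fun setT f ->
  (\int[mu 0]_x f x)%E = f 0.
Proof. by move=> mf; rewrite [LHS]integral_dirac// diracT mul1e. Qed.

Definition tensor n (f : 'I_n -> R -> R) (x : 'rV[R]_n) : R :=
  \prod_i f i (x ord0 i).

Lemma tensor_cons n (f : 'I_n.+1 -> R -> R) t x :
  tensor f (rV_cons (t, x)) = f ord0 t * tensor (fun j => f (lift ord0 j)) x.
Proof.
rewrite /tensor big_ord_recl rV_cons0; congr (_ * _).
by apply: eq_bigr => j _; rewrite rV_consS.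
Qed.

Lemma tensor_ge0 n (f : 'I_n -> R -> R) x :
  (forall i t, 0 <= f i t) -> 0 <= tensor f x.
Proof. by move=> f0; apply: prodr_ge0 => i _; exact: f0. Qed.

Lemma measurable_tensor n (f : 'I_n -> R -> R) :
  (forall i, measurable_fun setT (f i)) -> measurable_fun setT (tensor f).
Proof.
move=> mf; apply: measurable_prod => i _.
by apply: (measurableT_comp (mf i)); exact: measurable_coord.
Qed.

Lemma integrable_tensor n (f : 'I_n -> R -> R) :
  (forall i, measurable_fun [set: R] (f i)) ->
  (forall i, leb.-integrable setT (EFin \o f i)) ->
  (mu n).-integrable setT (EFin \o tensor f).
Proof.
move=> mf intf; apply/integrableP; split.
  by apply/measurable_EFinP; exact: measurable_tensor.
elim: n f mf intf => [|n IH] f mf intf.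
  rewrite integral_rV0 ?ltry//.
  by do 2 apply: measurableT_comp => //; exact: measurable_tensor.
rewrite ge0_integral_rV_cons//; last first.
  by do 2 apply: measurableT_comp => //; exact: measurable_tensor.
set g := fun j => f (lift ord0 j).
have mg j : measurable_fun [set: R] (g j) by exact: mf.
have ig := IH g mg (fun j => intf _).
rewrite (_ : (fun t => _) = fun t : R => (`|f ord0 t|%:E * \int[mu n]_x `|(tensor g x)%:E|)%E).
  rewrite ge0_integralZr//.
  - apply: lte_mul_pinfty; first exact: integral_ge0.
      rewrite ge0_fin_numE; last exact: integral_ge0.
      by have /integrableP[] := intf ord0.
    exact: ig.
  - by do 2 apply: measurableT_comp => //; have /integrableP[/measurable_EFinP] := intf ord0.
  - exact: integral_ge0.
apply/funext => t; under eq_integral => x _.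
  rewrite /= tensor_cons normrM EFinM; over.
rewrite ge0_integralZl//.
by do 2 apply: measurableT_comp => //; exact: measurable_tensor.
Qed.

Lemma Rintegral_tensor n (f : 'I_n -> R -> R) :
  (forall i, measurable_fun [set: R] (f i)) ->
  (forall i, leb.-integrable setT (EFin \o f i)) ->
  \int[mu n]_x tensor f x = \prod_i \int[leb]_t f i t.
Proof.
elim: n f => [|n IH] f mf intf.
  rewrite big_ord0 /Rintegral integral_rV0/= ?/tensor ?big_ord0//.
  by apply/measurable_EFinP; exact: measurable_tensor.
set g := fun j => f (lift ord0 j).
have mg j : measurable_fun [set: R] (g j) by exact: mf.
have ig j : leb.-integrable setT (EFin \o g j) by exact: intf.
rewrite big_ord_recl -(IH g mg ig) /Rintegral.
rewrite integral_rV_cons; last exact: (integrable_tensor mf intf).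
have -> : (\int[leb]_t \int[mu n]_x (tensor f (rV_cons (t, x)))%:E =
    \int[leb]_t ((f ord0 t)%:E * \int[mu n]_x (tensor g x)%:E))%E.
  apply: eq_integral => t _; under eq_integral => x _.
    rewrite tensor_cons EFinM; over.
  by rewrite integralZl//; exact: integrable_tensor.
have fg : (\int[mu n]_x (tensor g x)%:E)%E \is a fin_num.
  by apply: integrable_fin_num => //; exact: integrable_tensor.
rewrite -(fineK fg) (integralZr measurableT (intf ord0)) fineM//.
exact: (integrable_fin_num measurableT (intf ord0)).
Qed.

(** The product of the Cauchy densities is the majorant against which all
    functions on [R^n] are integrated. *)
Definition weight n : 'rV[R]_n -> R := tensor (fun _ => @cauchy R).

Lemma weight_ge0 n (x : 'rV[R]_n) : 0 <= weight x.
Proof. by apply: tensor_ge0 => _ t; exact: cauchy_ge0. Qed.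

Lemma weight_gt0 n (x : 'rV[R]_n) : 0 < weight x.
Proof. by apply: prodr_gt0 => i _; exact: cauchy_gt0. Qed.

Lemma weight_le1 n (x : 'rV[R]_n) : weight x <= 1.
Proof. by apply: prodr_ile1 => i _; rewrite cauchy_ge0 cauchy_le1. Qed.

Lemma measurable_weight n : measurable_fun setT (@weight n).
Proof. by apply: measurable_tensor => _; exact: measurable_cauchy. Qed.

Lemma integrable_weight n : (mu n).-integrable setT (EFin \o @weight n).
Proof.
apply: integrable_tensor => _; first exact: measurable_cauchy.
exact: integrable_cauchy.
Qed.

Lemma integrable_weight_bound n (f : 'rV[R]_n -> R) (C : R) :
  measurable_fun setT f -> (forall x, `|f x| <= C * weight x) ->
  (mu n).-integrable setT (EFin \o f).
Proof.
move=> mf fC; apply: (@integrable_dominated _ _ _ (mu n) f (fun x => C * weight x)) => //.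
exact: (integrableZl measurableT C (integrable_weight n)).
Qed.

Lemma weight_bound_ge0 n (f : 'rV[R]_n -> R) (C : R) :
  (forall x, `|f x| <= C * weight x) -> 0 <= C.
Proof.
move=> /(_ 0) fC; have := le_trans (normr_ge0 _) fC.
by rewrite pmulr_lge0// weight_gt0.
Qed.

Lemma integral_Rintegral0 d (T : measurableType d)
  (m : {measure set T -> \bar R}) (f : T -> R) :
  m.-integrable setT (EFin \o f) -> \int[m]_x f x = 0 -> (\int[m]_x (f x)%:E = 0)%E.
Proof.
by move=> intf f0; rewrite -[LHS]fineK ?[fine _]f0//; exact: integrable_fin_num.
Qed.

Lemma rV_cons_add0 n (t h : R) (x : 'rV[R]_n) :
  rV_cons (t, x) + h *: delta_mx ord0 ord0 = rV_cons (t + h, x).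
Proof.
apply/rowP => k; rewrite [LHS]mxE [X in _ + X]mxE [X in _ + _ * X]mxE eqxx /=.
case: (unliftP ord0 k) => [l ->|->]; first by rewrite !rV_consS mulr0 addr0.
by rewrite !rV_cons0 eqxx mulr1.
Qed.

Lemma rV_cons_addS n (t h : R) (x : 'rV[R]_n) j :
  rV_cons (t, x) + h *: delta_mx ord0 (lift ord0 j) =
  rV_cons (t, x + h *: delta_mx ord0 j).
Proof.
apply/rowP => k; rewrite [LHS]mxE [X in _ + X]mxE [X in _ + _ * X]mxE eqxx /=.
case: (unliftP ord0 k) => [l ->|->]; last by rewrite !rV_cons0 mulr0 addr0.
by rewrite !rV_consS (inj_eq lift_inj) !mxE eqxx.
Qed.

Lemma is_derive_shift (f : R -> R) (t d : R) :
  is_derive (0 : R) 1 (fun h => f (t + h)) d -> is_derive t 1 f d.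
Proof.
move=> df.
have dB : is_derive t 1 (fun s : R => s - t) (1 - 0) by apply: is_deriveB.
have df' : is_derive (t - t) 1 (fun h => f (t + h)) d by rewrite subrr.
have := @is_derive1_comp _ (fun h => f (t + h)) (fun s : R => s - t) t _ _ df' dB.
rewrite subr0 mulr1; congr (is_derive _ _ _ _).
by apply/funext => s /=; rewrite addrC subrK.
Qed.

(** A partial derivative has zero integral: by Fubini, one integrates first in
    the variable of differentiation, or applies the result in lower dimension
    to the slices. The hypotheses are chosen so as to be inherited by slices. *)
Lemma Rintegral_partial_eq0 n (i : 'I_n) (G G' : 'rV[R]_n -> R) (C : R) :
  (forall x, is_derive (0 : R) 1 (fun h : R => G (x + h *: delta_mx ord0 i)) (G' x)) ->
  (forall x, continuous (fun h : R => G' (x + h *: delta_mx ord0 i))) ->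
  measurable_fun setT G' ->
  (forall x, `|G x| <= C * weight x) -> (forall x, `|G' x| <= C * weight x) ->
  \int[mu n]_x G' x = 0.
Proof.
elim: n i G G' C => [[]//|n IH] i G G' C dG cG' mG' GC G'C.
have C0 := weight_bound_ge0 GC.
have intG' : (mu n.+1).-integrable setT (EFin \o G').
  exact: integrable_weight_bound mG' G'C.
case: (unliftP ord0 i) dG cG' => [j ->|->] dG cG'.
  rewrite /Rintegral integral_rV_cons// integral0_eq// => t _.
  have mS := measurable_fun_slice t mG'.
  have SC (F : 'rV[R]_n.+1 -> R) : (forall x, `|F x| <= C * weight x) ->
      forall x, `|F (rV_cons (t, x))| <= C * weight x.
    move=> FC x; rewrite (le_trans (FC _))// ler_wpM2l// /weight tensor_cons.
    by rewrite ler_piMl ?cauchy_le1// weight_ge0.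
  apply: integral_Rintegral0; first exact: integrable_weight_bound mS (SC _ G'C).
  apply: (IH j (fun x => G (rV_cons (t, x))) _ C) => //; try exact: SC.
  - move=> x; have := dG (rV_cons (t, x)).
    by under eq_fun do rewrite rV_cons_addS.
  - move=> x; have := cG' (rV_cons (t, x)).
    by under eq_fun do rewrite rV_cons_addS.
rewrite /Rintegral integral_rV_cons_swap// integral0_eq// => x _.
have mS : measurable_fun [set: measurableTypeR R] (fun t => G' (rV_cons (t, x))).
  apply: (measurableT_comp mG'); apply: measurableT_comp; last exact: measurable_pair2.
  exact: measurable_rV_cons.
have SC (F : 'rV[R]_n.+1 -> R) : (forall x, `|F x| <= C * weight x) ->
    forall t, `|F (rV_cons (t, x))| <= C * cauchy t.
  move=> FC t; rewrite (le_trans (FC _))// ler_wpM2l// /weight tensor_cons.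
  by rewrite ler_piMr ?cauchy_ge0// weight_le1.
apply: integral_Rintegral0; first exact: integrable_cauchy_bound mS (SC _ G'C).
apply: (@Rintegral_derive_eq0 R (fun t => G (rV_cons (t, x))) _ C); try exact: SC.
- move=> t; apply: is_derive_shift; have := dG (rV_cons (t, x)).
  by under eq_fun do rewrite rV_cons_add0.
- move=> t; have := cG' (rV_cons (0, x)) t.
  by under eq_fun do rewrite rV_cons_add0 add0r.
Qed.

End rV_integration.

(** * Hermite functions on [R^n] *)

Section continuous_rV.
Context (R : realType) (n : nat).
Implicit Types (f g : 'rV[R]_n -> R) (x v : 'rV[R]_n).

(** The sigma-algebra of [R^n] is generated by the coordinates, and not by the
    open sets. A continuous function is the pointwise limit of its
    discretizations on the grids of mesh [(N + 1)^-1], each of which is constant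
    on countably many boxes. *)
Lemma measurable_continuous_rV f : continuous f -> measurable_fun setT f.
Proof.
move=> cf.
pose grid (N : nat) (z : 'rV[int]_n) : 'rV[R]_n :=
  \row_i ((z ord0 i)%:~R / N.+1%:R).
pose disc N x : 'rV[int]_n := \row_i Num.floor (N.+1%:R * x ord0 i).
apply: (measurable_fun_cvg (h := fun N x => f (grid N (disc N x)))).
- move=> N _ A mA; rewrite setTI.
  have -> : (fun x => f (grid N (disc N x))) @^-1` A =
      \bigcup_(z : 'rV[int]_n) (if `[< A (f (grid N z)) >] then
        \bigcap_(i in [set: 'I_n]) [set x : 'rV[R]_n | Num.floor (N.+1%:R * x ord0 i) = z ord0 i]
      else set0).
    apply/seteqP; split => [x /= Ax|x [z _]].
      exists (disc N x) => //; rewrite asboolT//.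
      by move=> i _ /=; rewrite mxE.
    case: ifPn => // /asboolP Az xz /=.
    rewrite (_ : disc N x = z)//; by apply/rowP => i; rewrite mxE; exact: xz.
  apply: countable_bigcupT_measurable; first exact: countableP.
  move=> z; case: ifPn => // _; apply: fin_bigcap_measurable => // i _.
  have mM : measurable_fun setT (fun x : 'rV[R]_n => N.+1%:R * x ord0 i).
    by apply: measurable_funM => //; exact: measurable_coord.
  rewrite (_ : [set x | _] = setT `&` (fun x : 'rV[R]_n => N.+1%:R * x ord0 i) @^-1`
      `[(z ord0 i)%:~R, (z ord0 i + 1)%:~R[); first exact: mM.
  rewrite setTI; apply/seteqP; split => x /=; rewrite in_itv/= => h.
    by rewrite -h floor_itv.
  exact: floor_def.
- move=> x _; apply: (@cvg_comp _ _ _ (fun N => grid N (disc N x)) f _ (nbhs x)); last exact: cf.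
  apply/cvg_ballP => e e0; near=> N; split => // i j.
  rewrite !mxE !(ord1 i) /ball/= distrC.
  have N0 : 0 < N.+1%:R :> R by [].
  have := floor_itv (N.+1%:R * x ord0 j); move: (Num.floor _) => z /andP[z1 z2].
  rewrite (_ : z%:~R / _ - _ = - ((N.+1%:R * x ord0 j - z%:~R) / N.+1%:R)); last by field.
  rewrite normrN normrM normfV !ger0_norm ?subr_ge0//.
  rewrite ltr_pdivrMr// (@lt_trans _ _ 1)//.
    by rewrite ltrBlDl -[1]/(1%:~R) -intrD.
  rewrite -ltr_pdivrMl// mulr1 (lt_trans (y := N%:R)) ?ltr_nat//.
  near: N; exact: nbhs_infty_gtr.
Unshelve. all: by end_near. Qed.

Lemma is_derive_line f x v (d : R) :
  is_derive (0 : R) 1 (fun h : R => f (x + h *: v)) d <-> is_derive x v f d.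
Proof.
have E : (fun h : R => h^-1 *: (((fun h : R => f (x + h *: v)) \o shift 0) (h *: (1 : R)) -
    (fun h : R => f (x + h *: v)) 0)) =
    (fun h : R => h^-1 *: ((f \o shift x) (h *: v) - f x)).
  by apply/funext => h /=; rewrite addr0 [h%:A]mulr1 scale0r addr0 [x + _]addrC.
have E1 : derivable (fun h : R => f (x + h *: v)) 0 (1 : R) = derivable f x v.
  exact: (congr1 (fun F : R -> R => cvg (F @ 0^')) E).
have E2 : 'D_(1 : R) (fun h : R => f (x + h *: v)) 0 = 'D_v f x.
  exact: (congr1 (fun F : R -> R => lim (F @ 0^')) E).
by split=> -[c l]; split; rewrite -?l ?E1 ?E2// -?E1 -?E2.
Qed.

Lemma continuousM_rV f g : continuous f -> continuous g ->
  continuous (fun x => f x * g x).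
Proof. by move=> cf cg x; exact: (cvgM (cf x) (cg x)). Qed.

Lemma continuousD_rV f g : continuous f -> continuous g ->
  continuous (fun x => f x + g x).
Proof. by move=> cf cg x; exact: (cvgD (cf x) (cg x)). Qed.

Lemma continuousZ_rV (c : R) f : continuous f -> continuous (fun x => c * f x).
Proof. by move=> cf x; exact: (cvgM (cvg_cst _) (cf x)). Qed.

Lemma continuous_prod_rV (I : finType) (P : pred I) (F : I -> 'rV[R]_n -> R) :
  (forall i, continuous (F i)) -> continuous (fun x => \prod_(i | P i) F i x).
Proof.
move=> cF; apply: continuous_big => // -[a b].
by apply: (@cvgM _ _ _ _ fst snd); [exact: cvg_fst|exact: cvg_snd].
Qed.

Lemma continuous_sum_rV (I : Type) (s : seq I) (F : I -> 'rV[R]_n -> R) :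
  (forall i, continuous (F i)) -> continuous (fun x => \sum_(i <- s) F i x).
Proof.
move=> cF; apply: continuous_big => // -[a b].
by apply: (@cvgD _ _ _ _ _ fst snd); [exact: cvg_fst|exact: cvg_snd].
Qed.

End continuous_rV.

Section hermite_rV.
Context (R : realType) (n : nat).
Implicit Types (nu mu : {ffun 'I_n -> nat}) (x : 'rV[R]_n) (i : 'I_n) (k : nat).
Local Notation Phi := (@hermite_fun R n).
Local Notation phi := (@hermite_fun1 R).
Local Notation leb := (@lebesgue_measure R).

Definition upd i k nu : {ffun 'I_n -> nat} :=
  [ffun j => if j == i then k else nu j].

Lemma upd_same i k nu : upd i k nu i = k.
Proof. by rewrite ffunE eqxx. Qed.

Lemma upd_id i nu : upd i (nu i) nu = nu.
Proof. by apply/ffunP => j; rewrite ffunE; case: eqP => [->|]. Qed.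

Lemma upd_upd i k l nu : upd i k (upd i l nu) = upd i k nu.
Proof. by apply/ffunP => j; rewrite !ffunE; case: eqP. Qed.

Lemma hermite_upd i k nu x :
  Phi (upd i k nu) x = phi k (x ord0 i) * \prod_(j | j != i) phi (nu j) (x ord0 j).
Proof.
rewrite /hermite_fun (bigD1 i)//= upd_same; congr (_ * _).
by apply: eq_bigr => j ji; rewrite ffunE (negbTE ji).
Qed.

Lemma hermite_mulX i nu x : x ord0 i * Phi nu x =
  ladder R (nu i).+1 * Phi (upd i (nu i).+1 nu) x +
  ladder R (nu i) * Phi (upd i (nu i).-1 nu) x.
Proof.
rewrite -{1}[nu](upd_id i) !hermite_upd mulrA hermite1_mulX; ring.
Qed.

Lemma is_derive_hermite i nu x : is_derive x (delta_mx ord0 i) (Phi nu)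
  (ladder R (nu i) * Phi (upd i (nu i).-1 nu) x -
   ladder R (nu i).+1 * Phi (upd i (nu i).+1 nu) x).
Proof.
apply/is_derive_line; set c := \prod_(j | j != i) phi (nu j) (x ord0 j).
rewrite (_ : (fun h => _) = (fun h : R => c * phi (nu i) (x ord0 i + h))); last first.
  apply/funext => h; rewrite -{1}[nu](upd_id i) hermite_upd mulrC; congr (_ * _).
    apply: eq_bigr => j ji; rewrite !mxE (negbTE ji).
    by rewrite andbF mulr0 addr0.
  by rewrite !mxE !eqxx mulr1.
rewrite !hermite_upd -/c.
have d1 : is_derive (0 : R) 1 (fun h : R => x ord0 i + h) (0 + 1) by apply: is_deriveD.
have d2 := is_derive_hermite1 (nu i) (x ord0 i + 0).
have := @is_derive1_comp _ (phi (nu i)) (fun h : R => x ord0 i + h) 0 _ _ d2 d1.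
move=> /(is_deriveZ c) d3; apply: is_derive_eq.
by rewrite /GRing.scale/= addr0; ring.
Qed.

Lemma continuous_hermite nu : continuous (Phi nu).
Proof.
apply: continuous_prod_rV => i x.
apply: (@cvg_comp _ _ _ (fun x : 'rV[R]_n => x ord0 i) (phi (nu i))).
  exact: coord_continuous.
exact: continuous_hermite1.
Qed.

Lemma measurable_hermite nu : measurable_fun setT (Phi nu).
Proof. by apply: measurable_continuous_rV; exact: continuous_hermite. Qed.

(** Only the polynomial growth in [nu] matters. *)
Definition hermite_cst nu : R := \prod_i (96 * (nu i).+1%:R ^+ 3).

Lemma hermite_cst_ge0 nu : 0 <= hermite_cst nu.
Proof. by apply: prodr_ge0 => i _; rewrite mulr_ge0// exprn_ge0. Qed.

Lemma hermite_decay nu x : `|Phi nu x| <= hermite_cst nu * weight x.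
Proof.
rewrite /hermite_fun normr_prod /hermite_cst /weight /tensor -big_split/=.
by apply: ler_prod => i _; rewrite normr_ge0 hermite1_decay.
Qed.

Lemma hermite_bound nu x : `|Phi nu x| <= hermite_cst nu.
Proof.
rewrite (le_trans (hermite_decay _ _))// ler_piMr ?hermite_cst_ge0//.
exact: weight_le1.
Qed.

Lemma hermite_orthonormal nu mu :
  \int[lebesgue_rV R n]_x (Phi nu x * Phi mu x) = (nu == mu)%:R.
Proof.
pose f i t := phi (nu i) t * phi (mu i) t.
have -> : (fun x => Phi nu x * Phi mu x) = tensor f.
  by apply/funext => x; rewrite /hermite_fun -big_split.
rewrite Rintegral_tensor; last 2 first.
- by move=> i; apply: measurable_funM; exact: measurable_hermite1.
- by move=> i; exact: integrable_hermite1M.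
rewrite (eq_bigr (fun i => (nu i == mu i)%:R)); last first.
  by move=> i _; rewrite hermite1_orthonormal.
have [->|/eqP numu] := eqVneq nu mu; first by rewrite big1// => i _; rewrite eqxx.
have [i /eqP/negbTE ni] : exists i, nu i <> mu i.
  by apply: contrapT => /forallNP h; apply: numu; apply/ffunP => i; exact: contrapT (h i).
by rewrite (bigD1 i)//= ni mul0r.
Qed.

(** By the ladder relations this class is stable under partial derivatives and
    under multiplication by the coordinates, so that for its members the
    conditions on Schwartz functions reduce to boundedness. *)
Definition hermite_span (f : 'rV[R]_n -> R) := exists s : seq (R * {ffun 'I_n -> nat}),
  f = fun x => \sum_(p <- s) p.1 * Phi p.2 x.

Lemma hermite_span1 nu : hermite_span (Phi nu).
Proof. by exists [:: (1, nu)]; apply/funext => x; rewrite big_seq1 mul1r. Qed.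

Lemma hermite_span_flatten f (s : seq (R * {ffun 'I_n -> nat})) g :
  (forall nu, hermite_span (g nu)) ->
  (forall x, f x = \sum_(p <- s) p.1 * g p.2 x) -> hermite_span f.
Proof.
move=> sg; elim: s f => [|p s IH] f fE.
  by exists [::]; apply/funext => x; rewrite fE !big_nil.
have [t tE] := IH _ (fun x => erefl).
have [u uE] := sg p.2.
exists ([seq (p.1 * q.1, q.2) | q <- u] ++ t); apply/funext => x.
rewrite fE big_cons big_cat/= big_map -(congr1 (@^~ x) tE) uE mulr_sumr.
by congr (_ + _); apply: eq_bigr => q _; rewrite mulrA.
Qed.

Lemma is_derive_hermite_span (s : seq (R * {ffun 'I_n -> nat})) i x :
  is_derive x (delta_mx ord0 i) (fun x => \sum_(p <- s) p.1 * Phi p.2 x)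
  (\sum_(p <- s) p.1 * (ladder R (p.2 i) * Phi (upd i (p.2 i).-1 p.2) x -
   ladder R (p.2 i).+1 * Phi (upd i (p.2 i).+1 p.2) x)).
Proof.
elim: s => [|p s IH].
  under eq_fun do rewrite big_nil; rewrite big_nil; exact: is_derive_cst.
under eq_fun do rewrite big_cons; rewrite big_cons.
apply: (@is_deriveD _ _ _ (fun x => p.1 * Phi p.2 x)
  (fun x => \sum_(j <- s) j.1 * Phi j.2 x)).
by apply: is_deriveZ; exact: is_derive_hermite.
Qed.

Lemma partial_hermite_span i f : hermite_span f -> hermite_span (partial i f).
Proof.
move=> [s ->].
apply: (@hermite_span_flatten _ s (fun nu x => ladder R (nu i) * Phi (upd i (nu i).-1 nu) x -
   ladder R (nu i).+1 * Phi (upd i (nu i).+1 nu) x)).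
  move=> nu; exists [:: (ladder R (nu i), upd i (nu i).-1 nu); (- ladder R (nu i).+1, upd i (nu i).+1 nu)].
  by apply/funext => x; rewrite big_cons big_seq1/= mulNr.
by move=> x; rewrite /partial; have := is_derive_hermite_span s i x => ds; rewrite derive_val.
Qed.

Lemma mulX_hermite_span i f : hermite_span f -> hermite_span (fun x => x ord0 i * f x).
Proof.
move=> [s ->].
apply: (@hermite_span_flatten _ s (fun nu x => x ord0 i * Phi nu x)).
  move=> nu; exists [:: (ladder R (nu i).+1, upd i (nu i).+1 nu); (ladder R (nu i), upd i (nu i).-1 nu)].
  by apply/funext => x; rewrite big_cons big_seq1/= hermite_mulX.
by move=> x; rewrite mulr_sumr; apply: eq_bigr => p _; rewrite mulrCA.
Qed.

Lemma hermite_span_bounded f : hermite_span f ->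
  exists M : R, forall x, `|f x| <= M.
Proof.
move=> [s ->]; exists (\sum_(p <- s) `|p.1| * hermite_cst p.2) => x.
rewrite (le_trans (ler_norm_sum _ _ _))//; apply: ler_sum => p _.
by rewrite normrM ler_wpM2l// hermite_bound.
Qed.

Lemma hermite_span_schwartz f : hermite_span f -> real_schwartz f.
Proof.
move=> sf; have partialsP s : hermite_span (partials s f).
  by elim: s => [//|i s IH] /=; exact: partial_hermite_span.
split=> [s|a s].
  have [t ->] := partialsP s; split=> [|i x].
    apply: continuous_sum_rV => p; apply: continuousZ_rV.
    exact: continuous_hermite.
  have := is_derive_hermite_span t i x => dt; exact: ex_derive.
apply: hermite_span_bounded.
suff H (r : seq 'I_n) : hermite_span (fun x => (\prod_(i <- r) x ord0 i ^+ a i) * partials s f x).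
  exact: H.
elim: r => [|i r IH]; first by under eq_fun do rewrite big_nil mul1r.
under eq_fun do rewrite big_cons -mulrA.
elim: (a i) => [|k IHk]; first by under eq_fun do rewrite mul1r.
under eq_fun do rewrite exprS -mulrA; exact: mulX_hermite_span.
Qed.

End hermite_rV.

(** * Completeness of the Hermite functions *)

Section approximable.
Context (R : realType).
Implicit Types (h : R -> R) (t b lam eps : R) (p : {poly R}).
Local Notation phi := (@hermite_fun1 R).

Definition hermite1_comb (s : seq (R * nat)) t : R :=
  \sum_(q <- s) q.1 * phi q.2 t.

(** Orthogonality to all Hermite functions passes to these uniform limits. *)
Definition approximable h := forall eps, 0 < eps ->
  exists s, forall t, `|h t - hermite1_comb s t| <= eps.

Lemma approximable_limit h :
  (forall eps, 0 < eps ->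
    exists2 g, approximable g & forall t, `|h t - g t| <= eps) ->
  approximable h.
Proof.
move=> H eps e0; have e20 : 0 < eps / 2 by rewrite divr_gt0.
have [g ag hg] := H _ e20; have [s gs] := ag _ e20.
exists s => t; rewrite (le_trans (ler_distD (g t) _ _))//.
by rewrite [leRHS](splitr eps) lerD.
Qed.

Lemma hermite1_comb_bounded s : exists B : R, forall t, `|hermite1_comb s t| <= B.
Proof.
exists (\sum_(q <- s) `|q.1| * (3 * q.2.+1%:R)) => t.
rewrite (le_trans (ler_norm_sum _ _ _))//; apply: ler_sum => q _.
by rewrite normrM ler_wpM2l// hermite1_bound.
Qed.

Lemma approximable_bounded h : approximable h ->
  exists2 B : R, 0 <= B & forall t, `|h t| <= B.
Proof.
move=> /(_ 1 ltr01)[s hs]; have [B sB] := hermite1_comb_bounded s.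
exists (1 + B) => [|t].
  by have := le_trans (normr_ge0 _) (sB 0); lra.
have := ler_normD (h t - hermite1_comb s t) (hermite1_comb s t).
by rewrite subrK; have := hs t; have := sB t; lra.
Qed.

(** Multiplication by [t] preserves the finite combinations, and the first
    Hermite function is a Gaussian. *)
Lemma approximable_poly_gauss p :
  approximable (fun t => p.[t] * expR (- (2^-1 * t ^+ 2))).
Proof.
suff [s sE] : exists s, forall t,
    p.[t] * expR (- (2^-1 * t ^+ 2)) = hermite1_comb s t.
  by move=> eps e0; exists s => t; rewrite sE subrr normr0 ltW.
elim/poly_ind: p => [|p c [s IH]].
  by exists [::] => t; rewrite horner0 mul0r /hermite1_comb big_nil.
pose c0 : R := Num.sqrt (2 ^+ 0 * 0`!%:R * Num.sqrt pi).
have c00 : c0 != 0.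
  by rewrite lt0r_neq0// sqrtr_gt0 expr0 fact0 !mul1r sqrtr_gt0 pi_gt0.
exists ((c * c0, 0%N) :: [seq (q.1 * ladder R q.2.+1, q.2.+1) | q <- s] ++
  [seq (q.1 * ladder R q.2, q.2.-1) | q <- s]) => t.
rewrite /hermite1_comb big_cons big_cat !big_map /=.
rewrite hornerMXaddC mulrDl mulrAC IH [LHS]addrC; congr (_ + _).
  have -> : phi 0 t = c0^-1 * expR (- (t ^+ 2 / 2)).
    by rewrite /hermite_fun1 /= hornerC mulr1.
  by rewrite [RHS]mulrA mulfK// [t ^+ 2 / 2]mulrC.
rewrite mulr_suml -big_split; apply: eq_bigr => q _ /=.
rewrite mulrAC -mulrA; have := hermite1_mulX q.2 t.
by rewrite mulrC -mulrA => ->; ring.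
Qed.

(** The new exponent is the old one plus [G = b t - lam t^2 / 8]. Up to an
    additive constant, [2 |G|] is at most half of [lam t^2], so that the
    exponential series of [expR G] converges uniformly against the Gaussian. *)
Lemma approximable_gauss_step lam : 0 < lam ->
  (forall p, approximable (fun t => p.[t] * expR (- (lam * t ^+ 2)))) ->
  forall p b, approximable
    (fun t => p.[t] * expR (- (9 / 8 * lam * t ^+ 2) + b * t)).
Proof.
move=> l0 H p b; apply: approximable_limit => eps e0.
pose G : {poly R} := b *: 'X - (lam / 8) *: 'X^2.
have GE t : G.[t] = b * t - lam / 8 * t ^+ 2.
  by rewrite /G hornerD hornerN !hornerZ hornerX hornerXn.
have l20 : 0 < lam / 2 by rewrite divr_gt0.
have [C pC] := poly_gauss_bounded p l20.
pose K := 4 * b ^+ 2 / lam.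
have C0 : 0 <= C.
  by apply: le_trans (pC 0); rewrite mulr_ge0 ?normr_ge0 ?expR_ge0.
have boundG t : expR (- (lam * t ^+ 2)) * expR (2 * `|G.[t]|) <=
    expR K * expR (- (lam / 2 * t ^+ 2)).
  rewrite -!expRD ler_expR GE.
  have -> : K = 4 * b ^+ 2 / lam by [].
  have h1 : `|b * t - lam / 8 * t ^+ 2| <= `|b * t| + lam / 8 * t ^+ 2.
    by rewrite (le_trans (ler_normB _ _))// lerD2l ger0_norm// mulr_ge0 ?sqr_ge0// divr_ge0 ?ltW.
  have h2 : 2 * `|b * t| <= lam / 4 * t ^+ 2 + 4 * b ^+ 2 / lam.
    have : 0 <= (lam * `|t| - 4 * `|b|) ^+ 2 / (4 * lam).
      by rewrite divr_ge0 ?sqr_ge0// mulr_ge0 ?ltW.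
    rewrite sqrrB !exprMn !real_normK ?num_real// normrM.
    rewrite (_ : _ / (4 * lam) = lam / 4 * t ^+ 2 - 2 * (`|b| * `|t|) + 4 * b ^+ 2 / lam).
      lra.
    by field; rewrite gt_eqF.
  lra.
have [N NE] : exists N, 2^-1 ^+ N * (expR K * C) <= eps.
  have : 2^-1 ^+ N * (expR K * C) @[N --> \oo] --> 0 * (expR K * C).
    apply: cvgM; last exact: cvg_cst.
    by apply: cvg_expr; rewrite gtr0_norm ?invr_gt0// invf_lt1// ltr1n.
  rewrite mul0r => /cvgrPdist_le /(_ _ e0)[N _ /(_ _ (leqnn N))].
  rewrite sub0r normrN => h; exists N; exact: le_trans (ler_norm _) h.
pose P : {poly R} := p * \sum_(k < N) (k`!%:R)^-1 *: G ^+ k.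
exists (fun t => P.[t] * expR (- (lam * t ^+ 2))); first exact: H.
move=> t; rewrite /P hornerM horner_sum.
under eq_bigr => k _ do rewrite hornerZ horner_exp mulrC.
rewrite (_ : - (9 / 8 * lam * t ^+ 2) + b * t = G.[t] + - (lam * t ^+ 2)); last first.
  by rewrite GE; field.
rewrite expRD mulrA -mulrBl -mulrBr normrM (ger0_norm (expR_ge0 _)) normrM.
apply: (@le_trans _ _ (2^-1 ^+ N * (`|p.[t]| * (expR (- (lam * t ^+ 2)) * expR (2 * `|G.[t]|))))).
  rewrite -!mulrA [leRHS]mulrCA ler_wpM2l// mulrC [leRHS]mulrCA ler_wpM2l ?expR_ge0//.
  exact: expR_series_tail.
apply: le_trans NE; rewrite ler_wpM2l ?exprn_ge0//.
apply: le_trans (ler_wpM2l (normr_ge0 _) (boundG t)) _.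
by rewrite mulrCA ler_wpM2l ?expR_ge0.
Qed.

(** From the exponent [1/2] of the Hermite functions, the factor [9/8] of the
    previous lemma leads to arbitrarily concentrated Gaussians. *)
Definition gauss_rate j : R := 2^-1 * (9 / 8) ^+ j.

Lemma gauss_rate_gt0 j : 0 < gauss_rate j.
Proof. by rewrite mulr_gt0 ?exprn_gt0 ?invr_gt0// divr_gt0. Qed.

Lemma gauss_rate_ge j : j%:R / 16 <= gauss_rate j.
Proof.
suff : 1 + j%:R / 8 <= (9 / 8) ^+ j :> R by rewrite /gauss_rate; lra.
elim: j => [|j IH]; first by rewrite expr0 mul0r addr0.
have := @ler0n R j; rewrite exprSr -natr1; lra.
Qed.

Lemma approximable_gauss j y :
  approximable (fun t => expR (- (gauss_rate j.+1 * (t - y) ^+ 2))).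
Proof.
have H k p : approximable (fun t => p.[t] * expR (- (gauss_rate k * t ^+ 2))).
  elim: k p => [|k IH] p.
    rewrite /gauss_rate expr0 mulr1; exact: approximable_poly_gauss.
  have := approximable_gauss_step (gauss_rate_gt0 k) IH p 0.
  rewrite (_ : 9 / 8 * gauss_rate k = gauss_rate k.+1); last first.
    by rewrite /gauss_rate exprS mulrCA.
  by under eq_fun do rewrite mul0r addr0.
have := approximable_gauss_step (gauss_rate_gt0 j) (H j)
  (expR (- (gauss_rate j.+1 * y ^+ 2)))%:P (2 * gauss_rate j.+1 * y).
congr approximable; apply/funext => t; rewrite hornerC -expRD; congr expR.
by rewrite /gauss_rate exprS; field.
Qed.

End approximable.

Section completeness.
Context (R : realType) (n : nat).
Implicit Types (w : 'rV[R]_n -> R) (h : 'I_n -> R -> R) (x y : 'rV[R]_n).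
Local Notation leb := (@lebesgue_measure R).
Local Notation mu := (lebesgue_rV R n).
Local Notation phi := (@hermite_fun1 R).

Let subst (i : 'I_n) (g : R -> R) h : 'I_n -> R -> R :=
  fun j => if j == i then g else h j.

Let tensor_subst i g h x : tensor (subst i g h) x =
  g (x ord0 i) * \prod_(j | j != i) h j (x ord0 j).
Proof.
rewrite /tensor (bigD1 i)//= /subst eqxx; congr (_ * _).
by apply: eq_bigr => j /negbTE ->.
Qed.

(** The factors of a Hermite function are replaced by approximable functions, one
    coordinate at a time: [r] lists the coordinates already treated. For the next
    one, the integral vanishes when its factor is a Hermite function, hence when
    it is a linear combination of them, and the error made by approximating the
    factor is bounded by a multiple of the integral of the weight. *)
Lemma orthogonal_tensor w (C : R) h : measurable_fun setT w ->
  (forall x, `|w x| <= C * weight x) ->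
  (forall nu, \int[mu]_x (w x * hermite_fun nu x) = 0) ->
  (forall i, measurable_fun setT (h i)) -> (forall i, approximable (h i)) ->
  \int[mu]_x (w x * tensor h x) = 0.
Proof.
move=> mw wC w0 mh ah.
have bounded_tensor (f : 'I_n -> R -> R) :
    (forall i, exists2 B : R, 0 <= B & forall t, `|f i t| <= B) ->
    exists2 B : R, 0 <= B & forall (P : pred 'I_n) x, `|\prod_(i | P i) f i (x ord0 i)| <= B.
  move=> bf; pose B i := 1 + xget 0 [set B : R | 0 <= B /\ forall t, `|f i t| <= B].
  have BP i : 1 <= B i /\ forall t, `|f i t| <= B i.
    rewrite /B; case: xgetP => [b _ [b0 fb]|no].
      by split=> [|t]; [lra|have := fb t; lra].
    by have [b b0 fb] := bf i; case: (no b).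
  exists (\prod_i B i) => [|P x].
    by apply: prodr_ge0 => i _; have [] := BP i; lra.
  rewrite normr_prod (bigID P predT)/= -[leLHS]mulr1.
  apply: ler_pM; rewrite ?prodr_ge0//.
    by apply: ler_prod => i _; rewrite normr_ge0/=; apply: (BP i).2.
  apply: (big_ind (fun z => 1 <= z)) => // [u v u1 v1|i _]; last exact: (BP i).1.
  exact: mulr_ege1.
have integ (f : 'rV[R]_n -> R) : measurable_fun setT f ->
    (exists2 B : R, 0 <= B & forall x, `|f x| <= B) ->
    mu.-integrable setT (EFin \o (fun x => w x * f x)).
  move=> mf [B B0 fB]; apply: (@integrable_weight_bound _ _ _ (C * B)).
    exact: measurable_funM.
  by move=> x; rewrite normrM mulrAC ler_pM.
suff H (r : seq 'I_n) : forall f, (forall i, i \in r -> approximable (f i)) ->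
    (forall i, i \notin r -> exists k, f i = phi k) ->
    (forall i, measurable_fun setT (f i)) ->
    \int[mu]_x (w x * tensor f x) = 0.
  by apply: (H (enum 'I_n)) => // i; rewrite mem_enum.
elim: r => [|i r IH] f fr fnr mf.
  have /choice[nu fE] : forall i, exists k, f i = phi k by move=> i; exact: fnr.
  rewrite -(w0 [ffun i => nu i]); apply: eq_Rintegral => x _; congr (_ * _).
  by apply: eq_bigr => j _; rewrite fE ffunE.
have [ir|ir] := boolP (i \in r).
  apply: IH => // j jr; first by apply: fr; rewrite inE jr orbT.
  by apply: fnr; rewrite inE negb_or jr andbT; apply: contraNneq jr => ->.
have bf j : exists2 B : R, 0 <= B & forall t, `|f j t| <= B.
  have [jr|jr] := boolP (j \in i :: r); first exact: approximable_bounded (fr j jr).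
  by have [k ->] := fnr j jr; exists (3 * k.+1%:R) => // t; exact: hermite1_bound.
have [B B0 fB] := bounded_tensor f bf.
pose F x := \prod_(j | j != i) f j (x ord0 j).
have mF : measurable_fun setT F.
  rewrite (_ : F = fun x => \prod_j (if j != i then f j (x ord0 j) else 1)); last first.
    by apply/funext => x; rewrite /F big_mkcond.
  apply: measurable_prod => j _; case: (j != i) => //.
  by apply: (measurableT_comp (mf j)); exact: measurable_coord.
have mi (g : R -> R) : measurable_fun setT g -> measurable_fun setT (fun x : 'rV[R]_n => g (x ord0 i)).
  by move=> mg; apply: (measurableT_comp mg); exact: measurable_coord.
have iphi k : mu.-integrable setT (EFin \o (fun x => w x * (phi k (x ord0 i) * F x))).
  apply: integ; first by apply: measurable_funM => //; apply: mi; exact: measurable_hermite1.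
  exists (3 * k.+1%:R * B); first by rewrite mulr_ge0.
  by move=> x; rewrite normrM ler_pM//; [exact: hermite1_bound|exact: fB].
have zero k : \int[mu]_x (w x * (phi k (x ord0 i) * F x)) = 0.
  rewrite -[RHS](IH (subst i (phi k) f)).
  - by apply: eq_Rintegral => x _; rewrite tensor_subst.
  - move=> j jr; rewrite /subst; case: eqP => [ji|_]; first by rewrite -ji jr in ir.
    by apply: fr; rewrite inE jr orbT.
  - move=> j jr; rewrite /subst; case: eqP => [_|/eqP ji]; first by exists k.
    by apply: fnr; rewrite inE negb_or ji.
  - by move=> j; rewrite /subst; case: eqP => // _; exact: measurable_hermite1.
have W0 : 0 <= C * B * \int[mu]_x weight x.
  rewrite !mulr_ge0 ?(weight_bound_ge0 wC)//.
  by apply: Rintegral_ge0 => x _; exact: weight_ge0.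
apply/eqP; rewrite -normr_le0; apply/ler_addgt0Pl => e e0; rewrite addr0.
pose eps := e / (C * B * \int[mu]_x weight x + 1).
have eps0 : 0 < eps by rewrite divr_gt0// ltr_wpDl.
have [s fs] := fr i (mem_head _ _) _ eps0.
have iis : mu.-integrable setT (EFin \o (fun x => w x * (hermite1_comb s (x ord0 i) * F x))).
  have := integrable_sum measurableT s (P := xpredT) (fun q _ =>
    integrableZl measurableT q.1 (iphi q.2)).
  apply: eq_integrable => // x _ /=.
  rewrite sumEFin /hermite1_comb mulr_suml mulr_sumr; congr EFin.
  by apply: eq_bigr => q _; ring.
have ifs : mu.-integrable setT (EFin \o (fun x => w x * tensor f x)).
  apply: integ; first exact: measurable_tensor.
  by exists B => // x; exact: (fB xpredT).
have -> : \int[mu]_x (w x * tensor f x) =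
    \int[mu]_x (w x * ((f i (x ord0 i) - hermite1_comb s (x ord0 i)) * F x)).
  transitivity (\int[mu]_x (w x * tensor f x) -
      \int[mu]_x (w x * (hermite1_comb s (x ord0 i) * F x))).
    rewrite (_ : \int[mu]_x (w x * (hermite1_comb s (x ord0 i) * F x)) = 0) ?subr0//.
    transitivity (\int[mu]_x \sum_(q <- s) q.1 * (w x * (phi q.2 (x ord0 i) * F x))).
      apply: eq_Rintegral => x _; rewrite /hermite1_comb mulr_suml mulr_sumr.
      by apply: eq_bigr => q _; ring.
    rewrite Rintegral_sum => [|q]; last exact: (integrableZl measurableT q.1 (iphi q.2)).
    by rewrite big1// => q _; rewrite RintegralZl// zero mulr0.
  rewrite -RintegralB//; apply: eq_Rintegral => x _.
  rewrite mulrBl mulrBr; congr (_ * _ - _).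
  by rewrite /tensor (bigD1 i)//.
have ms : measurable_fun setT (hermite1_comb s).
  by apply: measurable_sum => q; apply: measurable_funM => //; exact: measurable_hermite1.
have bd x : `|w x * ((f i (x ord0 i) - hermite1_comb s (x ord0 i)) * F x)| <=
    eps * C * B * weight x.
  rewrite !normrM (_ : eps * C * B * weight x = (C * weight x) * (eps * B)); last by ring.
  apply: ler_pM; rewrite ?mulr_ge0//.
  by apply: ler_pM => //; exact: fB.
have mI : measurable_fun setT (fun x => w x * ((f i (x ord0 i) - hermite1_comb s (x ord0 i)) * F x)).
  apply: measurable_funM => //; apply: measurable_funM => //.
  by apply: measurable_funB; apply: mi.
rewrite (le_trans (le_normr_Rintegral _ _))//; first exact: integrable_weight_bound mI bd.
apply: (@le_trans _ _ (\int[mu]_x (eps * C * B * weight x))).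
  apply: le_Rintegral => //.
  - have /integrable_norm := integrable_weight_bound mI bd; exact.
  - exact: (integrableZl measurableT (eps * C * B) (integrable_weight R n)).
rewrite RintegralZl//; last exact: integrable_weight.
rewrite [leLHS](_ : _ = eps * (C * B * \int[mu]_x weight x)); last by rewrite !mulrA.
rewrite /eps mulrAC ler_pdivrMr ?ltr_wpDl// mulrDr mulr1.
by rewrite lerDl ltW.
Qed.

(** If [w] is positive near [y] then its integral against [expR (- lam |x - y|^2)]
    is positive for large [lam]: the contribution of a small box around [y] is
    exponentially larger than that of the complement of a larger box. *)
Lemma orthogonal_eq0 w (C : R) : continuous w ->
  (forall x, `|w x| <= C * weight x) ->
  (forall nu, \int[mu]_x (w x * hermite_fun nu x) = 0) ->
  forall y, w y = 0.
Proof.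
suff H w' (C' : R) : continuous w' -> (forall x, `|w' x| <= C' * weight x) ->
    (forall nu, \int[mu]_x (w' x * hermite_fun nu x) = 0) -> forall y, w' y <= 0.
  move=> cw wC w0 y; apply/eqP; rewrite eq_le (H w C)//= -oppr_le0.
  apply: (H (fun x => - w x) C).
  - by move=> x; exact: (cvgN (cw x)).
  - by move=> x; rewrite normrN.
  move=> nu; under eq_Rintegral do rewrite mulNr -mulN1r.
  rewrite RintegralZl ?w0 ?mulr0//.
  apply: (@integrable_weight_bound _ _ _ (C * hermite_cst R nu)).
    apply: measurable_funM; last exact: measurable_hermite.
    exact: measurable_continuous_rV.
  move=> x; rewrite normrM mulrAC ler_pM//.
  exact: hermite_bound.
move: w' C' => {}w {}C cw wC w0 y; rewrite leNgt; apply/negP => wy0.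
have C0 := weight_bound_ge0 wC.
have mw : measurable_fun setT w by exact: measurable_continuous_rV.
pose eps := w y / 2; have eps0 : 0 < eps by rewrite divr_gt0.
have [del del0 wdel] : exists2 del : R, 0 < del &
    forall x, (forall i, `|x ord0 i - y ord0 i| < del) -> eps <= w x.
  have /cvgrPdist_lt/(_ _ eps0) := cw y.
  move=> /nbhs_ballP[del del0 ydel]; exists del => // x xy.
  have /ydel /= : ball y del x.
    by split=> // i j; rewrite !(ord1 i) /ball/= distrC.
  by move=> /(le_lt_trans (ler_norm _)); rewrite /eps; lra.
(* within [a] of [y] in each coordinate, the squared distance to [y] is at most
   [del^2 / 2], while it is at least [del^2] outside of the box of radius [del] *)
pose a := del / n.+1%:R; have a0 : 0 < a by rewrite divr_gt0.
have adel : a <= del by rewrite ler_pdivrMr// ler_peMr ?ler1n// ltW.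
have na2 : n%:R * a ^+ 2 <= del ^+ 2 / 2.
  rewrite /a expr_div_n mulrCA ler_wpM2l ?sqr_ge0// ler_pdivrMr ?exprn_gt0//.
  by rewrite -[n.+1%:R]natr1; move: (n%:R) => z; have := sqr_ge0 z; lra.
pose g j i t : R := expR (- (gauss_rate R j.+1 * (t - y ord0 i) ^+ 2)).
pose E j := tensor (g j).
have mg j i : measurable_fun setT (g j i).
  apply: measurableT_comp => //; apply: measurableT_comp => //.
  apply: measurable_funM => //; apply: measurable_funX.
  exact: measurable_funB.
have int0 j : \int[mu]_x (w x * E j x) = 0.
  apply: (orthogonal_tensor mw wC w0); first exact: mg.
  by move=> i; exact: approximable_gauss.
have E0 j x : 0 <= E j x by apply: tensor_ge0 => i t; exact: expR_ge0.
have g1 j i t : g j i t <= 1.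
  by rewrite /g -expR0 ler_expR oppr_le0 mulr_ge0 ?sqr_ge0// ltW// gauss_rate_gt0.
have E1 j x : E j x <= 1 by apply: prodr_ile1 => i _; rewrite expR_ge0 g1.
pose box : 'rV[R]_n -> R := tensor (fun i => \1_(`]y ord0 i - a, y ord0 i + a[%classic)).
have box01 x : box x = 0 \/ (box x = 1 /\ forall i, `|x ord0 i - y ord0 i| < a).
  have [ax|] := pselect (forall i, `|x ord0 i - y ord0 i| < a).
    right; split=> //; rewrite /box /tensor big1// => i _.
    by rewrite indicE mem_set//= in_itv/= -ltr_distlC distrC.
  move=> /existsNP[i ix]; left; rewrite /box /tensor (bigD1 i)//= indicE memNset ?mul0r//=.
  by rewrite in_itv/= -ltr_distlC distrC.
pose I := \int[mu]_x weight x.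
have I0 : 0 <= I by apply: Rintegral_ge0 => x _; exact: weight_ge0.
have lower j x : eps * expR (- (gauss_rate R j.+1 * (del ^+ 2 / 2))) * box x +
    - (C * expR (- (gauss_rate R j.+1 * del ^+ 2))) * weight x <= w x * E j x.
  have l0 := ltW (gauss_rate_gt0 R j.+1).
  have neg : - (C * expR (- (gauss_rate R j.+1 * del ^+ 2))) * weight x <= 0.
    by rewrite mulNr oppr_le0 !mulr_ge0 ?expR_ge0 ?weight_ge0.
  have [->|[-> xa]] := box01 x.
    rewrite mulr0 add0r.
    have [xd|/existsNP[i /negP]] := pselect (forall i, `|x ord0 i - y ord0 i| < del).
      rewrite (le_trans neg)// mulr_ge0//; have := wdel _ xd; lra.
    rewrite -leNgt => dx.
    have Ed : E j x <= expR (- (gauss_rate R j.+1 * del ^+ 2)).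
      rewrite /E /tensor (bigD1 i)//= -[leRHS]mulr1; apply: ler_pM; rewrite ?expR_ge0//.
      - by apply: prodr_ge0 => k _; exact: expR_ge0.
      - rewrite /g ler_expR lerN2 ler_wpM2l// -[leRHS]real_normK ?num_real//.
        by rewrite lerXn2r// nnegrE ltW.
      - by apply: prodr_ile1 => k _; rewrite expR_ge0 g1.
    have := wC x; rewrite ler_norml => /andP[wx _].
    rewrite (le_trans (y := - (C * weight x) * E j x))//; last by rewrite ler_wpM2r.
    by rewrite !mulNr lerN2 [leRHS]mulrAC ler_wpM2l// mulr_ge0// weight_ge0.
  rewrite mulr1 (le_trans (y := eps * expR (- (gauss_rate R j.+1 * (del ^+ 2 / 2)))))//.
    by rewrite gerDl.
  have xd i : `|x ord0 i - y ord0 i| < del by rewrite (lt_le_trans (xa i)).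
  apply: ler_pM; rewrite ?expR_ge0//; [exact: ltW|exact: wdel|].
  rewrite /E /tensor /g -expR_sum ler_expR sumrN lerN2 -mulr_sumr ler_wpM2l//.
  rewrite (le_trans _ na2)// (_ : n%:R * a ^+ 2 = \sum_(i < n) a ^+ 2); last first.
    by rewrite sumr_const card_ord mulr_natl.
  apply: ler_sum => i _; rewrite -[leLHS]real_normK ?num_real//.
  by rewrite lerXn2r// ?nnegrE// ltW.
have mind i : leb.-integrable setT (EFin \o \1_(`]y ord0 i - a, y ord0 i + a[%classic)).
  exact: integrable_indic_itv.
have mind' i : measurable_fun [set: R] (\1_(`]y ord0 i - a, y ord0 i + a[%classic) : R -> R).
  exact: measurable_indic.
have Ibox : \int[mu]_x box x = (2 * a) ^+ n.
  rewrite Rintegral_tensor// (eq_bigr (fun=> 2 * a)); last first.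
    move=> i _; rewrite /Rintegral integral_indic// setIT.
    have := @lebesgue_measure_itv R `]y ord0 i - a, y ord0 i + a[.
    rewrite /= lte_fin ifT; last lra.
    by move=> h; rewrite [leb _]h -EFinB/=; lra.
  by rewrite prodr_const card_ord.
have main j : eps * expR (- (gauss_rate R j.+1 * (del ^+ 2 / 2))) * (2 * a) ^+ n <=
    C * expR (- (gauss_rate R j.+1 * del ^+ 2)) * I.
  have ibox := integrable_tensor mind' mind.
  have iE : mu.-integrable setT (EFin \o (fun x => w x * E j x)).
    apply: (@integrable_weight_bound _ _ _ C).
      by apply: measurable_funM => //; exact: measurable_tensor.
    by move=> x; rewrite normrM -[leRHS]mulr1 ler_pM// ger0_norm.
  have iW := integrable_weight R n.
  have := le_Rintegral measurableT (integrableD measurableT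
    (integrableZl measurableT (eps * expR (- (gauss_rate R j.+1 * (del ^+ 2 / 2)))) ibox)
    (integrableZl measurableT (- (C * expR (- (gauss_rate R j.+1 * del ^+ 2)))) iW)) iE
    (fun x _ => lower j x).
  rewrite int0 RintegralD//; last 2 first.
  - exact: (integrableZl measurableT _ ibox).
  - exact: (integrableZl measurableT _ iW).
  rewrite RintegralZl// [X in _ + X <= _]RintegralZl// -/box Ibox -/I; lra.
(* [main] compares the exponential of [- gauss_rate * del^2 / 2] with its square;
   [expR s >= 1 + s] and the growth of [gauss_rate] give an explicit [j] for which
   the square is too small *)
pose u := eps * (2 * a) ^+ n; have u0 : 0 < u by rewrite mulr_gt0// exprn_gt0// mulr_gt0.
pose j := (Num.trunc (32 * C * I / (u * del ^+ 2))).+1.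
have := main j; apply/negP; rewrite -ltNge.
have -> : expR (- (gauss_rate R j.+1 * del ^+ 2)) =
    expR (- (gauss_rate R j.+1 * (del ^+ 2 / 2))) * expR (- (gauss_rate R j.+1 * (del ^+ 2 / 2))).
  by rewrite -expRD; congr expR; field.
set e := expR _; have e0 : 0 < e by exact: expR_gt0.
rewrite (_ : C * (e * e) * I = e * (C * I * e)); last by ring.
rewrite (_ : eps * e * _ = e * u); last by rewrite /u; ring.
rewrite ltr_pM2l// /e expRN ltr_pdivrMr ?expR_gt0//.
apply: (@lt_le_trans _ _ (u * (1 + gauss_rate R j.+1 * (del ^+ 2 / 2)))); last first.
  by rewrite ler_wpM2l ?expR_ge1Dx// ltW.
have jR : j%:R / 16 <= gauss_rate R j.+1.
  by rewrite (le_trans _ (gauss_rate_ge _ _))// ler_wpM2r ?ler_nat.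
have d20 : 0 < del ^+ 2 by rewrite exprn_gt0.
have : 32 * C * I / (u * del ^+ 2) < j%:R by exact: truncnS_gt.
have uu : 0 < u * del ^+ 2 by exact: mulr_gt0.
rewrite (ltr_pdivrMr _ _ uu) => cI.
have h1 : u * (j%:R / 16 * (del ^+ 2 / 2)) <= u * (gauss_rate R j.+1 * (del ^+ 2 / 2)).
  by rewrite ler_pM2l// ler_wpM2r// divr_ge0// ltW.
have h2 : u * (j%:R / 16 * (del ^+ 2 / 2)) = j%:R * (u * del ^+ 2) / 32 by field.
lra.
Qed.

End completeness.

(** * Hermite expansion of Schwartz functions *)

Section countable_sums.
Context (R : realType) (I : countType).
Implicit Types (a : I -> R) (M N : nat).

(** The [M] first elements of the enumeration of [I]; codes that do not
    correspond to any element are skipped. *)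
Definition enum_upto M : seq I := pmap pickle_inv (iota 0 M).

Lemma enum_upto_uniq M : uniq (enum_upto M).
Proof.
apply: (pmap_uniq (g := pickle)); last exact: iota_uniq.
by move=> k; exact: pickle_invK.
Qed.

Lemma mem_enum_upto M i : (i \in enum_upto M) = (pickle i < M)%N.
Proof.
rewrite mem_pmap; apply/mapP/idP => [[k]|iM].
  rewrite mem_iota add0n => /= kM ik.
  by have := @pickle_invK I k; rewrite -ik /= => ->.
by exists (pickle i); rewrite ?mem_iota ?pickleK_inv.
Qed.

Lemma enum_uptoS M : enum_upto M.+1 = enum_upto M ++ seq_of_opt (pickle_inv M).
Proof.
by rewrite /enum_upto -addn1 iotaD pmap_cat add0n /=; congr (_ ++ _).
Qed.

Lemma sum_enum_upto (V : zmodType) (u : I -> V) :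
  (fun M => \sum_(i <- enum_upto M) u i) =
  series (fun k => \sum_(i <- seq_of_opt (pickle_inv k)) u i).
Proof.
apply/funext; elim=> [|M IH]; first by rewrite /series/= big_geq// big_nil.
by rewrite enum_uptoS big_cat IH seriesEnat/= big_nat_recr.
Qed.

(** Some finite set nearly attains the supremum of the finite sums, and a finite
    set disjoint from it cannot add more than [eps]. *)
Lemma summable_tail a (C : R) : (forall i, 0 <= a i) ->
  (forall s : seq I, uniq s -> \sum_(i <- s) a i <= C) ->
  forall eps, 0 < eps -> exists N, forall s : seq I, uniq s ->
    (forall i, i \in s -> (N <= pickle i)%N) -> \sum_(i <- s) a i <= eps.
Proof.
move=> a0 aC eps e0.
have hs : has_sup [set \sum_(i <- s) a i | s in [set s : seq I | uniq s]].
  split; first by exists (\sum_(i <- [::]) a i); exists [::].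
  by exists C => _ [s us <-]; exact: aC.
have [_ [s us <-] sS] := sup_adherent e0 hs.
exists (\max_(i <- s) pickle i).+1 => t ut tN.
rewrite -(lerD2l (\sum_(i <- s) a i)) -big_cat/=.
rewrite (le_trans (ub_le_sup hs.2 _)) //; last first.
  by move: sS; rewrite ltrBlDr => /ltW.
exists (s ++ t) => //=; rewrite cat_uniq us ut andbT.
apply/hasPn => i /tN; apply: contraTN => is_; rewrite -ltnNge ltnS.
exact: leq_bigmax_seq.
Qed.

End countable_sums.

Section summable_ffun.
Context (R : realType) (n : nat).

(** The induction carries the telescoping bound [2 - 1 / (M + 1)]. *)
Lemma sum_inv_sqr_le (N : nat) : \sum_(k < N) (k.+1%:R ^- 2 : R) <= 2.
Proof.
suff H M : \sum_(k < M.+1) (k.+1%:R ^- 2 : R) <= 2 - M.+1%:R^-1.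
  case: N => [|N]; first by rewrite big_ord0.
  by rewrite (le_trans (H N))// gerDl oppr_le0 invr_ge0.
elim: M => [|M IH]; first by rewrite big_ord1 expr1n invr1; lra.
rewrite big_ord_recr/= (le_trans (lerD IH (lexx _)))//.
have h1 : 0 < M.+1%:R :> R by [].
have h2 : M.+2%:R = M.+1%:R + 1 :> R by rewrite -[M.+2]addn1 natrD.
rewrite h2; move: (M.+1%:R) h1 => z z0.
have z1 : 0 < z + 1 by lra.
rewrite -addrA lerD2l addrC -subr_ge0.
have -> : - (z + 1)^-1 - ((z + 1) ^- 2 - z^-1) = z^-1 * (z + 1) ^- 2.
  by field; rewrite !gt_eqF.
by rewrite mulr_ge0 ?invr_ge0 ?exprn_ge0// ltW.
Qed.

Definition inv_sqr (nu : {ffun 'I_n -> nat}) : R := \prod_i (nu i).+1%:R ^- 2.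

Lemma inv_sqr_ge0 nu : 0 <= inv_sqr nu.
Proof. by apply: prodr_ge0 => i _; rewrite invr_ge0 exprn_ge0. Qed.

(** A finite set of indices lies in a cube, over which the sum of the products is
    the product of the sums. *)
Lemma sum_inv_sqr_bounded (s : seq {ffun 'I_n -> nat}) : uniq s ->
  \sum_(nu <- s) inv_sqr nu <= 2 ^+ n.
Proof.
move=> us.
pose N := (\max_(nu <- s) \max_i nu i)%N.
pose f (nu : {ffun 'I_n -> nat}) : {ffun 'I_n -> 'I_N.+1} := [ffun i => inord (nu i)].
have fK nu : nu \in s -> forall i, f nu i = nu i :> nat.
  move=> nus i; rewrite ffunE inordK// ltnS.
  rewrite (leq_trans (leq_bigmax i))//.
  exact: (@leq_bigmax_seq _ _ xpredT (fun nu : {ffun 'I_n -> nat} => (\max_i nu i)%N)).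
have -> : \sum_(nu <- s) inv_sqr nu =
    \sum_(k <- [seq f nu | nu <- s]) \prod_i (k i).+1%:R ^- 2.
  rewrite big_map; apply: eq_big_seq => nu nus; apply: eq_bigr => i _.
  by rewrite fK.
have uf : uniq [seq f nu | nu <- s].
  rewrite map_inj_in_uniq// => nu nu' nus nus' ff; apply/ffunP => i.
  by rewrite -(fK nu)// -(fK nu')// ff.
rewrite (@le_trans _ _ (\sum_(k : {ffun 'I_n -> 'I_N.+1}) \prod_i (k i).+1%:R ^- 2))//.
  rewrite big_uniq//= big_mkcond/=; apply: ler_sum => k _; case: ifP => // _.
  by apply: prodr_ge0 => i _; rewrite invr_ge0 exprn_ge0.
rewrite -(bigA_distr_bigA (fun (_ : 'I_n) (k : 'I_N.+1) => k.+1%:R ^- 2 : R)).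
rewrite -[X in _ <= 2 ^+ X]card_ord -prodr_const; apply: ler_prod => i _.
by rewrite sum_inv_sqr_le andbT sumr_ge0// => k _; rewrite invr_ge0 exprn_ge0.
Qed.

End summable_ffun.

Section schwartz_expansion.
Context (R : realType) (n : nat).
Implicit Types (x : 'rV[R]_n) (nu a : {ffun 'I_n -> nat}) (s : seq 'I_n) (i : 'I_n).
Local Notation mu := (lebesgue_rV R n).
Local Notation Phi := (@hermite_fun R n).
Variable f : 'rV[R]_n -> R.
Hypothesis sf : real_schwartz f.

Let mono a x : R := \prod_i x ord0 i ^+ a i.

(** Multiplication by a coordinate and differentiation do not lead out of this
    family of functions, which makes repeated integration by parts possible. *)
Let F a s x := mono a x * partials s f x.

Let mono_upd i k a x :
  mono (upd i k a) x = x ord0 i ^+ k * \prod_(j | j != i) x ord0 j ^+ a j.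
Proof.
rewrite /mono (bigD1 i)//= upd_same; congr (_ * _).
by apply: eq_bigr => j ji; rewrite ffunE (negbTE ji).
Qed.

Let continuous_F a s : continuous (F a s).
Proof.
have cm : continuous (mono a).
  apply: continuous_prod_rV => i x.
  apply: (@cvg_comp _ _ _ (fun x : 'rV[R]_n => x ord0 i) (fun t => t ^+ a i)).
    exact: coord_continuous.
  exact: exprn_continuous.
by move=> x; exact: (cvgM (cm x) ((sf.1 s).1 x)).
Qed.

(** [1 / weight] is the product of the [1 + x_i^2], a polynomial. *)
Let F_weight a s : exists C : R, forall x, `|F a s x| <= C * weight x.
Proof.
suff [C FC] : exists C : R, forall x, `|(\prod_i (1 + x ord0 i ^+ 2)) * F a s x| <= C.
  exists C => x; rewrite /weight /tensor /cauchy prodfV ler_pdivlMr; last first.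
    by apply: prodr_gt0 => i _; rewrite ltr_pwDl// sqr_ge0.
  rewrite mulrC -[X in X * _]ger0_norm -?normrM//.
  by apply: prodr_ge0 => i _; rewrite addr_ge0 ?sqr_ge0.
suff H (r : seq 'I_n) : forall a, exists C : R, forall x,
    `|(\prod_(i <- r) (1 + x ord0 i ^+ 2)) * F a s x| <= C by exact: H.
elim: r => [|i r IH] b.
  by have [C bC] := sf.2 b s; exists C => x; rewrite big_nil mul1r; exact: bC.
have [C1 H1] := IH b; have [C2 H2] := IH (upd i (b i).+2 b).
exists (C1 + C2) => x; rewrite big_cons mulrDl mul1r mulrDl.
rewrite (le_trans (ler_normD _ _))// lerD//.
suff -> : x ord0 i ^+ 2 * \prod_(j <- r) (1 + x ord0 j ^+ 2) * F b s x =
  \prod_(j <- r) (1 + x ord0 j ^+ 2) * F (upd i (b i).+2 b) s x by exact: H2.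
by rewrite /F -{1}[b](upd_id i) !mono_upd !exprS expr0; ring.
Qed.

Let is_derive_F i a s x : is_derive x (delta_mx ord0 i) (F a s)
  ((a i)%:R * F (upd i (a i).-1 a) s x + F a (i :: s) x).
Proof.
have dm : is_derive x (delta_mx ord0 i) (mono a) ((a i)%:R * mono (upd i (a i).-1 a) x).
  apply/is_derive_line; set c := \prod_(j | j != i) x ord0 j ^+ a j.
  rewrite (_ : (fun h => _) = (fun h : R => c * (x ord0 i + h) ^+ a i)); last first.
    apply/funext => h; rewrite -{1}[a](upd_id i) mono_upd mulrC; congr (_ * _).
      apply: eq_bigr => j ji; rewrite !mxE (negbTE ji).
      by rewrite andbF mulr0 addr0.
    by rewrite !mxE !eqxx mulr1.
  rewrite mono_upd -/c.
  have d1 : is_derive (0 : R) 1 (fun h : R => x ord0 i + h) (0 + 1) by apply: is_deriveD.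
  case: (a i) => [|k].
    under eq_fun do rewrite expr0 mulr1; rewrite mul0r; exact: is_derive_cst.
  have d2 := is_deriveX k.+1 d1.
  rewrite (_ : (fun h => _) = c *: (fun h : R => x ord0 i + h) ^+ k.+1); last first.
    by apply/funext => h; rewrite /= exprfctE.
  apply: is_derive_eq (is_deriveZ c d2) _.
  by rewrite /GRing.scale/= addr0 add0r mulr1; ring.
have ds : is_derive x (delta_mx ord0 i) (partials s f) (partials (i :: s) f x).
  by apply/derivableP; exact: (sf.1 s).2.
apply: is_derive_eq (is_deriveM dm ds) _.
rewrite /F; set p := partials (i :: s) f x; rewrite /GRing.scale/=; ring.
Qed.

Let measurable_F a s : measurable_fun setT (F a s).
Proof. by apply: measurable_continuous_rV; exact: continuous_F. Qed.

Let integrable_F a s nu : mu.-integrable setT (EFin \o (fun x => F a s x * Phi nu x)).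
Proof.
have [C FC] := F_weight a s.
apply: (@integrable_weight_bound _ _ _ (C * hermite_cst R nu)).
  by apply: measurable_funM; [exact: measurable_F|exact: measurable_hermite].
move=> x; rewrite normrM mulrAC ler_pM//; exact: hermite_bound.
Qed.

Let coef a s nu := \int[mu]_x (F a s x * Phi nu x).

Let RintegralZD (c1 c2 c3 : R) (g1 g2 g3 : 'rV[R]_n -> R) :
  mu.-integrable setT (EFin \o g1) -> mu.-integrable setT (EFin \o g2) ->
  mu.-integrable setT (EFin \o g3) ->
  \int[mu]_x (c1 * g1 x + c2 * g2 x + c3 * g3 x) =
  c1 * \int[mu]_x g1 x + c2 * \int[mu]_x g2 x + c3 * \int[mu]_x g3 x.
Proof.
move=> i1 i2 i3.
have z1 := integrableZl measurableT c1 i1.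
have z2 := integrableZl measurableT c2 i2.
have z3 := integrableZl measurableT c3 i3.
rewrite RintegralD//; last exact: (integrableD measurableT z1 z2).
by rewrite RintegralD// !RintegralZl.
Qed.

(** Integration by parts in [int (x_i phi - d_i phi) F], where
    [x_i phi - d_i phi] is a multiple of the next Hermite function. *)
Let coef_up i a s nu :
  2 * ladder R (nu i).+1 * coef a s (upd i (nu i).+1 nu) =
  coef (upd i (a i).+1 a) s nu + (a i)%:R * coef (upd i (a i).-1 a) s nu +
  coef a (i :: s) nu.
Proof.
set up := upd i (nu i).+1 nu; set dn := upd i (nu i).-1 nu.
set l1 := ladder R (nu i).+1; set l0 := ladder R (nu i).
have ibp : (a i)%:R * coef (upd i (a i).-1 a) s nu + 1 * coef a (i :: s) nu +
    1 * \int[mu]_x (l0 * (F a s x * Phi dn x) + - l1 * (F a s x * Phi up x) + 0 * (F a s x * Phi nu x)) = 0.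
  have i3 : mu.-integrable setT (EFin \o (fun x => l0 * (F a s x * Phi dn x) +
      - l1 * (F a s x * Phi up x) + 0 * (F a s x * Phi nu x))).
    have z1 := integrableZl measurableT l0 (integrable_F a s dn).
    have z2 := integrableZl measurableT (- l1) (integrable_F a s up).
    have z3 := integrableZl measurableT 0 (integrable_F a s nu).
    exact: (integrableD measurableT (integrableD measurableT z1 z2) z3).
  rewrite -RintegralZD//.
  pose G x := F a s x * Phi nu x.
  pose dF x := (a i)%:R * F (upd i (a i).-1 a) s x + F a (i :: s) x.
  pose dPhi x := l0 * Phi dn x - l1 * Phi up x.
  transitivity (\int[mu]_x (F a s x * dPhi x + Phi nu x * dF x)).
    by apply: eq_Rintegral => x _; rewrite /dPhi /dF; ring.
  have [C FC] := F_weight a s.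
  have [D1 FD1] := F_weight (upd i (a i).-1 a) s.
  have [D2 FD2] := F_weight a (i :: s).
  have cdF : continuous dF.
    apply: continuousD_rV; last exact: continuous_F.
    by apply: continuousZ_rV; exact: continuous_F.
  have cdP : continuous dPhi.
    apply: continuousD_rV; first by apply: continuousZ_rV; exact: continuous_hermite.
    under eq_fun do rewrite -mulNr.
    by apply: continuousZ_rV; exact: continuous_hermite.
  have cdG : continuous (fun x => F a s x * dPhi x + Phi nu x * dF x).
    apply: continuousD_rV.
      exact: (continuousM_rV (@continuous_F a s) cdP).
    exact: (continuousM_rV (@continuous_hermite R n nu) cdF).
  have C0 := weight_bound_ge0 FC.
  pose E := l0 * hermite_cst R dn + l1 * hermite_cst R up.
  have E0 : 0 <= E by rewrite addr_ge0// mulr_ge0 ?hermite_cst_ge0 ?ladder_ge0.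
  have dPb x : `|dPhi x| <= E.
    rewrite (le_trans (ler_normB _ _))// !normrM !(ger0_norm (ladder_ge0 _ _)).
    by rewrite lerD// ler_wpM2l ?ladder_ge0 ?hermite_bound.
  pose D := (a i)%:R * D1 + D2.
  have dFb x : `|dF x| <= D * weight x.
    rewrite (le_trans (ler_normD _ _))// mulrDl lerD// normrM normr_nat -mulrA.
    by rewrite ler_wpM2l.
  have D0 := weight_bound_ge0 dFb.
  apply: (@Rintegral_partial_eq0 R n i G _ (C * (E + hermite_cst R nu) + hermite_cst R nu * D)).
  - move=> x; apply/is_derive_line; apply: is_derive_eq.
      exact: is_deriveM (is_derive_F i a s x) (is_derive_hermite i nu x).
    by rewrite /GRing.scale/=.
  - move=> x h; apply: (@cvg_comp _ _ _ (fun h : R => x + h *: delta_mx ord0 i)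
      (fun x => F a s x * dPhi x + Phi nu x * dF x)); last exact: cdG.
    by apply: cvgD; [exact: cvg_cst|apply: cvgZr_tmp].
  - exact: measurable_continuous_rV cdG.
  - move=> x; rewrite normrM; have := ler_pM (normr_ge0 _) (normr_ge0 _) (FC x) (hermite_bound nu x).
    move=> /le_trans; apply; rewrite mulrAC ler_wpM2r ?weight_ge0//.
    by rewrite mulrDr -addrA addrCA lerDl addr_ge0// mulr_ge0// hermite_cst_ge0.
  - move=> x; rewrite (le_trans (ler_normD _ _))//.
    rewrite [`|F a s x * _|]normrM [`|Phi nu x * _|]normrM.
    have h1 := ler_pM (normr_ge0 _) (normr_ge0 _) (FC x) (dPb x).
    have h2 := ler_pM (normr_ge0 _) (normr_ge0 _) (hermite_bound nu x) (dFb x).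
    rewrite (le_trans (lerD h1 h2))// mulrAC mulrA -mulrDl ler_wpM2r ?weight_ge0//.
    by rewrite lerD2r ler_wpM2l// lerDl hermite_cst_ge0.
rewrite RintegralZD// in ibp; rewrite -!/(coef _ _ _) in ibp.
have mulX : coef (upd i (a i).+1 a) s nu = l1 * coef a s up + l0 * coef a s dn + 0 * coef a s dn.
  rewrite -RintegralZD//; apply: eq_Rintegral => x _.
  have aE : mono a x = x ord0 i ^+ a i * \prod_(j | j != i) x ord0 j ^+ a j.
    by rewrite -{1}[a](upd_id i) mono_upd.
  rewrite /F mono_upd aE exprS.
  transitivity (x ord0 i ^+ a i * \prod_(j | j != i) x ord0 j ^+ a j * partials s f x *
    (x ord0 i * Phi nu x)).
    by ring.
  rewrite hermite_mulX -/up -/dn -/l1 -/l0.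
  by move: (Phi up x) (Phi dn x) (partials s f x) => u v z; ring.
by rewrite mulX; move: ibp; lra.
Qed.

(** Each use of [coef_up] gains a factor [sqrt (nu i + 1)] on the coefficient, at
    the price of three coefficients of the same kind; [r] lists, with repetitions,
    the coordinates for which it is used. *)
Let coef_decay (r : seq 'I_n) : forall a s, exists2 C : R, 0 <= C & forall nu,
  coef a s nu ^+ 2 * \prod_(i <- r) (nu i).+1%:R <= C * hermite_cst R nu ^+ 2.
Proof.
elim: r => [|i r IH] a s.
  have [C FC] := F_weight a s.
  exists ((C * \int[mu]_x weight x) ^+ 2); first exact: sqr_ge0.
  move=> nu; rewrite big_nil mulr1 -exprMn.
  rewrite -[leLHS]real_normK ?num_real//; apply: lerXn2r; rewrite ?nnegrE//.
    rewrite mulr_ge0 ?hermite_cst_ge0// mulr_ge0 ?(weight_bound_ge0 FC)//.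
    by apply: Rintegral_ge0 => x _; exact: weight_ge0.
  apply: le_trans (le_normr_Rintegral _ (integrable_F a s nu)) _ => //.
  rewrite [leRHS](_ : _ = \int[mu]_x (C * hermite_cst R nu * weight x)).
    apply: le_Rintegral => //.
    - exact: (integrable_norm (integrable_F a s nu)).
    - exact: (integrableZl measurableT _ (integrable_weight R n)).
    move=> x _; rewrite normrM mulrAC ler_pM//; exact: hermite_bound.
  rewrite RintegralZl; last exact: integrable_weight.
    by rewrite mulrAC.
  exact: measurableT.
have [C0 C00 H0] := IH a s.
have [C1 C10 H1] := IH (upd i (a i).+1 a) s.
have [C2 C20 H2] := IH (upd i (a i).-1 a) s.
have [C3 C30 H3] := IH a (i :: s).
pose D := 3 * (C1 + (a i)%:R ^+ 2 * C2 + C3) * 2 ^+ size r.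
have D0 : 0 <= D by rewrite !mulr_ge0 ?exprn_ge0// !addr_ge0// mulr_ge0// sqr_ge0.
exists (C0 + D); first exact: addr_ge0.
move=> nu; rewrite big_cons.
have h0 : 0 <= hermite_cst R nu ^+ 2 by exact: sqr_ge0.
case E : (nu i) => [|k].
  rewrite mul1r (le_trans (H0 nu))// ler_wpM2r// lerDl//.
set dn := upd i k nu.
have nuE : nu = upd i (dn i).+1 dn by rewrite upd_same upd_upd -E upd_id.
have Pr (j : 'I_n) : (nu j).+1%:R <= 2 * (dn j).+1%:R :> R.
  rewrite ffunE; case: eqP => [->|_]; rewrite ?E -natrM ler_nat; lia.
have prod_le : \prod_(j <- r) (nu j).+1%:R <= 2 ^+ size r * \prod_(j <- r) (dn j).+1%:R :> R.
  elim: (r) => [|j t IHt]; first by rewrite !big_nil mulr1.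
  by rewrite !big_cons exprS mulrACA ler_pM ?ler0n ?prodr_ge0.
have cst_le : hermite_cst R dn ^+ 2 <= hermite_cst R nu ^+ 2.
  rewrite lerXn2r ?nnegrE ?hermite_cst_ge0//; apply: ler_prod => j _.
  rewrite mulr_ge0 ?exprn_ge0//= ler_wpM2l// lerXn2r ?nnegrE// ler_nat ffunE.
  by case: eqP => [->|_]; rewrite ?E; lia.
have := coef_up i a s dn; rewrite -nuE upd_same.
set c := coef a s nu; set l := ladder R k.+1.
set x1 := coef _ s dn; set x2 := coef _ s dn; set x3 := coef _ _ dn => lE.
have sq : c ^+ 2 * k.+2%:R <= 3 * (x1 ^+ 2 + (a i)%:R ^+ 2 * x2 ^+ 2 + x3 ^+ 2).
  apply: (@le_trans _ _ ((2 * l * c) ^+ 2)).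
    rewrite !exprMn sqr_ladder mulrC ler_wpM2r ?sqr_ge0//.
    rewrite -[k.+2]addn1 natrD; have : 1 <= k.+1%:R :> R by rewrite ler1n.
    lra.
  rewrite lE -exprMn; move: ((a i)%:R * x2) => z.
  by have := sqr_ge0 (x1 - z); have := sqr_ge0 (x1 - x3); have := sqr_ge0 (z - x3); nra.
rewrite mulrA.
apply: (@le_trans _ _ (3 * (x1 ^+ 2 + (a i)%:R ^+ 2 * x2 ^+ 2 + x3 ^+ 2) *
    (2 ^+ size r * \prod_(j <- r) (dn j).+1%:R))).
  by apply: ler_pM => //; [rewrite mulr_ge0// sqr_ge0|exact: prodr_ge0].
have := H1 dn; have := H2 dn; have := H3 dn; rewrite -/x1 -/x2 -/x3.
move: (\prod_(j <- r) _) => P h3 h2 h1.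
apply: (@le_trans _ _ (D * hermite_cst R dn ^+ 2)); last first.
  by rewrite mulrDl (le_trans (ler_wpM2l D0 cst_le))// lerDr mulr_ge0.
rewrite /D; move: (hermite_cst R dn ^+ 2) h1 h2 h3 => h h1 h2 h3.
have ha := ler_wpM2l (sqr_ge0 (a i)%:R) h2.
rewrite [leRHS](_ : _ = 2 ^+ size r * (3 * (C1 * h + (a i)%:R ^+ 2 * (C2 * h) + C3 * h))); last by ring.
rewrite [leLHS](_ : _ = 2 ^+ size r *
  (3 * (x1 ^+ 2 * P + (a i)%:R ^+ 2 * (x2 ^+ 2 * P) + x3 ^+ 2 * P))); last by ring.
by rewrite ler_wpM2l ?exprn_ge0// ler_wpM2l// !lerD.
Qed.

Definition real_coef nu : R := \int[mu]_x (f x * Phi nu x).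

Let F0 x : F [ffun=> 0%N] [::] x = f x.
Proof. by rewrite /F /mono /= big1 ?mul1r// => i _; rewrite ffunE expr0. Qed.

Let real_coefE nu : real_coef nu = coef [ffun=> 0%N] [::] nu.
Proof. by apply: eq_Rintegral => x _; rewrite F0. Qed.

Lemma schwartz_weight : exists C : R, forall x, `|f x| <= C * weight x.
Proof. by have [C FC] := F_weight [ffun=> 0%N] [::]; exists C => x; rewrite -F0. Qed.

Lemma integrable_schwartzM nu : mu.-integrable setT (EFin \o (fun x => f x * Phi nu x)).
Proof.
apply: eq_integrable (integrable_F [ffun=> 0%N] [::] nu) => // x _.
by rewrite /= F0.
Qed.

Lemma real_coef_decay : exists2 C : R, 0 <= C &
  forall nu, `|real_coef nu| * hermite_cst R nu <= C * inv_sqr R nu.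
Proof.
(* with [Q] the product of the [nu i + 1], [hermite_cst nu] is of order [Q^3] and
   [inv_sqr nu] is [Q^-2]; after squaring, [16 = 6 + 6 + 4] powers are needed *)
have [C C0 HC] := coef_decay (flatten (nseq 16 (index_enum 'I_n))) [ffun=> 0%N] [::].
exists (Num.sqrt C * 96 ^+ n ^+ 2); first by rewrite mulr_ge0 ?sqrtr_ge0 ?exprn_ge0.
move=> nu; have := HC nu; rewrite big_flatten/= -real_coefE.
set Q : R := \prod_i (nu i).+1%:R.
have Q0 : 0 < Q by apply: prodr_gt0.
have -> : \prod_(s <- nseq 16 (index_enum 'I_n)) \prod_(i <- s) (nu i).+1%:R = Q ^+ 16.
  by rewrite big_nseq /= mulr1; rewrite !exprS expr0 mulr1.
have -> : inv_sqr R nu = Q ^- 2 by rewrite /inv_sqr prodfV prodrXl.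
have -> : hermite_cst R nu = 96 ^+ n * Q ^+ 3.
  by rewrite /hermite_cst big_split/= prodr_const card_ord prodrXl.
set K : R := 96 ^+ n; have K0 : 0 <= K by rewrite exprn_ge0.
move: (real_coef nu) => c cQ.
rewrite ler_pdivlMr ?exprn_gt0//.
have lhs0 : 0 <= `|c| * (K * Q ^+ 3) * Q ^+ 2.
  by rewrite !mulr_ge0 ?exprn_ge0 ?(ltW Q0).
have rhs0 : 0 <= Num.sqrt C * K ^+ 2 by rewrite mulr_ge0 ?sqrtr_ge0 ?exprn_ge0.
rewrite -(ler_pXn2r (n := 2))//.
have Q6 : 0 < Q ^+ 6 by rewrite exprn_gt0.
rewrite -(ler_pM2r Q6).
apply: (@le_trans _ _ (K ^+ 2 * (c ^+ 2 * Q ^+ 16))).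
  rewrite -[c ^+ 2]real_normK ?num_real//.
  by rewrite le_eqVlt; apply/orP; left; apply/eqP; ring.
apply: (le_trans (ler_wpM2l (sqr_ge0 K) cQ)).
rewrite le_eqVlt; apply/orP; left; apply/eqP.
by rewrite [in RHS]exprMn sqr_sqrtr//; ring.
Qed.

Let c := real_coef.
Let S M x := \sum_(nu <- enum_upto _ M) c nu * Phi nu x.

Let partial_bound : exists2 B : R, 0 <= B & forall (s : seq {ffun 'I_n -> nat}) x,
  uniq s -> \sum_(nu <- s) `|c nu * Phi nu x| <= B * weight x.
Proof.
have [C C0 HC] := real_coef_decay; exists (C * 2 ^+ n); first by rewrite mulr_ge0.
move=> s x us; apply: (@le_trans _ _ (\sum_(nu <- s) C * inv_sqr R nu * weight x)).
  apply: ler_sum => nu _; rewrite normrM.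
  apply: le_trans (ler_wpM2r (weight_ge0 x) (HC nu)).
  by rewrite -mulrA ler_wpM2l// hermite_decay.
rewrite -mulr_suml -mulr_sumr ler_wpM2r ?weight_ge0// ler_wpM2l//.
exact: sum_inv_sqr_bounded.
Qed.

Let tail eps : 0 < eps -> exists N, forall (s : seq {ffun 'I_n -> nat}) x, uniq s ->
  (forall nu, nu \in s -> (N <= pickle nu)%N) ->
  `|\sum_(nu <- s) c nu * Phi nu x| <= eps * weight x.
Proof.
move=> e0; have [C C0 HC] := real_coef_decay.
have C1 : 0 < C + 1 by rewrite ltr_wpDl.
have [N HN] := summable_tail (@inv_sqr_ge0 R n) (@sum_inv_sqr_bounded R n)
  (divr_gt0 e0 C1).
exists N => s x us sN; apply: le_trans (ler_norm_sum _ _ _) _.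
apply: (@le_trans _ _ (\sum_(nu <- s) (C + 1) * inv_sqr R nu * weight x)).
  apply: ler_sum => nu _; rewrite normrM.
  apply: (@le_trans _ _ (`|c nu| * hermite_cst R nu * weight x)).
    by rewrite -mulrA ler_wpM2l// hermite_decay.
  rewrite ler_wpM2r ?weight_ge0// (le_trans (HC nu))// ler_wpM2r ?inv_sqr_ge0//.
  by rewrite lerDl.
rewrite -mulr_suml -mulr_sumr ler_wpM2r ?weight_ge0//.
by rewrite mulrC -ler_pdivlMr// HN.
Qed.

Let cvg_S x : cvgn (S ^~ x).
Proof.
rewrite /S sum_enum_upto; apply: normed_cvg.
apply: nondecreasing_is_cvgn.
  by apply: nondecreasing_series => k /=.
have [B B0 HB] := partial_bound; exists (B * weight x) => _ [M _ <-].
rewrite /= (le_trans _ (HB (enum_upto _ M) x (enum_upto_uniq _ M)))//.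
have -> := congr1 (@^~ M) (sum_enum_upto (fun nu : {ffun 'I_n -> nat} => `|c nu * Phi nu x|)).
by rewrite !seriesEnat/=; apply: ler_sum => k _; exact: ler_norm_sum.
Qed.

Let Sl x := limn (S ^~ x).

(** The partial sums along the enumeration differ from the sum over [A] only by
    indices beyond the first [N], which [tail] controls. *)
Let approx eps : 0 < eps -> exists N, forall (A : seq {ffun 'I_n -> nat}) x, uniq A ->
  (forall nu, (pickle nu < N)%N -> nu \in A) ->
  `|Sl x - \sum_(nu <- A) c nu * Phi nu x| <= eps * weight x.
Proof.
move=> e0; have [N HN] := tail e0; exists N => A x uA NA.
have cv : `|S M x - \sum_(nu <- A) c nu * Phi nu x| @[M --> \oo] -->
    `|Sl x - \sum_(nu <- A) c nu * Phi nu x|.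
  by apply: cvg_norm; apply: cvgB; [exact: cvg_S|exact: cvg_cst].
have <- := cvg_lim (@Rhausdorff R) cv; apply: limr_le.
  by apply/cvg_ex; eexists; exact: cv.
pose K := (\max_(nu <- A) pickle nu).+1.
near=> M.
have AM nu : nu \in A -> nu \in enum_upto _ M.
  move=> nuA; rewrite mem_enum_upto (@leq_trans K)//; last first.
    by near: M; exact: nbhs_infty_ge.
  by rewrite ltnS leq_bigmax_seq.
pose rest := [seq nu <- enum_upto _ M | nu \notin A].
have pe : perm_eq (enum_upto _ M) (A ++ rest).
  apply: uniq_perm; first exact: enum_upto_uniq.
    rewrite cat_uniq uA filter_uniq ?enum_upto_uniq// andbT.
    by apply/hasPn => nu; rewrite mem_filter => /andP[].
  move=> nu; rewrite mem_cat mem_filter; case: (boolP (nu \in A)) => //= /AM.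
  by move=> ->.
rewrite /S (perm_big _ pe) big_cat/= [X in `|X - _|]addrC addrK; apply: HN.
  by rewrite filter_uniq// enum_upto_uniq.
move=> nu; rewrite mem_filter => /andP[nuA _]; rewrite leqNgt.
by apply: contra nuA; exact: NA.
Unshelve. all: by end_near. Qed.

Let Sl_approx eps : 0 < eps -> exists N, forall x, `|Sl x - S N x| <= eps * weight x.
Proof.
move=> /approx[N HN]; exists N => x; apply: HN; first exact: enum_upto_uniq.
by move=> nu; rewrite mem_enum_upto.
Qed.

Let continuous_S M : continuous (S M).
Proof.
by apply: continuous_sum_rV => nu; apply: continuousZ_rV; exact: continuous_hermite.
Qed.

Let continuous_Sl : continuous Sl.
Proof.
move=> x; apply/(@cvgrPdist_le _ _ _ (nbhs x)) => eps e0.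
have e30 : 0 < eps / 3 by rewrite divr_gt0.
have [N HN] := Sl_approx e30.
have HN' y : `|Sl y - S N y| <= eps / 3.
  by rewrite (le_trans (HN y))// ler_piMr ?weight_le1// ltW.
have /cvgrPdist_le/(_ _ e30) := @continuous_S N x; apply: filterS => y xy.
rewrite (le_trans (ler_distD (S N x) _ _))//.
have := ler_distD (S N y) (S N x) (Sl y); have := HN' x; have := HN' y.
rewrite (distrC (Sl y)); move: xy; lra.
Qed.

Let S_bound : exists2 B : R, 0 <= B & forall M x, `|S M x| <= B * weight x.
Proof.
have [B B0 HB] := partial_bound; exists B => // M x.
by rewrite (le_trans (ler_norm_sum _ _ _))// HB// enum_upto_uniq.
Qed.

(** The sum of the Hermite series of [f] has the same Hermite coefficients as [f],
    and both are dominated by the weight: completeness applies to the difference. *)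
Lemma schwartz_expansion_pointwise x : f x = Sl x.
Proof.
have [B B0 HB] := S_bound; have [C fC] := schwartz_weight.
have SlB y : `|Sl y| <= B * weight y.
  have cv : `|S M y| @[M --> \oo] --> `|Sl y| by apply: cvg_norm; exact: cvg_S.
  have <- := cvg_lim (@Rhausdorff R) cv; apply: limr_le.
    by apply/cvg_ex; eexists; exact: cv.
  by apply: nearW => M; exact: HB.
have cf : continuous f := (sf.1 [::]).1.
have mS M : measurable_fun setT (S M) by exact: measurable_continuous_rV (@continuous_S M).
have mSl : measurable_fun setT Sl by exact: measurable_continuous_rV continuous_Sl.
suff H y : f y - Sl y = 0 by apply/eqP; rewrite -subr_eq0 H.
apply: (@orthogonal_eq0 R n (fun y => f y - Sl y) (C + B)).
- have := continuousD_rV cf (continuousZ_rV (c := -1) continuous_Sl).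
  by under eq_fun do rewrite mulN1r.
- by move=> z; rewrite (le_trans (ler_normB _ _))// mulrDl lerD.
move=> nu.
have PB (g : 'rV[R]_n -> R) : (forall z, `|g z| <= B * weight z) ->
    forall z, `|g z * Phi nu z| <= B * hermite_cst R nu * weight z.
  move=> gB z; rewrite normrM mulrAC ler_pM//; exact: hermite_bound.
have iSl : mu.-integrable setT (EFin \o (fun z => Sl z * Phi nu z)).
  apply: integrable_weight_bound (PB _ SlB).
  by apply: measurable_funM => //; exact: measurable_hermite.
under eq_Rintegral do rewrite mulrBl.
rewrite RintegralB//; last exact: integrable_schwartzM.
apply/eqP; rewrite subr_eq0; apply/eqP.
have lim1 : \int[mu]_z (S M z * Phi nu z) @[M --> \oo] --> \int[mu]_z (Sl z * Phi nu z).
  apply: (Rdominated_cvg _ (g := fun z => B * hermite_cst R nu * weight z)).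
  - by move=> M; apply: measurable_funM => //; exact: measurable_hermite.
  - exact: (integrableZl measurableT _ (integrable_weight R n)).
  - by move=> M z; exact: PB (HB M) z.
  - by move=> z; apply: cvgM; [exact: cvg_S|exact: cvg_cst].
have lim2 : \int[mu]_z (S M z * Phi nu z) @[M --> \oo] --> c nu.
  apply: cvg_near_cst; near=> M.
  have iP k : mu.-integrable setT (EFin \o (fun z => Phi k z * Phi nu z)).
    apply: (@integrable_weight_bound _ _ _ (hermite_cst R k * hermite_cst R nu)).
      by apply: measurable_funM; exact: measurable_hermite.
    move=> z; rewrite normrM mulrAC ler_pM// ?hermite_decay//.
    exact: hermite_bound.
  transitivity (\int[mu]_z \sum_(k <- enum_upto _ M) c k * (Phi k z * Phi nu z)).
    by apply: eq_Rintegral => z _; rewrite mulr_suml; apply: eq_bigr => k _; rewrite mulrA.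
  rewrite Rintegral_sum => [|k]; last exact: (integrableZl measurableT _ (iP k)).
  rewrite (bigD1_seq nu) ?enum_upto_uniq//=; last first.
    by rewrite mem_enum_upto; near: M; exact: nbhs_infty_gt.
  rewrite big1 => [|k knu].
    by rewrite addr0 RintegralZl// hermite_orthonormal eqxx mulr1.
  by rewrite RintegralZl// hermite_orthonormal (negbTE knu) mulr0.
exact: cvg_unique lim2 lim1.
Unshelve. all: by end_near. Qed.

(** The expansion converges unconditionally, uniformly with respect to the
    weight; this implies convergence in every [L^p]. *)
Theorem schwartz_expansion eps : 0 < eps -> exists N,
  forall (A : seq {ffun 'I_n -> nat}) x, uniq A ->
  (forall nu, (pickle nu < N)%N -> nu \in A) ->
  `|f x - \sum_(nu <- A) real_coef nu * Phi nu x| <= eps * weight x.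
Proof.
by move=> /approx[N HN]; exists N => A x; rewrite schwartz_expansion_pointwise; exact: HN.
Qed.

End schwartz_expansion.

(** * Riesz representation on a weighted space *)

(** A functional on L^p is studied through its values on the functions [W * s],
    where [W] is a fixed positive integrable weight and [s] is bounded. They lie in
    L^p since [W <= 1], and Hermite functions are of this form. *)
Definition bounded_measurable d (T : measurableType d) (R : realType) (s : T -> R) :=
  measurable_fun setT s /\ exists B : R, forall x, `|s x| <= B.

Section weighted_powers.
Context d (T : measurableType d) (R : realType).
Variables (mu : {measure set T -> \bar R}) (W : T -> R) (p : R).
Hypothesis W_gt0 : forall x, 0 < W x.
Hypothesis W_le1 : forall x, W x <= 1.
Hypothesis iW : mu.-integrable setT (EFin \o W).
Hypothesis p_ge1 : 1 <= p.

Let p_ge0 : 0 <= p. Proof. exact: le_trans ler01 p_ge1. Qed.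

Lemma weighted_powR_le (s : T -> R) B x : `|s x| <= B ->
  (W x * `|s x|) `^ p <= B `^ p * W x.
Proof.
move=> sB; rewrite powRM ?normr_ge0 ?(ltW (W_gt0 _))// mulrC.
have B0 : 0 <= B by rewrite (le_trans _ sB).
rewrite ler_pM ?powR_ge0//; last by rewrite ge1r_powR// W_gt0 W_le1.
by rewrite ge0_ler_powR ?nnegrE ?normr_ge0.
Qed.

Lemma measurable_weighted_powR s : bounded_measurable s ->
  measurable_fun setT (fun x => (W x * `|s x|) `^ p).
Proof.
move=> [ms _]; apply: (measurableT_comp (measurable_powR _)).
apply: measurable_funM; last exact: measurableT_comp.
exact/measurable_EFinP/(measurable_int mu iW).
Qed.

Lemma integrable_weighted_powR s : bounded_measurable s ->
  mu.-integrable setT (EFin \o (fun x => (W x * `|s x|) `^ p)).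
Proof.
move=> bs; have [_ [B sB]] := bs.
apply: (@integrable_dominated _ _ _ mu _ (fun x => B `^ p * W x)).
- exact: measurable_weighted_powR.
- exact: (integrableZl measurableT (B `^ p) iW).
- by move=> x; rewrite ger0_norm ?powR_ge0// weighted_powR_le.
Qed.

End weighted_powers.

Section riesz.
Context d (T : measurableType d) (R : realType).
Variable mu : {sigma_finite_measure set T -> \bar R}.
Variables (W : T -> R) (p M : R) (L : (T -> R) -> R).

Local Notation bm := (@bounded_measurable _ T R).

Hypothesis W_gt0 : forall x, 0 < W x.
Hypothesis W_le1 : forall x, W x <= 1.
Hypothesis iW : mu.-integrable setT (EFin \o W).
Hypothesis p_ge1 : 1 <= p.
Hypothesis M_ge0 : 0 <= M.
Hypothesis L_lin : forall a s t, bm s -> bm t ->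
  L (fun x => a * s x + t x) = a * L s + L t.
Hypothesis L_le : forall s, bm s ->
  `|L s| <= M * (\int[mu]_x (W x * `|s x|) `^ p) `^ p^-1.

Let p_gt0 : 0 < p. Proof. exact: lt_le_trans p_ge1. Qed.
Let pVp : p * p^-1 = 1. Proof. by rewrite mulfV// gt_eqF. Qed.
Let pVp' : p^-1 * p = 1. Proof. by rewrite mulVf// gt_eqF. Qed.

Let mW : measurable_fun setT W.
Proof. exact/measurable_EFinP/(measurable_int mu iW). Qed.

Let bmD s t : bm s -> bm t -> bm (fun x => s x + t x).
Proof.
move=> [ms [B sB]] [mt [C tC]]; split; first exact: measurable_funD.
by exists (B + C) => x; rewrite (le_trans (ler_normD _ _))// lerD.
Qed.

Let bmZ a s : bm s -> bm (fun x => a * s x).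
Proof.
move=> [ms [B sB]]; split; first exact: measurable_funM.
by exists (`|a| * B) => x; rewrite normrM ler_wpM2l.
Qed.

Let bm0 : bm (fun=> 0).
Proof. by split=> //; exists 0 => x; rewrite normr0. Qed.

Let bm1 (A : set T) : measurable A -> bm \1_A.
Proof.
move=> mA; split; first exact: measurable_indic.
by exists 1 => x; rewrite indicE; case: (x \in A); rewrite ?normr1 ?normr0.
Qed.

Let L0 : L (fun=> 0) = 0.
Proof.
have := L_lin (-1) bm0 bm0.
by rewrite (_ : (fun=> _) = (fun=> 0)) ?mulN1r ?addNr//; apply/funext => x; rewrite mulN1r addNr.
Qed.

Let LZ a s : bm s -> L (fun x => a * s x) = a * L s.
Proof.
move=> bs; have := L_lin a bs bm0; rewrite L0 addr0 => <-.
by congr L; apply/funext => x; rewrite addr0.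
Qed.

Let LD s t : bm s -> bm t -> L (fun x => s x + t x) = L s + L t.
Proof.
move=> bs bt; have := L_lin 1 bs bt; rewrite mul1r => <-.
by congr L; apply/funext => x; rewrite mul1r.
Qed.

Let LB s t : bm s -> bm t -> L s - L t = L (fun x => s x - t x).
Proof.
move=> bs bt; have := L_lin (-1) bt bs; rewrite mulN1r addrC => <-.
by congr L; apply/funext => x; rewrite mulN1r addrC.
Qed.

Let bm_sum (I : Type) (r : seq I) (s : I -> T -> R) : (forall i, bm (s i)) ->
  bm (fun x => \sum_(i <- r) s i x).
Proof.
move=> bs; elim: r => [|i r IH].
  by under eq_fun do rewrite big_nil.
by under eq_fun do rewrite big_cons; exact: bmD.
Qed.

Let L_sum (I : Type) (r : seq I) (s : I -> T -> R) : (forall i, bm (s i)) ->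
  L (fun x => \sum_(i <- r) s i x) = \sum_(i <- r) L (s i).
Proof.
move=> bs; elim: r => [|i r IH].
  by under eq_fun do rewrite big_nil; rewrite L0 big_nil.
by under eq_fun do rewrite big_cons; rewrite LD ?IH ?big_cons//; exact: bm_sum.
Qed.

Let integrable_powM s : bm s ->
  mu.-integrable setT (EFin \o (fun x => (W x * `|s x|) `^ p)).
Proof. by move=> bs; exact: integrable_weighted_powR. Qed.

Let iWp : mu.-integrable setT (EFin \o (fun x => W x `^ p)).
Proof.
have := integrable_powM (bm1 measurableT).
congr (_ .-integrable setT _); apply/funext => x /=.
by rewrite indicT normr1 mulr1.
Qed.

Let K := M * (\int[mu]_x W x `^ p) `^ p^-1.

Let L_le_cst s c : 0 <= c -> bm s -> (forall x, `|s x| <= c) -> `|L s| <= c * K.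
Proof.
move=> c0 bs sc; apply: (le_trans (L_le bs)); rewrite /K mulrCA ler_wpM2l//.
have -> : c * (\int[mu]_x W x `^ p) `^ p^-1 = (\int[mu]_x (c `^ p * W x `^ p)) `^ p^-1.
  rewrite RintegralZl// powRM ?powR_ge0 ?Rintegral_ge0//; last by move=> *; exact: powR_ge0.
  by rewrite -powRrM pVp powRr1.
apply: ge0_ler_powR; rewrite ?nnegrE ?invr_ge0 ?(ltW p_gt0) ?Rintegral_ge0//;
  try by move=> *; rewrite ?mulr_ge0 ?powR_ge0.
apply: le_Rintegral => //.
- exact: integrable_powM.
- exact: (integrableZl measurableT (c `^ p) iWp).
- move=> x _; rewrite powRM ?normr_ge0 ?(ltW (W_gt0 _))// mulrC ler_wpM2r ?powR_ge0//.
  by rewrite ge0_ler_powR ?nnegrE ?normr_ge0 ?(ltW p_gt0).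
Qed.

(** Dominated convergence in L^p: this makes the set function [kappa] below
    countably additive. *)
Let L_cvg0 (s : nat -> T -> R) : (forall k, bm (s k)) ->
  (forall k x, `|s k x| <= 1) -> (forall x, s k x @[k --> \oo] --> 0) ->
  L (s k) @[k --> \oo] --> 0.
Proof.
move=> bs s1 s0.
have I0 : \int[mu]_x (W x * `|s k x|) `^ p @[k --> \oo] --> 0.
  have := @Rdominated_cvg _ _ _ mu (fun k x => (W x * `|s k x|) `^ p) (fun=> 0) W.
  rewrite Rintegral_cst// mul0r; apply => //.
  - by move=> k; exact: (measurable_weighted_powR p iW).
  - by move=> k x; rewrite ger0_norm ?powR_ge0//
      (le_trans (weighted_powR_le W_gt0 W_le1 p_ge1 (s1 k x)))// powR1 mul1r.
  - move=> x; apply/cvgrPdist_le => eps e0.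
    have /cvgrPdist_le/(_ (eps `^ p^-1)) := s0 x; rewrite powR_gt0// => /(_ erefl).
    apply: filterS => k; rewrite !sub0r !normrN => sk.
    rewrite ger0_norm ?powR_ge0//.
    rewrite -[leRHS](_ : (eps `^ p^-1) `^ p = _); last by rewrite -powRrM pVp' powRr1// ltW.
    rewrite ge0_ler_powR ?nnegrE ?(ltW p_gt0) ?powR_ge0 ?mulr_ge0 ?(ltW (W_gt0 x))//.
    rewrite (le_trans _ sk)// ler_piMl//; exact: W_le1.
apply/cvgrPdist_le => eps e0.
pose del := (eps / (M + 1)) `^ p.
have M1 : 0 < M + 1 by rewrite ltr_wpDl.
have del0 : 0 < del by rewrite powR_gt0// divr_gt0.
have /cvgrPdist_le/(_ _ del0) := I0.
apply: filterS => k; rewrite !sub0r !normrN => Ik.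
apply: (le_trans (L_le (bs k))).
apply: (@le_trans _ _ (M * (eps / (M + 1)))); last first.
  by rewrite mulrCA ler_piMr ?(ltW e0)// ler_pdivrMr// mul1r lerDl.
rewrite ler_wpM2l//.
rewrite -[leRHS](_ : del `^ p^-1 = _); last by rewrite /del -powRrM pVp powRr1// divr_ge0 ?ltW.
apply: ge0_ler_powR; rewrite ?nnegrE ?invr_ge0 ?(ltW p_gt0) ?(ltW del0)//.
- by apply: Rintegral_ge0 => x _; exact: powR_ge0.
- by rewrite (le_trans (ler_norm _)).
Qed.

Definition functional_charge (A : set T) : \bar R := (L \1_A)%:E.

Local Notation kappa := functional_charge.

Let kappa0 : kappa set0 = 0%E.
Proof. by rewrite /kappa indic0 L0. Qed.

Let kappa_fin A : measurable A -> kappa A \is a fin_num.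
Proof. by []. Qed.

Let kappa_additive : semi_sigma_additive kappa.
Proof.
move=> F mF tF mUF.
have -> : (fun n => \sum_(0 <= i < n) kappa (F i))%E =
    (fun n => (L (fun x => \sum_(0 <= i < n) \1_(F i) x))%:E).
  by apply/funext => n; rewrite /kappa sumEFin L_sum// => i; exact: bm1.
apply: cvg_EFin; first exact: nearW.
have bU := bm1 mUF; have bF i : bm \1_(F i) by exact: bm1.
have F1 x j : F j x -> forall k, (j < k)%N -> \sum_(0 <= i < k) \1_(F i) x = 1 :> R.
  move=> Fj k jk; rewrite (big_rem j) ?mem_index_iota//= indicE mem_set// big1_seq ?addr0//.
  move=> i /= ; rewrite mem_rem_uniq ?iota_uniq// inE => /andP[ij _].
  rewrite indicE memNset// => Fi; move/trivIsetP: tF => /(_ i j I I ij).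
  by apply/eqP/set0P; exists x.
have F0 x : ~ (\bigcup_i F i) x -> forall k, \sum_(0 <= i < k) \1_(F i) x = 0 :> R.
  move=> nF k; rewrite big1// => i _; rewrite indicE memNset// => Fi.
  by apply: nF; exists i.
pose b k x : R := \1_(\bigcup_i F i) x - \sum_(0 <= i < k) \1_(F i) x.
have bb k : bm (b k).
  apply: (@bmD _ (fun x => - _)) => //.
  rewrite (_ : (fun x => _) = (fun x => -1 * \sum_(0 <= i < k) \1_(F i) x)).
    by apply: bmZ; exact: bm_sum.
  by apply/funext => x; rewrite mulN1r.
have lim0 x : b k x @[k --> \oo] --> 0.
  rewrite /b; have [Ux|Ux] := pselect ((\bigcup_i F i) x); last first.
    apply: cvg_near_cst; apply: nearW => k.
    by rewrite F0// indicE memNset// subrr.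
  have [j _ Fj] := Ux; apply: cvg_near_cst; exists j.+1 => // k /= jk.
  by rewrite (F1 x j)// indicE mem_set// subrr.
have b1 k x : `|b k x| <= 1.
  rewrite /b; have [Ux|Ux] := pselect ((\bigcup_i F i) x); last first.
    by rewrite F0// indicE memNset// subrr normr0.
  have S0 : 0 <= \sum_(0 <= i < k) \1_(F i) x :> R by apply: sumr_ge0 => i _; rewrite indicE.
  have S1 : \sum_(0 <= i < k) \1_(F i) x <= 1 :> R.
    have [j _ Fj] := Ux; rewrite -(F1 x j Fj (k + j.+1)%N) ?leq_addl//.
    by rewrite [leRHS](@big_cat_nat _ _ _ k) ?leq_addr//= lerDl sumr_ge0// => i _; rewrite indicE.
  by rewrite indicE mem_set// ger0_norm ?subr_ge0// lerBlDr lerDl.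
have := L_cvg0 bb b1 lim0.
move=> /cvgrPdist_le h; apply/cvgrPdist_le => eps /h.
apply: filterS => k; rewrite sub0r normrN /b -LB//.
exact: bm_sum.
Qed.

HB.instance Definition _ :=
  isCharge.Build _ _ _ kappa kappa0 kappa_fin kappa_additive.

Let kappa_dominated : kappa `<< mu.
Proof.
apply/null_content_dominatesP => A mA A0; rewrite /kappa; congr EFin.
apply/eqP; rewrite -normr_le0 (le_trans (L_le (bm1 mA)))//.
have -> : \int[mu]_x (W x * `|\1_A x|) `^ p = 0.
  rewrite (_ : (\int[mu]_x _) = \int[mu]_(x in A) (W x `^ p)).
    rewrite /Rintegral null_set_integral//.
    by apply: measurable_funTS; exact: (measurable_int mu iWp).
  rewrite [RHS]Rintegral_mkcond; apply: eq_Rintegral => x _.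
  rewrite patchE indicE; case: (x \in A); first by rewrite normr1 mulr1.
  by rewrite normr0 mulr0 powR0// gt_eqF.
by rewrite powR0 ?mulr0// invr_eq0 gt_eqF.
Qed.

Let G x := fine (Radon_Nikodym kappa mu x).

Let iG : mu.-integrable setT (EFin \o G).
Proof.
have := Radon_Nikodym_integrable kappa_dominated.
congr (_ .-integrable setT _); apply/funext => x /=.
by rewrite /G fineK//; exact: (Radon_Nikodym_fin_num _ kappa_dominated).
Qed.

Let mG : measurable_fun setT G.
Proof. exact/measurable_EFinP/(measurable_int mu iG). Qed.

Let L_indic A : measurable A -> L \1_A = \int[mu]_x (G x * \1_A x).
Proof.
move=> mA; have LA : kappa A = _ := Radon_Nikodym_integral kappa_dominated mA.
transitivity (\int[mu]_(x in A) G x).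
  rewrite /Rintegral [LHS](_ : _ = fine (kappa A))// LA; congr fine.
  by apply: eq_integral => x _; rewrite /G fineK//; exact: (Radon_Nikodym_fin_num _ kappa_dominated).
rewrite Rintegral_mkcond; apply: eq_Rintegral => x _.
by rewrite patchE indicE; case: (x \in A); rewrite ?mulr1 ?mulr0.
Qed.

Let integrable_GM s : bm s -> mu.-integrable setT (EFin \o (fun x => G x * s x)).
Proof.
move=> [ms [B sB]].
apply: (@integrable_dominated _ _ _ mu _ (fun x => B * `|G x|)).
- exact: measurable_funM.
- exact: (integrableZl measurableT B (integrable_norm iG)).
- by move=> x; rewrite normrM mulrC ler_wpM2r.
Qed.

(** Both sides are continuous for uniform convergence and agree on step functions.
    Rounding the values of [s + B] down to multiples of [1 / (j + 1)] gives step
    functions [sj j] that converge uniformly to [s]. *)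
Let L_integral s : bm s -> L s = \int[mu]_x (G x * s x).
Proof.
move=> bs; have [ms [B sB]] := bs.
have B0 : 0 <= B \/ (forall x : T, False).
  have [[x _]|] := pselect (exists x : T, True); first by left; rewrite (le_trans _ (sB x)).
  by move=> h; right => x; apply: h; exists x.
case: B0 => [B0|T0]; last first.
  have -> : s = (fun=> 0) by apply/funext => x; case: (T0 x).
  by rewrite L0; under eq_Rintegral do rewrite mulr0; rewrite Rintegral_cst// mul0r.
pose N (j : nat) : R := j.+1%:R.
pose A j k := (fun x => Num.trunc (N j * (s x + B))) @^-1` [set k].
have mA j k : measurable (A j k).
  rewrite -[X in measurable X]setTI.
  have mt : measurable_fun setT (fun x => N j * (s x + B)).
    by apply: measurable_funM => //; exact: measurable_funD.
  rewrite (_ : _ `&` _ = [set: T] `&` (fun x => N j * (s x + B)) @^-1` `[k%:R, k.+1%:R[).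
    by apply: mt => //; exact: measurable_itv.
  apply/seteqP; split => x /= [_]; rewrite /A/= in_itv/=.
    have : 0 <= N j * (s x + B).
      by rewrite mulr_ge0// -lerBlDr sub0r; have := sB x; rewrite ler_norml => /andP[].
    by move=> /Num.Theory.truncn_itv /[swap] ->.
  move=> h; split => //; apply/eqP; rewrite truncn_eq//.
  by have /andP[/(le_trans _)->] := h.
pose c j (k : nat) : R := k%:R / N j - B.
pose K_ j := Num.trunc (N j * (B + B)).
pose sj j x := \sum_(k <- iota 0 (K_ j).+1) c j k * \1_(A j k) x.
have bsj j : bm (sj j) by apply: bm_sum => k; apply: bmZ; exact: bm1.
have Lsj j : L (sj j) = \int[mu]_x (G x * sj j x).
  rewrite /sj L_sum => [|k]; last by apply: bmZ; exact: bm1.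
  rewrite (eq_bigr (fun k => \int[mu]_x (G x * (c j k * \1_(A j k) x)))); last first.
    move=> k _; rewrite LZ ?L_indic//; last exact: bm1.
    rewrite -RintegralZl//; last by apply: integrable_GM; exact: bm1.
    by apply: eq_Rintegral => x _; rewrite mulrCA.
  rewrite -Rintegral_sum => [|k]; last by apply: integrable_GM; apply: bmZ; exact: bm1.
  by apply: eq_Rintegral => x _; rewrite mulr_sumr.
have ssj j x : `|s x - sj j x| <= (N j)^-1.
  have N0 : 0 < N j by rewrite ltr0n.
  pose k := Num.trunc (N j * (s x + B)).
  have xB : 0 <= N j * (s x + B).
    by rewrite mulr_ge0// -lerBlDr sub0r; have := sB x; rewrite ler_norml => /andP[].
  have kK : (k < (K_ j).+1)%N.
    rewrite ltnS /k /K_ le_truncn// ler_wpM2l ?(ltW N0)// lerD2r.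
    by rewrite (le_trans (ler_norm _)).
  have -> : sj j x = c j k.
    rewrite /sj (big_rem k) ?mem_iota// indicE mem_set// mulr1 big1_seq; last first.
      move=> i /andP[_]; rewrite mem_rem_uniq ?iota_uniq// inE => /andP[ik _].
      by rewrite indicE memNset ?mulr0// => Ai; move: ik; rewrite /k Ai eqxx.
    exact: addr0.
  have /andP[k1 k2] := Num.Theory.truncn_itv xB.
  rewrite -/k in k1 k2.
  have -> : s x - c j k = (N j * (s x + B) - k%:R) / N j.
    by rewrite /c mulrBl mulrAC mulfV ?gt_eqF// mul1r opprB addrA.
  rewrite normrM ger0_norm ?subr_ge0// gtr0_norm ?invr_gt0// ler_piMl ?invr_ge0 ?(ltW N0)//.
  by rewrite lerBlDl natr1 ltW.
pose C := K + \int[mu]_x `|G x|.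
have key j : `|L s - \int[mu]_x (G x * s x)| <= C / N j.
  have -> : L s - \int[mu]_x (G x * s x) =
      (L s - L (sj j)) - (\int[mu]_x (G x * s x) - \int[mu]_x (G x * sj j x)).
    by rewrite -Lsj opprB addrA subrK.
  rewrite (le_trans (ler_normB _ _))// /C mulrDl lerD//.
    rewrite LB// mulrC; apply: L_le_cst; [by rewrite invr_ge0| |exact: ssj].
    apply: bmD => //; rewrite (_ : (fun x => _) = (fun x => -1 * sj j x)); first exact: bmZ.
    by apply/funext => x; rewrite mulN1r.
  rewrite -RintegralB//; [|exact: integrable_GM|exact: integrable_GM].
  have iB := integrableB measurableT (integrable_GM bs) (integrable_GM (bsj j)).
  rewrite (le_trans (le_normr_Rintegral measurableT iB))//.
  rewrite mulrC -RintegralZl//; last exact: integrable_norm.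
  apply: le_Rintegral => //.
  - exact: (integrable_norm iB).
  - exact: (integrableZl measurableT (N j)^-1 (integrable_norm iG)).
  - by move=> x _; rewrite -mulrBr normrM mulrC ler_wpM2r.
apply/eqP; rewrite -subr_eq0 -normr_le0; apply/ler_addgt0Pl => eps e0; rewrite addr0.
have [j] : exists j, C / N j <= eps; last exact: le_trans.
exists (Num.trunc (`|C| / eps)); rewrite ler_pdivrMr ?ltr0n// mulrC -ler_pdivrMr//.
rewrite (@le_trans _ _ (`|C| / eps))// ?ler_wpM2r ?invr_ge0 ?(ltW e0) ?ler_norm//.
by rewrite ltW// truncnS_gt.
Qed.

Let V x := W x `^ (-1).

Let VW x : V x * W x = 1.
Proof. by rewrite /V powR_inv1 ?mulVf ?gt_eqF ?(ltW (W_gt0 x)). Qed.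

Let V_gt0 x : 0 < V x. Proof. by rewrite powR_gt0. Qed.

Let mV : measurable_fun setT V.
Proof. exact: (measurableT_comp (measurable_powR _)). Qed.

(** The functional sees the function [W * s], so that its density [G] with respect
    to [s] has to be divided by [W]. *)
Let g x := G x * V x.

Let mg : measurable_fun setT g.
Proof. exact: measurable_funM. Qed.

Let gW x : g x * W x = G x.
Proof. by rewrite /g -mulrA VW mulr1. Qed.

Let sgn x : R := if G x < 0 then -1 else 1.

Let msgn : measurable_fun setT sgn.
Proof. by apply: measurable_fun_ifT => //; exact: measurable_fun_ltr. Qed.

Let normr_sgn x : `|sgn x| = 1.
Proof. by rewrite /sgn; case: ifP => _; rewrite ?normrN1 ?normr1. Qed.

Let sgnG x : G x * sgn x = `|G x|.
Proof. rewrite /sgn; case: ltrP => Gx; first by rewrite mulrN1 ltr0_norm.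
by rewrite mulr1 ger0_norm. Qed.

Section finite_exponent.
Variable q : R.
Hypothesis pq : p^-1 + q^-1 = 1.
Hypothesis q_ge1 : 1 <= q.

Let q_gt0 : 0 < q. Proof. exact: lt_le_trans q_ge1. Qed.

Let q1_gt0 : 0 < q - 1.
Proof.
rewrite subr_gt0 -[q]invrK invf_gt1 ?invr_gt0//.
by rewrite -pq ltrDr invr_gt0.
Qed.

Let q1p : (q - 1) * p = q.
Proof.
have p0 := lt0r_neq0 p_gt0; have q0 := lt0r_neq0 q_gt0.
have e : q + p = p * q by rewrite -[RHS]mul1r -pq; field; rewrite p0 q0.
by rewrite mulrBl mul1r mulrC -e addrK.
Qed.

Let h x := `|g x| `^ (q - 1).

Let mh : measurable_fun setT h.
Proof.
by apply: (measurableT_comp (measurable_powR _)); exact: measurableT_comp.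
Qed.

Let hp x : h x `^ p = `|g x| `^ q. Proof. by rewrite /h -powRrM q1p. Qed.

Let hg x : `|g x| * h x = `|g x| `^ q.
Proof.
rewrite /h; have [->|g0] := eqVneq (g x) 0.
  by rewrite normr0 mul0r powR0// gt_eqF.
rewrite -[X in X * _]powRr1// -powRD ?(addrC 1) ?subrK//.
by rewrite normr_eq0 g0 implybT.
Qed.

Let A n x := h x <= n%:R * W x.

Let mA n : measurable_fun setT (A n).
Proof. by apply: measurable_fun_ler => //; exact: measurable_funM. Qed.

(** The extremal function [sgn g |g|^(q-1)] of Hoelder's inequality, truncated so
    that it is [W] times a bounded function. *)
Let s n x := if A n x then sgn x * (h x * V x) else 0.

Let bms n : bm (s n).
Proof.
split.
  apply: measurable_fun_ifT => //; apply: measurable_funM => //.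
  exact: measurable_funM.
exists n%:R => x; rewrite /s; case: ifP => [Ax|_]; last by rewrite normr0.
rewrite normrM normr_sgn mul1r ger0_norm ?mulr_ge0 ?powR_ge0//.
rewrite (_ : n%:R = n%:R * W x * V x); last by rewrite -mulrA [W x * _]mulrC VW mulr1.
by rewrite ler_wpM2r ?(ltW (V_gt0 x)).
Qed.

Let u n x := if A n x then `|g x| `^ q else 0.

Let u_ge0 n x : 0 <= u n x. Proof. by rewrite /u; case: ifP => // _; exact: powR_ge0. Qed.

Let Gs n x : G x * s n x = u n x.
Proof.
rewrite /s /u; case: ifP => _; rewrite ?mulr0// mulrA sgnG -hg.
by rewrite [h x * _]mulrC mulrA {1}/g normrM [`|V x|]ger0_norm ?powR_ge0.
Qed.

Let Wsp n x : (W x * `|s n x|) `^ p = u n x.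
Proof.
rewrite /s /u; case: ifP => _; last by rewrite normr0 mulr0 powR0// gt_eqF.
rewrite normrM normr_sgn mul1r ger0_norm ?mulr_ge0 ?powR_ge0//.
by rewrite mulrCA [W x * _]mulrC VW mulr1 hp.
Qed.

Let iu n : mu.-integrable setT (EFin \o u n).
Proof.
have := integrable_powM (bms n).
by congr (_ .-integrable setT _); apply/funext => x /=; rewrite Wsp.
Qed.

(** Testing [L] on the extremal function gives [I <= M I^(1/p)] for the truncated
    integral [I] of [|g|^q]. *)
Let I_le n : \int[mu]_x u n x <= M `^ q.
Proof.
set I := \int[mu]_x u n x.
have I0 : 0 <= I by apply: Rintegral_ge0.
have : I <= M * I `^ p^-1.
  have := L_le (bms n); under eq_Rintegral do rewrite Wsp.
  apply: le_trans; rewrite L_integral//.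
  by under eq_Rintegral do rewrite Gs; rewrite ler_norm.
have [->|In0] := eqVneq I 0; first by rewrite powR_ge0.
have Ip : 0 < I by rewrite lt_neqAle eq_sym In0.
have e : I = I `^ p^-1 * I `^ q^-1.
  by rewrite -powRD ?pq ?powRr1// In0 implybT.
rewrite {1}e mulrC ler_pM2r ?powR_gt0// => IM.
have -> : I = (I `^ q^-1) `^ q by rewrite -powRrM mulVf ?powRr1// gt_eqF.
by rewrite ge0_ler_powR ?nnegrE ?powR_ge0 ?(ltW q_gt0).
Qed.

Lemma Lnorm_finite_exponent : ('N[mu]_(q%:E)[EFin \o g] <= M%:E)%E.
Proof.
rewrite unlock.
have -> : (M%:E = (M `^ q)%:E `^ q^-1)%E.
  by rewrite poweR_EFin -powRrM mulfV ?powRr1// gt_eqF.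
apply: gt0_ler_poweR; rewrite ?invr_ge0 ?(ltW q_gt0) ?in_itv/= ?leey ?andbT ?lee_fin ?powR_ge0//.
  by apply: integral_ge0 => x _; rewrite lee_fin powR_ge0.
have mu_ n : measurable_fun setT (EFin \o u n) by exact: (measurable_int mu (iu n)).
have nd x : {homo (fun n => (u n x)%:E) : m n / (m <= n)%N >-> (m <= n)%E}.
  move=> i j ij; rewrite lee_fin /u; case: ifP => Ai; last exact: u_ge0.
  suff -> : A j x by [].
  by rewrite /A (le_trans Ai)// ler_wpM2r ?ler_nat// ltW.
have := @cvg_monotone_convergence _ _ _ mu _ measurableT _ mu_
  (fun n x _ => u_ge0 n x) (fun x _ => nd x).
have lim x : limn (fun k => (EFin \o u k) x) = (`|g x| `^ q)%:E.
  apply/cvg_lim => //; apply: cvg_near_cst.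
  exists (Num.trunc (h x * V x)).+1 => // n /= nx.
  rewrite /u; suff -> : A n x by [].
  rewrite /A [leLHS](_ : h x = h x * V x * W x); last by rewrite -mulrA VW mulr1.
  rewrite ler_wpM2r ?(ltW (W_gt0 x))//.
  by rewrite (le_trans (ltW (truncnS_gt _)))// ler_nat.
rewrite (eq_integral (fun x => (`|g x| `^ q)%:E)) => [cv|x _]; last exact: lim.
rewrite -(cvg_lim _ cv)//.
apply: lime_le; first by apply/cvg_ex; eexists; exact: cv.
apply: nearW => n; have := I_le n; rewrite -lee_fin; apply: le_trans.
by rewrite /Rintegral fineK//; exact: (integrable_fin_num measurableT (iu n)).
Qed.

End finite_exponent.

Section infinite_exponent.
Hypothesis p1 : p = 1.

Let B x := M * W x < `|G x|.

Let mB : measurable_fun setT B.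
Proof.
apply: measurable_fun_ltr; first exact: measurable_funM.
exact: measurableT_comp.
Qed.

(** Testing [L] on the sign of [g] over the set where [|g|] exceeds [M] shows that
    this set is negligible. *)
Let s x := if B x then sgn x else 0.

Let bms : bm s.
Proof.
split; first exact: measurable_fun_ifT.
by exists 1 => x; rewrite /s; case: ifP => _; rewrite ?normr_sgn ?normr0.
Qed.

Let f x := if B x then `|G x| - M * W x else 0.

Let f_ge0 x : 0 <= f x.
Proof. by rewrite /f; case: ifP => // Bx; rewrite subr_ge0 ltW. Qed.

Let fE x : f x = G x * s x - M * (W x * `|s x|) `^ p.
Proof.
rewrite p1 powRr1 ?mulr_ge0 ?(ltW (W_gt0 x))// /f /s; case: ifP => _.
  by rewrite sgnG normr_sgn mulr1.
by rewrite normr0 !mulr0 subrr.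
Qed.

Let f_ae0 : {ae mu, forall x, f x = 0}.
Proof.
have iM := integrableZl measurableT M (integrable_powM bms).
have ifn : mu.-integrable setT (EFin \o f).
  have := integrableB measurableT (integrable_GM bms) iM.
  by congr (_ .-integrable setT _); apply/funext => x /=; rewrite fE.
have : \int[mu]_x f x <= 0.
  under eq_Rintegral do rewrite fE.
  rewrite (RintegralB measurableT (integrable_GM bms) iM) RintegralZl//; last exact: integrable_powM.
  rewrite -L_integral// subr_le0; have := L_le bms; rewrite p1 invr1 powRr1.
    by apply: le_trans; rewrite ler_norm.
  by apply: Rintegral_ge0 => x _; rewrite powR_ge0.
move=> f0.
have : (\int[mu]_x `|(f x)%:E| = 0)%E.
  under eq_integral do rewrite gee0_abs ?lee_fin//.
  rewrite -[LHS]fineK; last exact: (integrable_fin_num measurableT ifn).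
  by congr EFin; apply/eqP; rewrite eq_le f0 Rintegral_ge0.
move/(ae_eq_integral_abs mu measurableT (measurable_int mu ifn)).
by apply: filterS => x /(_ I) [].
Qed.

Lemma Lnorm_infinite_exponent : ('N[mu]_(+oo%E)[EFin \o g] <= M%:E)%E.
Proof.
rewrite unlock; case: ifPn => // _; apply/ess_supP.
apply: filterS f_ae0 => x /=; rewrite lee_fin /f; case: ifPn => [Bx /eqP|].
  by rewrite subr_eq0 gt_eqF.
rewrite -leNgt -gW normrM [`|W x|]gtr0_norm// => + _.
by rewrite ler_pM2r.
Qed.

End infinite_exponent.

(** The representing function is the Radon-Nikodym derivative of [A |-> L 1_A],
    divided by the weight. Its norm is bounded by testing [L] on (truncations of)
    the functions for which Hoelder's inequality is an equality. *)
Theorem riesz_representation (q : \bar R) : (1 <= q)%E ->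
  (p%:E^-1 + q^-1 = 1)%E ->
  exists g : T -> R, [/\ measurable_fun setT g,
    ('N[mu]_q[EFin \o g] <= M%:E)%E &
    forall s, bm s -> mu.-integrable setT (EFin \o (fun x => g x * (W x * s x))) /\
      L s = \int[mu]_x (g x * (W x * s x))].
Proof.
move=> q1 pq; exists g; split => //; last first.
  move=> s bs; have e x : g x * (W x * s x) = G x * s x by rewrite mulrA gW.
  under eq_Rintegral do rewrite e.
  split; last exact: L_integral.
  have := integrable_GM bs.
  by congr (_ .-integrable setT _); apply/funext => x /=; rewrite e.
case: q q1 pq => [q q1 pq||//].
- apply: Lnorm_finite_exponent => //.
  have q0 : 0 < q by rewrite (lt_le_trans ltr01)// -lee_fin.
  by move: pq; rewrite !inver !gt_eqF// => -[].
- move=> _; rewrite invey adde0 inver gt_eqF// => -[pV].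
  by apply: Lnorm_infinite_exponent; rewrite -[p]invrK pV invr1.
Qed.

End riesz.

(** * Complex normed spaces *)

Lemma normc_real (R : realType) (t : R) : normc t%:C%C = `|t|.
Proof. by rewrite /= expr0n addr0 sqrtr_sqr. Qed.

Lemma normr_Re_le (R : rcfType) (z : R[i]) : `|complex.Re z| <= normc z.
Proof. by have := normc_ge_Re z; rewrite lecR. Qed.

Lemma normr_Im_le (R : rcfType) (z : R[i]) : `|complex.Im z| <= normc z.
Proof.
case: z => a b /=; rewrite -sqrtr_sqr ler_sqrt ?addr_ge0 ?sqr_ge0//.
by rewrite lerDr sqr_ge0.
Qed.

Lemma normc_le_ReIm (R : rcfType) (z : R[i]) : normc z <= `|complex.Re z| + `|complex.Im z|.
Proof.
case: z => a b /=.
rewrite -[leRHS]ger0_norm ?addr_ge0// -[leRHS]sqrtr_sqr ler_sqrt ?sqr_ge0//.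
rewrite sqrrD !real_normK ?num_real// -addrA lerD2l lerDr.
by rewrite mulrn_wge0// mulr_ge0.
Qed.

Section rnorm.
Context (R : realType) (E : normedModType R[i]).
Implicit Types x y : E.

Lemma normr_rnorm x : `|x| = (rnorm x)%:C%C.
Proof. by rewrite /rnorm RRe_real// normr_real. Qed.

Lemma rnorm_ge0 x : 0 <= rnorm x.
Proof. by rewrite -lecR -normr_rnorm normr_ge0. Qed.

Lemma rnormD x y : rnorm (x + y) <= rnorm x + rnorm y.
Proof.
have := ler_normD x y; rewrite !normr_rnorm -(rmorphD (real_complex R)).
by rewrite lecR.
Qed.

Lemma rnormN x : rnorm (- x) = rnorm x.
Proof. by rewrite /rnorm normrN. Qed.

Lemma rnormZ a x : rnorm (a *: x) = normc a * rnorm x.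
Proof.
rewrite {1}/rnorm normrZ normr_rnorm (_ : `|a| = (normc a)%:C%C)//.
by rewrite -rmorphM.
Qed.

Lemma rnorm0 : rnorm (0 : E) = 0.
Proof. by rewrite /rnorm normr0. Qed.

Lemma rnorm0_eq0 x : rnorm x = 0 -> x = 0.
Proof. by move=> x0; apply/eqP; rewrite -normr_eq0 normr_rnorm x0. Qed.

Lemma cvg_rnormP (I : Type) (F : set_system I) (FF : Filter F) (u : I -> E) (l : E) :
  u @ F --> l <-> forall eps : R, 0 < eps -> \forall i \near F, rnorm (l - u i) <= eps.
Proof.
split=> [/cvgrPdist_le ul eps e0|ul].
  have e0' : 0 < eps%:C%C by rewrite ltcR.
  by apply: filterS (ul _ e0') => i; rewrite normr_rnorm lecR.
apply/cvgrPdist_le => eps e0.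
have er : eps = (complex.Re eps)%:C%C by rewrite RRe_real// gtr0_real.
rewrite er ltcR in e0.
by apply: filterS (ul _ e0) => i; rewrite normr_rnorm er lecR.
Qed.

End rnorm.

Lemma rnormC (R : realType) (z : R[i]^o) : rnorm z = normc z.
Proof. by []. Qed.

Section dual_norm.
Context (R : realType) (E : normedModType R[i]) (e : {linear E -> R[i]^o}).

Hypothesis ce : continuous e.

Let bound : exists C : R, forall x, rnorm x <= 1 -> normc (e x) <= C.
Proof.
have /cvgrPdist_le := @ce 0; move=> /(_ 1 ltr01) /nbhs_normP[del /= del0 H].
have dr : del = (complex.Re del)%:C%C by rewrite RRe_real// gtr0_real.
rewrite dr ltcR in del0; set del' := complex.Re del in dr del0.
exists (2 / del') => x x1.
pose c : R := del' / 2.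
have c0 : 0 < c by rewrite divr_gt0.
have : `|e 0 - e (c%:C%C *: x)| <= 1.
  apply: H; rewrite /= dr normr_rnorm ltcR sub0r rnormN rnormZ.
  rewrite normc_real gtr0_norm//.
  rewrite (@le_lt_trans _ _ c)// ?ler_piMr ?(ltW c0)//.
  by rewrite /c ltr_pdivrMr// ltr_pMr// ltr1n.
rewrite linear0 sub0r normrN linearZ normr_rnorm rnormZ rnormC.
rewrite normc_real gtr0_norm// -[1](rmorph1 (real_complex R)) lecR.
rewrite -ler_pdivlMl// mulr1 /c invf_div.
by case: (e x).
Qed.

Let S := [set normc (e x) | x in [set x : E | rnorm x <= 1]].

Let hS : has_sup S.
Proof.
split; first by exists (normc (e 0)); exists 0 => //=; rewrite rnorm0.
by have [C HC] := bound; exists C => _ [x /= x1 <-]; exact: HC.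
Qed.

Lemma dual_norm_ge0 : 0 <= dual_norm e.
Proof.
apply: le_trans (normc_ge0 (e 0)) _; apply: sup_upper_bound => //.
by exists 0 => //=; rewrite rnorm0.
Qed.

(** [dual_norm] is a supremum in [R], which bounds the values of [e] on the unit
    ball only because continuity makes them bounded. *)
Lemma le_dual_norm x : normc (e x) <= dual_norm e * rnorm x.
Proof.
have [/rnorm0_eq0 ->|x0] := eqVneq (rnorm x) 0.
  by rewrite linear0 rnorm0 mulr0 Normc.normc0.
have xp : 0 < rnorm x by rewrite lt_neqAle eq_sym x0 rnorm_ge0.
pose c : R := (rnorm x)^-1.
have cE : normc c%:C%C = c.
  by rewrite normc_real gtr0_norm// invr_gt0.
have : normc (e (c%:C%C *: x)) <= dual_norm e.
  apply: sup_upper_bound => //; exists (c%:C%C *: x) => //=.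
  by rewrite rnormZ cE mulVf.
rewrite linearZ -rnormC rnormZ cE rnormC /c mulrC.
by rewrite ler_pdivrMr.
Qed.

End dual_norm.

Lemma dual_norm_le (R : realType) (E : normedModType R[i])
    (e : {linear E -> R[i]^o}) (M : R) : 0 <= M ->
  (forall x, normc (e x) <= M * rnorm x) -> dual_norm e <= M.
Proof.
move=> M0 eM; apply: ge_sup.
  by exists (normc (e 0)); exists 0 => //=; rewrite rnorm0.
by move=> _ [x /= x1 <-]; rewrite (le_trans (eM x))// ler_piMr.
Qed.

Lemma continuous_bounded_linear (R : realType) (E F : normedModType R[i])
    (e : {linear E -> F}) (M : R) :
  (forall x, rnorm (e x) <= M * rnorm x) -> continuous e.
Proof.
move=> eM x; apply/cvg_rnormP => eps e0.
have M1 : 0 < `|M| + 1 by rewrite ltr_wpDl.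
have : (id : E -> E) @ nbhs x --> x by exact: cvg_id.
move/cvg_rnormP => /(_ (eps / (`|M| + 1)) (divr_gt0 e0 M1)).
apply: filterS => y xy; rewrite -linearB (le_trans (eM _))//.
rewrite (@le_trans _ _ ((`|M| + 1) * rnorm (x - y)))//.
  by rewrite ler_wpM2r ?rnorm_ge0// (le_trans (ler_norm M))// lerDl.
by rewrite mulrC -ler_pdivlMr.
Qed.

(** * The spaces L^p *)

Section cLspace.
Context d (T : measurableType d) (R : realType).
Variables (mu : {measure set T -> \bar R}) (p : \bar R) (hp : (1 <= p)%E).
Local Notation E := (cLspace mu hp).
Implicit Types (F G : E) (f g : T -> R[i]).

Local Open Scope quotient_scope.

Lemma cmeasurable_cLspace F : cmeasurable F.
Proof. exact: cLfun_meas. Qed.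

Lemma cLnorm_rnorm F : cLnorm mu p F = (rnorm F)%:E.
Proof. by rewrite /rnorm [RHS]fineK//; exact: cLfun_fin. Qed.

Lemma rnorm_ae F f : cmeasurable f -> F = f %[ae mu] ->
  cLnorm mu p f = (rnorm F)%:E.
Proof.
move=> mf Ff; rewrite -cLnorm_rnorm; apply: cLnorm_ae => //.
  exact: cmeasurable_cLspace.
by apply: filterS Ff => x /[apply].
Qed.

Lemma cLspace_ae_eq F G : (F : T -> R[i]) = G %[ae mu] -> F = G.
Proof. by move=> FG; rewrite -[F]reprK -[G]reprK; apply/cLspace_piP. Qed.

Lemma cmeasurable_sum (I : Type) (r : seq I) (a : I -> R[i]) (h : I -> T -> R[i]) :
  (forall i, cmeasurable (h i)) -> cmeasurable (fun x => \sum_(i <- r) a i * h i x).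
Proof.
move=> mh; elim: r => [|i r IH].
  by under eq_fun do rewrite big_nil; exact: cmeasurable0.
rewrite (_ : (fun x => _) = a i *: h i + (fun x => \sum_(j <- r) a j * h j x)).
  exact: cmeasurableZD.
by apply/funext => x; rewrite big_cons.
Qed.

Lemma cLspace_exists f : cmeasurable f -> (cLnorm mu p f < +oo)%E ->
  exists F : E, F = f %[ae mu].
Proof.
move=> mf ff; have pf : f \in cLfun_pred mu p by rewrite inE; split.
by exists (\pi_E (CLfun pf)); exact: cLspace_repr_ae.
Qed.

Lemma cLspace_ZD_ae a F G :
  cLspace_fun (a *: F + G) = (fun x => a * F x + G x) %[ae mu].
Proof.
have := @cLspace_piD _ _ _ mu p hp (a *: repr F) (repr G).
rewrite reprK -[_ + G]/(a *: F + G) => <-.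
exact: cLspace_repr_ae.
Qed.

Lemma cLspace_D_ae F G : cLspace_fun (F + G) = (fun x => F x + G x) %[ae mu].
Proof.
have := cLspace_ZD_ae 1 F G; rewrite scale1r.
by apply: filterS => x /[apply] ->; rewrite mul1r.
Qed.

Lemma cLspace0_ae : cLspace_fun (0 : E) = (fun=> 0) %[ae mu].
Proof.
have -> : (0 : E) = \pi_E 0 by rewrite raddf0.
exact: cLspace_repr_ae.
Qed.

Lemma cLspace_Z_ae a F : cLspace_fun (a *: F) = (fun x => a * F x) %[ae mu].
Proof.
have := cLspace_ZD_ae a F 0; rewrite addr0 => h.
by apply: filterS2 h cLspace0_ae => x e1 e2 xI; rewrite e1// e2// addr0.
Qed.

Lemma cLspace_B_ae F G : cLspace_fun (F - G) = (fun x => F x - G x) %[ae mu].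
Proof.
have := cLspace_ZD_ae (-1) G F; rewrite scaleN1r addrC.
by apply: filterS => x /[apply] ->; rewrite mulN1r addrC.
Qed.

Lemma cLspace_sum_ae (I : eqType) (r : seq I) (u : I -> E) :
  cLspace_fun (\sum_(i <- r) u i) = (fun x => \sum_(i <- r) u i x) %[ae mu].
Proof.
elim: r => [|i r IH].
  by rewrite big_nil; apply: filterS cLspace0_ae => x /[apply] ->; rewrite big_nil.
rewrite big_cons.
by apply: filterS2 (cLspace_D_ae (u i) (\sum_(i <- r) u i)) IH => x
  e1 e2 xI; rewrite e1// e2// big_cons.
Qed.

End cLspace.

(** * Absolutely convergent series in L^p *)

Section absolutely_convergent.
Context d (T : measurableType d) (R : realType).
Variables (mu : {measure set T -> \bar R}) (p : R) (hp : (1 <= p%:E)%E).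
Local Notation E := (cLspace mu hp).

Let p_gt0 : 0 < p.
Proof. by rewrite (lt_le_trans ltr01)// -lee_fin. Qed.

Let poweRK (x : \bar R) : (0 <= x)%E -> ((x `^ p) `^ p^-1 = x)%E.
Proof. by move=> x0; rewrite -poweRrM mulfV ?poweRe1// gt_eqF. Qed.

Let poweRVK (x : \bar R) : (0 <= x)%E -> ((x `^ p^-1) `^ p = x)%E.
Proof. by move=> x0; rewrite -poweRrM mulVf ?poweRe1// gt_eqF. Qed.

Let le_poweR (r : R) (x y : \bar R) : 0 <= r -> (0 <= x)%E -> (x <= y)%E ->
  (x `^ r <= y `^ r)%E.
Proof.
move=> r0 x0 xy; apply: gt0_ler_poweR; rewrite ?in_itv/= ?leey ?andbT//.
exact: le_trans xy.
Qed.

Lemma le_Lnorm_ereal (f g : T -> \bar R) : measurable_fun setT f ->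
  measurable_fun setT g -> (forall x, 0 <= f x <= g x)%E ->
  ('N[mu]_(p%:E)[f] <= 'N[mu]_(p%:E)[g])%E.
Proof.
move=> mf mg fg; rewrite unlock; apply: le_poweR; rewrite ?invr_ge0 ?(ltW p_gt0)//.
  by apply: integral_ge0 => x _; exact: poweR_ge0.
have mp (h : T -> \bar R) : measurable_fun setT h ->
    measurable_fun setT (fun x => `|h x| `^ p)%E.
  by move=> mh; apply: (measurableT_comp (measurable_poweR _)); exact: measurableT_comp.
apply: ge0_le_integral => //; first by move=> *; exact: poweR_ge0.
- exact: mp.
- exact: mp.
move=> x _; have /andP[f0 fgx] := fg x.
by rewrite !gee0_abs ?(le_trans f0)// le_poweR// ltW.
Qed.

Variable w : nat -> T -> R.
Hypothesis w_ge0 : forall k x, 0 <= w k x.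
Hypothesis mw : forall k, measurable_fun setT (w k).

Lemma measurable_nneseries :
  measurable_fun setT (fun x => \sum_(i <oo) (w i x)%:E)%E.
Proof.
have := @ge0_emeasurable_sum _ _ _ setT (fun i x => (w i x)%:E) xpredT.
apply; first by move=> k x _ _; rewrite lee_fin.
by move=> k _; exact/measurable_EFinP.
Qed.

Lemma Lnorm_sum_le (n : nat) :
  ('N[mu]_(p%:E)[EFin \o (fun x => \sum_(0 <= i < n) w i x)%R] <=
   \sum_(0 <= i < n) 'N[mu]_(p%:E)[EFin \o w i])%E.
Proof.
elim: n => [|n IH].
  rewrite big_geq// (_ : _ \o _ = cst 0%E) ?Lnorm0 ?gt_eqF ?lte_fin//.
  by apply/funext => x /=; rewrite big_geq.
rewrite big_nat_recr//=.
have ms : measurable_fun setT (fun x => \sum_(0 <= i < n) w i x) by exact: measurable_sum.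
rewrite (_ : _ \o _ = EFin \o ((fun x => \sum_(0 <= i < n) w i x) \+ w n)); last first.
  by apply/funext => x /=; rewrite big_nat_recr.
by rewrite (le_trans (eminkowski mu ms (mw n) hp))// leeD2r.
Qed.

(** Minkowski's inequality for series. Monotone convergence applies to the powers
    of the partial sums, and their limit [L] dominates the power of the sum,
    because each partial sum is at most [L^(1/p)]. *)
Lemma Lnorm_nneseries_le :
  ('N[mu]_(p%:E)[(fun x => \sum_(i <oo) (w i x)%:E)] <=
   \sum_(i <oo) 'N[mu]_(p%:E)[EFin \o w i])%E.
Proof.
set B := (\sum_(i <oo) 'N[mu]_(p%:E)[EFin \o w i])%E.
have B0 : (0 <= B)%E by apply: nneseries_ge0 => i _ _; exact: Lnorm_ge0.
pose S n x := (\sum_(0 <= i < n) (w i x))%R.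
have S0 n x : 0 <= S n x by apply: sumr_ge0.
pose Sp n x := ((S n x)%:E `^ p)%E.
pose L x := limn (fun n => Sp n x).
have nd x : {homo (fun n => Sp n x) : m n / (m <= n)%N >-> (m <= n)%E}.
  move=> i j ij; apply: le_poweR; rewrite ?(ltW p_gt0) ?lee_fin//.
  by rewrite /S (big_cat_nat (leq0n i) ij)//= lerDl sumr_ge0.
have cL x : (Sp n x @[n --> \oo] --> L x)%E.
  exact: (ereal_nondecreasing_is_cvgn (nd x)).
have SpL n x : (Sp n x <= L x)%E.
  apply: lime_ge; first by apply/cvg_ex; exists (L x); exact: cL.
  by exists n => // k /= nk; exact: nd.
have mS n : measurable_fun setT (Sp n).
  apply: (measurableT_comp (measurable_poweR _)); apply/measurable_EFinP.
  exact: measurable_sum.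
have SL x : ((\sum_(i <oo) (w i x)%:E) `^ p <= L x)%E.
  have L0 : (0 <= L x)%E by rewrite (le_trans _ (SpL 0%N x))// poweR_ge0.
  rewrite -[leRHS]poweRVK//; apply: le_poweR; first exact: ltW.
    by apply: nneseries_ge0 => i _ _; rewrite lee_fin.
  apply: lime_le; first by apply: is_cvg_nneseries => i _ _; rewrite lee_fin.
  apply: nearW => n; rewrite sumEFin -[leLHS]poweRK ?lee_fin ?S0//.
  by apply: le_poweR; rewrite ?invr_ge0 ?(ltW p_gt0) ?poweR_ge0//; exact: SpL.
rewrite -[leRHS]poweRK// unlock; apply: le_poweR; rewrite ?invr_ge0 ?(ltW p_gt0)//.
  by apply: integral_ge0 => x _; exact: poweR_ge0.
apply: (@le_trans _ _ (\int[mu]_x L x)%E).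
  apply: ge0_le_integral => //.
  - by move=> *; exact: poweR_ge0.
  - apply: (measurableT_comp (measurable_poweR _)).
    by apply: measurableT_comp => //; exact: measurable_nneseries.
  - by apply: (emeasurable_fun_cvg Sp) => // x _; exact: cL.
  - move=> x _; rewrite gee0_abs; first exact: SL.
    by apply: nneseries_ge0 => i _ _; rewrite lee_fin.
have := @cvg_monotone_convergence _ _ _ mu _ measurableT _ mS
  (fun n x _ => poweR_ge0 _ _) (fun x _ => nd x).
move=> cv; rewrite -(cvg_lim _ cv)//.
apply: lime_le; first by apply/cvg_ex; eexists; exact: cv.
apply: nearW => n.
have -> : (\int[mu]_x Sp n x = 'N[mu]_(p%:E)[EFin \o S n] `^ p)%E.
  rewrite unlock poweRVK; last by apply: integral_ge0 => x _; exact: poweR_ge0.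
  by apply: eq_integral => x _; rewrite /Sp/= ger0_norm.
apply: le_poweR; rewrite ?(ltW p_gt0) ?Lnorm_ge0//.
rewrite (le_trans (Lnorm_sum_le n))//.
by apply: nneseries_lim_ge => i _ _; exact: Lnorm_ge0.
Qed.

End absolutely_convergent.

Section riesz_fischer.
Context d (T : measurableType d) (R : realType).
Variables (mu : {measure set T -> \bar R}) (p : R) (hp : (1 <= p%:E)%E).
Local Notation E := (cLspace mu hp).
Variable u : nat -> E.
Hypothesis su : (\sum_(k <oo) (rnorm (u k))%:E < +oo)%E.

Let p_gt0 : 0 < p.
Proof. by rewrite (lt_le_trans ltr01)// -lee_fin. Qed.

Let w k x := normc (u k x).
Let w_ge0 k x : 0 <= w k x. Proof. exact: normc_ge0. Qed.
Let mw k : measurable_fun setT (w k).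
Proof. exact/cmeasurable_normc/cmeasurable_cLspace. Qed.

Let tail n x := (\sum_(n <= i <oo) (w i x)%:E)%E.

Let S n x : R[i] := \sum_(0 <= i < n) u i x.

Let tail_ge0 n x : (0 <= tail n x)%E.
Proof. by apply: nneseries_ge0 => i _ _; rewrite lee_fin. Qed.

Let tail_split n x : (tail 0 x = (\sum_(0 <= i < n) w i x)%:E + tail n x)%E.
Proof.
have := @nneseries_split R (fun i => (w i x)%:E) 0 n.
by rewrite add0n sumEFin /tail => -> // k _; rewrite lee_fin.
Qed.

Let tail_fin n x : (tail 0 x < +oo)%E -> tail n x \is a fin_num.
Proof.
by rewrite (tail_split n) ge0_fin_numE//; apply: le_lt_trans; rewrite leeDr// lee_fin sumr_ge0.
Qed.

Let tail_ae : {ae mu, forall x, (tail 0 x < +oo)%E}.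
Proof.
have mt : measurable_fun setT (tail 0) by exact: measurable_nneseries.
have mtp : measurable_fun setT (fun x => `|tail 0 x| `^ p)%E.
  by apply: (measurableT_comp (measurable_poweR _)); exact: measurableT_comp.
have : ('N[mu]_(p%:E)[tail 0] < +oo)%E.
  apply: le_lt_trans (Lnorm_nneseries_le mu hp w_ge0 mw) _.
  rewrite (eq_eseriesr (g := fun k => (rnorm (u k))%:E))// => k _.
  exact: cLnorm_rnorm.
have I0 : (0 <= \int[mu]_x `|tail 0 x| `^ p)%E.
  by apply: integral_ge0 => x _; exact: poweR_ge0.
rewrite unlock => Ifin.
have : mu.-integrable setT (fun x => `|tail 0 x| `^ p)%E.
  apply/integrableP; split=> //.
  under eq_integral do rewrite gee0_abs ?poweR_ge0//.
  rewrite ltey; apply: contraTneq Ifin => ->.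
  by rewrite poweRyr ?ltxx// invr_eq0 gt_eqF.
move=> /(integrable_ae measurableT); apply: filterS => x /(_ I).
rewrite ltey; apply: contraTneq => ->.
by rewrite poweRyr// gt_eqF.
Qed.

Let normc_sum (I : Type) (r : seq I) (z : I -> R[i]) :
  normc (\sum_(i <- r) z i) <= \sum_(i <- r) normc (z i).
Proof.
elim: r => [|i r IH]; first by rewrite !big_nil Normc.normc0.
by rewrite !big_cons (le_trans (normcD _ _))// lerD2l.
Qed.

Let cauchy_S x n m : (n <= m)%N -> (tail 0 x < +oo)%E ->
  normc (S m x - S n x) <= fine (tail n x).
Proof.
move=> nm fx; rewrite /S (big_cat_nat (leq0n n) nm)//= addrAC subrr add0r.
rewrite (le_trans (normc_sum _ _))// -lee_fin fineK ?tail_fin//.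
have := @nneseries_split R (fun i => (w i x)%:E) n (m - n).
rewrite subnKC// sumEFin /tail => -> => [|k _]; last by rewrite lee_fin.
by rewrite leeDl//; exact: tail_ge0.
Qed.

Let lim_part (P : R[i] -> R) x : R :=
  if (tail 0 x < +oo)%E then limn (fun n => P (S n x)) else 0.

Let v x : R[i] := Complex (lim_part (@complex.Re R) x) (lim_part (@complex.Im R) x).

Let tail0 x : (tail 0 x < +oo)%E -> forall eps : R, 0 < eps ->
  \forall n \near \oo, fine (tail n x) <= eps.
Proof.
move=> fx eps e0.
have := @nneseries_tail_cvg R (fun i => (w i x)%:E) xpredT fx.
move=> /(_ (fun k _ => w_ge0 k x)) /fine_cvgP[_] /cvgrPdist_le/(_ _ e0).
by apply: filterS => n /=; rewrite sub0r normrN; apply: le_trans; exact: ler_norm.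
Qed.

Let cvg_part x (P : R[i] -> R) : (forall z, `|P z| <= normc z) ->
  (forall z z', P (z - z') = P z - P z') -> (tail 0 x < +oo)%E ->
  cvgn (fun n => P (S n x)).
Proof.
move=> Ple PB fx; apply/cauchy_cvgP/cauchy_exP => eps e0.
have e20 : 0 < eps / 2 by rewrite divr_gt0.
have [N _ HN] := tail0 fx e20.
exists (P (S N x)); exists N => // m /= Nm; rewrite /ball /= distrC -PB.
rewrite (le_lt_trans (Ple _))// (le_lt_trans (cauchy_S Nm fx))//.
rewrite (le_lt_trans (HN N _))//=.
by rewrite ltr_pdivrMr// ltr_pMr// ltr1n.
Qed.

Let v_tail n x : (tail 0 x < +oo)%E -> normc (v x - S n x) <= fine (tail n x).
Proof.
move=> fx; rewrite /v /lim_part fx.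
have cRe := cvg_part (@normr_Re_le R) (fun _ _ => raddfB _ _ _) fx.
have cIm := cvg_part (@normr_Im_le R) (fun _ _ => raddfB _ _ _) fx.
apply/ler_addgt0Pl => eps e0; have e20 : 0 < eps / 2 by rewrite divr_gt0.
set l := Complex _ _.
have /cvgrPdist_le/(_ _ e20)[N1 _ H1] := cRe.
have /cvgrPdist_le/(_ _ e20)[N2 _ H2] := cIm.
pose m := (n + (N1 + N2))%N.
have -> : l - S n x = (l - S m x) + (S m x - S n x) by rewrite addrA subrK.
rewrite (le_trans (normcD _ _))// lerD//; last by rewrite cauchy_S// leq_addr.
rewrite (le_trans (normc_le_ReIm _))// [leRHS]splitr lerD//.
  rewrite raddfB; apply: H1; rewrite /= /m; lia.
rewrite raddfB; apply: H2; rewrite /= /m; lia.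
Qed.

Let cmeasurable_S n : cmeasurable (S n).
Proof.
have := cmeasurable_sum (index_iota 0 n) (fun=> 1) (fun k => cmeasurable_cLspace (u k)).
by under eq_fun do under eq_bigr do rewrite mul1r.
Qed.

Let cmeasurable_v : cmeasurable v.
Proof.
have mb : measurable_fun setT (fun x => (tail 0 x < +oo)%E).
  by apply: measurable_fun_lte => //; exact: measurable_nneseries.
have part (P : R[i] -> R) : (forall z, `|P z| <= normc z) ->
    (forall z z', P (z - z') = P z - P z') ->
    (forall n, measurable_fun setT (fun x => P (S n x))) ->
    measurable_fun setT (lim_part P).
  move=> Ple PB mP.
  apply: (measurable_fun_cvg (h := fun n x => if (tail 0 x < +oo)%E then P (S n x) else 0)) => //.
    by move=> n; exact: measurable_fun_ifT.
  move=> x _; rewrite /lim_part; case: ifP => fx; last exact: cvg_cst.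
  exact: cvg_part.
split; apply: part => [|*|n]; rewrite ?raddfB//; try by have [] := cmeasurable_S n.
- exact: normr_Re_le.
- exact: normr_Im_le.
Qed.

Let tailE n : tail n = (fun x => \sum_(0 <= k <oo) (w (k + n)%N x)%:E)%E.
Proof.
by apply/funext => x; rewrite (@nneseries_addn _ (fun k => (w k x)%:E))// => k; rewrite lee_fin.
Qed.

Let Lnorm_tail n : ('N[mu]_(p%:E)[tail n] <= \sum_(n <= k <oo) (rnorm (u k))%:E)%E.
Proof.
rewrite tailE -(@nneseries_addn _ (fun k => (rnorm (u k))%:E)); last by move=> k; rewrite lee_fin rnorm_ge0.
apply: le_trans (Lnorm_nneseries_le mu hp (fun k => w_ge0 (k + n)%N) (fun k => mw (k + n)%N)) _.
rewrite (eq_eseriesr (g := fun k => (rnorm (u (k + n)%N))%:E))// => k _.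
exact: cLnorm_rnorm.
Qed.

Let Lnorm_v_S n : (cLnorm mu p%:E (v - S n)%R <= \sum_(n <= k <oo) (rnorm (u k))%:E)%E.
Proof.
apply: le_trans (Lnorm_tail n); apply: le_Lnorm_ereal => //.
- apply/measurable_EFinP/cmeasurable_normc; rewrite addrC -scaleN1r.
  exact: cmeasurableZD.
- by rewrite tailE; exact: (measurable_nneseries (fun k => w_ge0 (k + n)%N) (fun k => mw (k + n)%N)).
move=> x; rewrite lee_fin normc_ge0/=.
have [fx|] := ltP (tail 0 x) +oo%E.
  by rewrite -[leRHS]fineK ?tail_fin// lee_fin v_tail.
rewrite leye_eq (tail_split n) => /eqP; case: (tail n x) => [s||]//.
by rewrite leey.
Qed.

(** By Minkowski's inequality the series of the moduli is finite almost
    everywhere. Its tails, which tend to 0 both pointwise and in norm, dominate the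
    distance of the partial sums to the limit; hence both modes of convergence
    hold, with a common limit. *)
Theorem absolutely_convergent_series : exists l : E,
  series u @ \oo --> l /\
  {ae mu, forall x, series (fun k => u k x : R[i]^o) @ \oo --> (l x : R[i]^o)}.
Proof.
have v_fin : (cLnorm mu p%:E v < +oo)%E.
  have -> : v = (v - S 0%N)%R :> (T -> R[i]).
    by apply/funext => x; rewrite -[RHS]/(v x - S 0%N x) /S big_geq// subr0.
  exact: le_lt_trans (Lnorm_v_S 0) su.
have [l lv] := cLspace_exists hp cmeasurable_v v_fin.
exists l; split.
  apply/cvg_rnormP => eps e0.
  have := nneseries_tail_cvg su (fun k _ => rnorm_ge0 (u k)).
  move=> /fine_cvgP[fin] /cvgrPdist_le/(_ _ e0).
  apply: filterS2 fin => n fn /=; rewrite sub0r normrN => tn.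
  rewrite -lee_fin -(@rnorm_ae _ _ _ mu _ hp _ (v - S n)%R).
  - apply: (le_trans (Lnorm_v_S n)); rewrite -[leLHS]fineK// lee_fin.
    exact: le_trans (ler_norm _) tn.
  - by rewrite addrC -scaleN1r; exact: cmeasurableZD.
  have h1 := cLspace_B_ae l (series u n).
  have h2 := cLspace_sum_ae (index_iota 0 n) u.
  apply: filterS3 h1 h2 lv => x e1 e2 e3 xI.
  by rewrite e1// e2// e3.
apply: filterS2 tail_ae lv => x fx lx; rewrite lx//.
apply/cvg_rnormP => eps e0; apply: filterS (tail0 fx e0) => n.
by apply: le_trans; exact: v_tail.
Qed.
End riesz_fischer.

(** * Duality between L^p and L^q *)

Section hoelder_pairing.
Context d (T : measurableType d) (R : realType).
Variables (mu : {measure set T -> \bar R}) (p : R) (q : \bar R).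
Hypotheses (hp : (1 <= p%:E)%E) (hq : (1 <= q)%E) (hpq : (p%:E^-1 + q^-1 = 1)%E).

Let p_gt0 : 0 < p.
Proof. by rewrite (lt_le_trans ltr01)// -lee_fin. Qed.

(** For [q = +oo] the bound is pointwise: [|g|] is almost everywhere at most its
    essential supremum. *)
Lemma hoelder_ereal (f g : T -> R) : measurable_fun setT f -> measurable_fun setT g ->
  ('N[mu]_q[EFin \o g] < +oo)%E ->
  (\int[mu]_x `|(g x * f x)%:E| <= 'N[mu]_q[EFin \o g] * 'N[mu]_(p%:E)[EFin \o f])%E.
Proof.
move=> mf mg; case: q hq hpq => [s s1 pq _|_|//].
  have s0 : 0 < s by rewrite (lt_le_trans ltr01)// -lee_fin.
  have {}pq : p^-1 + s^-1 = 1 by move: pq; rewrite !inver !gt_eqF// => -[].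
  rewrite muleC (le_trans _ (hoelder mu mf mg p_gt0 s0 pq))//.
  by rewrite Lnorm1; under eq_integral do rewrite mulrC.
rewrite invey adde0 inver gt_eqF// => -[pV].
have p1 : p = 1 by rewrite -[p]invrK pV invr1.
rewrite p1 Lnorm1 unlock; case: ifPn => [mu0|].
  set K := ess_sup _ _ => Kfin.
  have Kae := ess_sup_ge mu (abse \o (EFin \o g)); rewrite -/K in Kae.
  have K0 : (0 <= K)%E by apply: ess_sup_gee => //; apply: nearW => x /=; rewrite lee_fin.
  have fK : K \is a fin_num by rewrite ge0_fin_numE.
  have mgf : measurable_fun setT (fun x => `|(g x * f x)%:E|)%E.
    by apply: measurableT_comp => //; apply/measurable_EFinP; exact: measurable_funM.
  have mf' : measurable_fun setT (fun x => `|(EFin \o f) x|)%E.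
    by apply: measurableT_comp => //; exact/measurable_EFinP.
  rewrite -[K]fineK// -ge0_integralZl_EFin ?fine_ge0//.
  apply: ae_ge0_le_integral => //.
  - by move=> x _; rewrite mule_ge0// lee_fin fine_ge0.
  - by apply: measurable_funeM.
  apply: filterS Kae => x; rewrite -[K in X in X -> _]fineK//= => gK _.
  by rewrite normrM lee_fin ler_wpM2r.
rewrite -leNgt measure_le0 => /eqP mu0 _; rewrite mul0e.
rewrite null_set_integral//.
by apply/measurable_EFinP => /=; apply: measurableT_comp => //; exact: measurable_funM.
Qed.

(** [P] is meant to be the real or the imaginary part. *)
Lemma cpairing_le (g : cLspace mu hq) (f : cLspace mu hp) (P : R[i] -> R) :
  (forall z, `|P z| <= normc z) -> measurable_fun setT (fun x => P (g x * f x)) ->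
  mu.-integrable setT (EFin \o (fun x => P (g x * f x))) /\
  `|\int[mu]_x P (g x * f x)| <= rnorm g * rnorm f.
Proof.
move=> Ple mP.
have mg := cmeasurable_normc (cmeasurable_cLspace g).
have mf := cmeasurable_normc (cmeasurable_cLspace f).
have Pgf : (\int[mu]_x `|(P (g x * f x))%:E| <= (rnorm g * rnorm f)%:E)%E.
  rewrite EFinM -!cLnorm_rnorm.
  have gfin : ('N[mu]_q[EFin \o (fun x => normc (g x))] < +oo)%E.
    by rewrite -[X in (X < _)%E]/(cLnorm mu q g) cLnorm_rnorm ltry.
  apply: le_trans (hoelder_ereal mf mg gfin); apply: ge0_le_integral => //.
  - by apply: measurableT_comp => //; exact/measurable_EFinP.
  - by apply: measurableT_comp => //; apply/measurable_EFinP; exact: measurable_funM.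
  - by move=> x _; rewrite lee_fin -Normc.normcM (le_trans (Ple _))// ler_norm.
have iP : mu.-integrable setT (EFin \o (fun x => P (g x * f x))).
  apply/integrableP; split; first exact/measurable_EFinP.
  by apply: le_lt_trans Pgf _; rewrite ltry.
split=> //; rewrite (le_trans (le_normr_Rintegral measurableT iP))//.
rewrite -lee_fin /Rintegral fineK//.
exact: (integrable_fin_num measurableT (integrable_norm iP)).
Qed.

Lemma cmeasurableM (f g : T -> R[i]) : cmeasurable f -> cmeasurable g ->
  cmeasurable (fun x => f x * g x).
Proof.
move=> [fr fi] [gr gi]; split.
  rewrite (_ : (fun x => _) = (fun x => complex.Re (f x) * complex.Re (g x) -
    complex.Im (f x) * complex.Im (g x))).
    by apply: measurable_funB; exact: measurable_funM.
  by apply/funext => x; case: (f x) (g x) => ? ? [? ?].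
rewrite (_ : (fun x => _) = (fun x => complex.Re (f x) * complex.Im (g x) +
  complex.Im (f x) * complex.Re (g x))).
  by apply: measurable_funD; exact: measurable_funM.
by apply/funext => x; case: (f x) (g x) => ? ? [? ?].
Qed.

Definition cintegrable (f : T -> R[i]) :=
  mu.-integrable setT (EFin \o (fun x => complex.Re (f x))) /\
  mu.-integrable setT (EFin \o (fun x => complex.Im (f x))).

Lemma cintegrable_pairing (g : cLspace mu hq) (f : cLspace mu hp) :
  cintegrable (fun x => g x * f x).
Proof.
have [mr mi] := cmeasurableM (cmeasurable_cLspace g) (cmeasurable_cLspace f).
split; first exact: (cpairing_le (@normr_Re_le R) mr).1.
exact: (cpairing_le (@normr_Im_le R) mi).1.
Qed.

Lemma normc_pairing_le (g : cLspace mu hq) (f : cLspace mu hp) :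
  normc (cintegral mu (fun x => g x * f x)) <= 2 * rnorm g * rnorm f.
Proof.
have [mr mi] := cmeasurableM (cmeasurable_cLspace g) (cmeasurable_cLspace f).
rewrite (le_trans (normc_le_ReIm _))// -mulrA mulr_natl mulr2n lerD//.
  exact: (cpairing_le (@normr_Re_le R) mr).2.
exact: (cpairing_le (@normr_Im_le R) mi).2.
Qed.

Lemma cintegral_ZD (a : R[i]) (f g : T -> R[i]) : cintegrable f -> cintegrable g ->
  cintegral mu (fun x => a * f x + g x) = a * cintegral mu f + cintegral mu g.
Proof.
move=> [fr fi] [gr gi]; rewrite /cintegral.
case: a => a b; apply/eqP; rewrite eq_complex /=; apply/andP; split; apply/eqP.
  rewrite (@eq_Rintegral _ _ _ mu setT (fun x => (a * complex.Re (f x) + (- b) * complex.Im (f x)) +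
    complex.Re (g x))) => [|x _]; last first.
    by case: (f x) (g x) => ? ? [? ?] /=; rewrite mulNr.
  have i1 := integrableZl measurableT a fr; have i2 := integrableZl measurableT (- b) fi.
  rewrite (RintegralD measurableT (integrableD measurableT i1 i2) gr).
  by rewrite (RintegralD measurableT i1 i2) !RintegralZl// mulNr.
rewrite (@eq_Rintegral _ _ _ mu setT (fun x => (a * complex.Im (f x) + b * complex.Re (f x)) +
  complex.Im (g x))) => [|x _]; last by case: (f x) (g x) => ? ? [? ?].
have i1 := integrableZl measurableT a fi; have i2 := integrableZl measurableT b fr.
rewrite (RintegralD measurableT (integrableD measurableT i1 i2) gi).
by rewrite (RintegralD measurableT i1 i2) !RintegralZl.
Qed.

Lemma cintegral_ae (f g : T -> R[i]) : cmeasurable f -> cmeasurable g ->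
  f = g %[ae mu] -> cintegral mu f = cintegral mu g.
Proof.
move=> [fr fi] [gr gi] fg; rewrite /cintegral.
congr Complex; congr fine; apply: ae_eq_integral => //; try exact/measurable_EFinP.
  by apply: filterS fg => x fgx xI; rewrite fgx.
by apply: filterS fg => x fgx xI; rewrite fgx.
Qed.

End hoelder_pairing.

Section complex_riesz.
Context d (T : measurableType d) (R : realType).
Variables (mu : {sigma_finite_measure set T -> \bar R}) (p : R) (q : \bar R).
Hypotheses (hp : (1 <= p%:E)%E) (hq : (1 <= q)%E) (hpq : (p%:E^-1 + q^-1 = 1)%E).
Local Notation E := (cLspace mu hp).

Variable W : T -> R.
Hypothesis W_gt0 : forall x, 0 < W x.
Hypothesis W_le1 : forall x, W x <= 1.
Hypothesis iW : mu.-integrable setT (EFin \o W).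

Variable e : {linear E -> R[i]^o}.
Hypothesis ce : continuous e.

Let p_ge1 : 1 <= p. Proof. by rewrite -lee_fin. Qed.
Let p_gt0 : 0 < p. Proof. exact: lt_le_trans p_ge1. Qed.

Let mW : measurable_fun setT W.
Proof. exact/measurable_EFinP/(measurable_int mu iW). Qed.

Local Notation bm := (@bounded_measurable _ T R).

Let emb s x : R[i] := (W x * s x)%:C%C.

Let normc_emb s x : normc (emb s x) = W x * `|s x|.
Proof. by rewrite normc_real normrM gtr0_norm. Qed.

Let cmeasurable_emb s : bm s -> cmeasurable (emb s).
Proof. by move=> [ms _]; split => //=; exact: measurable_funM. Qed.

Let cLnorm_emb s : bm s ->
  cLnorm mu p%:E (emb s) = ((\int[mu]_x (W x * `|s x|) `^ p) `^ p^-1)%:E.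
Proof.
move=> bs; rewrite /cLnorm unlock -poweR_EFin /Rintegral fineK; last first.
  exact: (integrable_fin_num measurableT
    (integrable_weighted_powR W_gt0 W_le1 iW p_ge1 bs)).
apply: (congr1 (fun t => (t `^ p^-1)%E)); apply: eq_integral => x _.
rewrite [RHS]/= -poweR_EFin; congr (_ `^ _)%E.
by rewrite gee0_abs ?lee_fin ?normc_ge0//; congr EFin; exact: normc_emb.
Qed.

Let cls_exists s : bm s -> exists F : E, cLspace_fun F = emb s %[ae mu].
Proof.
move=> bs; apply: cLspace_exists; first exact: cmeasurable_emb.
by rewrite cLnorm_emb// ltry.
Qed.

(** The class in L^p of [W * s]. *)
Let cls s : E := xget 0 [set F : E | cLspace_fun F = emb s %[ae mu]].

Let clsP s : bm s -> cLspace_fun (cls s) = emb s %[ae mu].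
Proof.
move=> bs; have [F HF] := cls_exists bs.
by have : [set F : E | cLspace_fun F = emb s %[ae mu]] (cls s) by apply: xgetPex; exists F.
Qed.

Let cls_lin a s t : bm s -> bm t ->
  cls (fun x => a * s x + t x) = a%:C%C *: cls s + cls t.
Proof.
move=> bs bt; have bst : bm (fun x => a * s x + t x).
  move: bs bt => [ms [B sB]] [mt [C tC]]; split.
    by apply: measurable_funD => //; exact: measurable_funM.
  exists (`|a| * B + C) => x; rewrite (le_trans (ler_normD _ _))// lerD//.
  by rewrite normrM ler_wpM2l.
apply: cLspace_ae_eq; move: (clsP bst); have h := cLspace_ZD_ae a%:C%C (cls s) (cls t).
move=> h4.
apply: (filterS _ (filterI (filterI h (clsP bs)) (filterI (clsP bt) h4))) => x [[e1 e2] [e3 e4]] xI.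
rewrite e4// e1// e2// e3// /emb mulrDr mulrCA.
by rewrite (rmorphD (real_complex R)) (rmorphM (real_complex R) a).
Qed.

Let rnorm_cls s : bm s ->
  rnorm (cls s) = (\int[mu]_x (W x * `|s x|) `^ p) `^ p^-1.
Proof.
move=> bs; have := rnorm_ae (cmeasurable_emb bs) (clsP bs).
by rewrite cLnorm_emb// => -[].
Qed.

Let part_riesz (P : R[i] -> R) : (forall z, `|P z| <= normc z) ->
  (forall z z', P (z + z') = P z + P z') -> (forall (a : R) z, P (a%:C%C * z) = a * P z) ->
  exists g : T -> R, [/\ measurable_fun setT g,
    ('N[mu]_q[EFin \o g] <= (dual_norm e)%:E)%E &
    forall s, bm s -> mu.-integrable setT (EFin \o (fun x => g x * (W x * s x))) /\
      P (e (cls s)) = \int[mu]_x (g x * (W x * s x))].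
Proof.
move=> Ple PD PZ.
apply: (@riesz_representation _ _ _ mu W p (dual_norm e) (fun s => P (e (cls s)))) => //.
- exact: dual_norm_ge0.
- by move=> a s t bs bt; rewrite cls_lin// linearP PD PZ.
- move=> s bs; rewrite (le_trans (Ple _))// -rnorm_cls//.
  exact: le_dual_norm.
Qed.

(** The real and the imaginary part of [e] are represented by real functions [g1]
    and [g2], and [g] is [g1 + i g2]. Treating them separately costs the factor 2 in
    the norm. *)
Theorem complex_riesz_representation : exists2 g : cLspace mu hq,
  rnorm g <= 2 * dual_norm e &
  forall (s : T -> R) (F : E), bm s -> cLspace_fun F = (fun x => (W x * s x)%:C%C) %[ae mu] ->
    e F = cintegral mu (fun x => g x * (W x * s x)%:C%C).
Proof.
have [g1 [mg1 Ng1 g1P]] := part_riesz (@normr_Re_le R) (fun _ _ => raddfD _ _ _)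
  (fun a z => ltac:(by case: z => ? ? /=; rewrite mul0r subr0)).
have [g2 [mg2 Ng2 g2P]] := part_riesz (@normr_Im_le R) (fun _ _ => raddfD _ _ _)
  (fun a z => ltac:(by case: z => ? ? /=; rewrite mul0r addr0)).
pose g x := Complex (g1 x) (g2 x).
have cg : cmeasurable g by split.
have Ng : (cLnorm mu q g <= (2 * dual_norm e)%:E)%E.
  apply: (@le_trans _ _ ('N[mu]_q[EFin \o ((fun x => `|g1 x|) \+ (fun x => `|g2 x|))%R])%E).
    apply: le_Lnorm => //.
    - exact: cmeasurable_normc.
    - by apply: measurable_funD; exact: measurableT_comp.
    - by move=> x; rewrite normc_ge0 normc_le_ReIm.
  rewrite mulr_natl mulr2n EFinD.
  apply: (le_trans (eminkowski mu _ _ hq)).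
  - exact: measurableT_comp.
  - exact: measurableT_comp.
  have Nabs (h : T -> R) : 'N[mu]_q[EFin \o (fun x => `|h x|)%R]%E = 'N[mu]_q[EFin \o h]%E.
    by rewrite -[RHS]Lnorm_abse.
  by rewrite !Nabs leeD.
have [G GE] := cLspace_exists hq cg (le_lt_trans Ng (ltry _)).
exists G; first by rewrite -lee_fin -(rnorm_ae cg GE).
move=> s F bs FE.
have -> : F = cls s.
  apply: cLspace_ae_eq; apply: filterS2 FE (clsP bs) => x e1 e2 xI.
  by rewrite e1// e2.
have mWs := cmeasurable_emb bs.
rewrite (@cintegral_ae _ _ _ mu _ (fun x => g x * (W x * s x)%:C%C)).
- have [_ e1] := g1P s bs; have [_ e2] := g2P s bs.
  rewrite /cintegral; case: (e (cls s)) e1 e2 => a b /= -> ->.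
  by congr Complex; apply: eq_Rintegral => x _; rewrite mulr0 ?subr0 ?add0r.
- exact: (cmeasurableM (cmeasurable_cLspace G) mWs).
- exact: (cmeasurableM cg mWs).
- by apply: filterS GE => x Gx xI; rewrite Gx.
Qed.

End complex_riesz.

(** * Hermite functions in L^p *)

Section hermite_Lp.
Context (R : realType) (n : nat).
Local Notation mu := (lebesgue_rV R n).
Local Notation Phi := (@hermite_fun R n).
Local Notation W := (@weight R n).
Local Notation cPhi nu := (fun x => (Phi nu x)%:C%C).

Lemma hermite_coefE (f : 'rV[R]_n -> R[i]) nu : hermite_coef f nu =
  Complex (real_coef (fun x => complex.Re (f x)) nu) (real_coef (fun x => complex.Im (f x)) nu).
Proof.
rewrite /hermite_coef /cintegral /real_coef.
congr Complex; apply: eq_Rintegral => x _; case: (f x) => a b /=.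
  by rewrite mulr0 subr0.
by rewrite mulr0 add0r.
Qed.

Lemma hermite_coef_hermite nu kappa : hermite_coef (cPhi kappa) nu = (nu == kappa)%:R.
Proof.
rewrite hermite_coefE /real_coef /=.
under eq_Rintegral do rewrite mulrC.
rewrite hermite_orthonormal; under eq_Rintegral do rewrite mul0r.
by rewrite Rintegral_cst// mul0r; case: eqP.
Qed.

Lemma schwartz_hermite nu : schwartz (cPhi nu).
Proof.
split=> /=; first exact/hermite_span_schwartz/hermite_span1.
apply: hermite_span_schwartz; exists [::].
by apply/funext => x; rewrite big_nil.
Qed.

Lemma measurable_schwartz (f : 'rV[R]_n -> R) : real_schwartz f -> measurable_fun setT f.
Proof. by move=> [sf _]; apply: measurable_continuous_rV; exact: (sf [::]).1. Qed.

Lemma cmeasurable_schwartz (f : 'rV[R]_n -> R[i]) : schwartz f -> cmeasurable f.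
Proof. by move=> [fr fi]; split; exact: measurable_schwartz. Qed.

Lemma cmeasurable_hermite nu : cmeasurable (cPhi nu).
Proof. exact/cmeasurable_schwartz/schwartz_hermite. Qed.

Variables (p : R) (hp : (1 <= p%:E)%E).
Local Notation E := (cLspace mu hp).

Let p_ge1 : 1 <= p. Proof. by rewrite -lee_fin. Qed.

Let cW x : R[i] := (W x)%:C%C.

Let cmeasurable_cW : cmeasurable cW.
Proof. by split => //=; exact: measurable_weight. Qed.

Let cLnorm_W : (cLnorm mu p%:E cW < +oo)%E.
Proof.
rewrite /cLnorm unlock poweR_lty//.
apply: le_lt_trans (_ : \int[mu]_x (W x)%:E < +oo)%E; last first.
  have /integrableP[_] := integrable_weight R n.
  by under eq_integral do rewrite gee0_abs ?lee_fin ?weight_ge0//.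
apply: ge0_le_integral => //.
- by move=> x _; exact: poweR_ge0.
- apply: measurable_normr_powR; exact: cmeasurable_normc.
- by apply/measurable_EFinP; exact: measurable_weight.
- move=> x _.
  have -> : (`|(EFin \o (fun x => normc (cW x))) x| = (W x)%:E)%E.
    by rewrite gee0_abs ?lee_fin ?normc_ge0//; congr EFin; rewrite normc_real ger0_norm ?weight_ge0.
  by rewrite poweR_EFin lee_fin ge1r_powR// weight_gt0 weight_le1.
Qed.

Definition weight_norm : R := fine (cLnorm mu p%:E cW).

Lemma weight_norm_ge0 : 0 <= weight_norm.
Proof. exact/fine_ge0/Lnorm_ge0. Qed.

Lemma cLnorm_weight_bound (f : 'rV[R]_n -> R[i]) C : 0 <= C -> cmeasurable f ->
  (forall x, normc (f x) <= C * W x) -> (cLnorm mu p%:E f <= (C * weight_norm)%:E)%E.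
Proof.
move=> C0 mf fC; rewrite EFinM /weight_norm fineK ?ge0_fin_numE ?Lnorm_ge0//.
have cE : normc (C%:C%C) = C by rewrite normc_real ger0_norm.
have -> : (C%:E * cLnorm mu p%:E cW = cLnorm mu p%:E (C%:C%C *: cW))%E by rewrite cLnormZ// cE.
have mCW : cmeasurable (C%:C%C *: cW).
  by rewrite -[_ *: _]addr0; apply: cmeasurableZD => //; exact: cmeasurable0.
apply: le_Lnorm => //; [exact: cmeasurable_normc|exact: cmeasurable_normc|].
move=> x; rewrite normc_ge0 andTb (le_trans (fC x))//.
by rewrite -[(_ *: cW) x]/(C%:C%C * cW x) Normc.normcM cE normc_real ger0_norm ?weight_ge0.
Qed.

Lemma hermite_class_exists nu : exists F : E, cLspace_fun F = cPhi nu %[ae mu].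
Proof.
apply: cLspace_exists; first exact: cmeasurable_hermite.
apply: le_lt_trans (cLnorm_weight_bound (hermite_cst_ge0 R nu) (cmeasurable_hermite nu) _) (ltry _).
by move=> x; rewrite normc_real hermite_decay.
Qed.

Definition hermite_class nu : E := xget 0 [set F : E | cLspace_fun F = cPhi nu %[ae mu]].

Lemma hermite_classP nu : cLspace_fun (hermite_class nu) = cPhi nu %[ae mu].
Proof.
have [F HF] := hermite_class_exists nu.
suff : [set F : E | cLspace_fun F = cPhi nu %[ae mu]] (hermite_class nu) by [].
by apply: xgetPex; exists F.
Qed.

(** The pointwise bound [eps * weight] on the error is a bound in L^p, the weight
    being in L^p. *)
Lemma schwartz_expansion_Lp (f : 'rV[R]_n -> R[i]) (F : E) eps : schwartz f ->
  cLspace_fun F = f %[ae mu] -> 0 < eps ->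
  exists N, forall A : seq {ffun 'I_n -> nat}, uniq A ->
    (forall nu, (pickle nu < N)%N -> nu \in A) ->
    rnorm (F - \sum_(nu <- A) hermite_coef f nu *: hermite_class nu) <= eps.
Proof.
move=> sf Ff e0; have [sr si] := sf.
have K1 : 0 < 2 * weight_norm + 1 by rewrite ltr_wpDl ?mulr_ge0 ?weight_norm_ge0.
pose del := eps / (2 * weight_norm + 1).
have del0 : 0 < del by rewrite divr_gt0.
have [N1 H1] := schwartz_expansion sr del0.
have [N2 H2] := schwartz_expansion si del0.
exists (N1 + N2)%N => A uA NA.
have A1 nu : (pickle nu < N1)%N -> nu \in A by move=> h; apply: NA; rewrite (leq_trans h)// leq_addr.
have A2 nu : (pickle nu < N2)%N -> nu \in A by move=> h; apply: NA; rewrite (leq_trans h)// leq_addl.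
pose S x := \sum_(nu <- A) hermite_coef f nu * cPhi nu x.
have SE x : S x = Complex (\sum_(nu <- A) real_coef (fun x => complex.Re (f x)) nu * Phi nu x)
    (\sum_(nu <- A) real_coef (fun x => complex.Im (f x)) nu * Phi nu x).
  rewrite /S; elim: (A) => [|nu s IH]; first by rewrite !big_nil.
  rewrite !big_cons IH hermite_coefE; apply/eqP; rewrite eq_complex /=.
  by rewrite !mulr0 subr0 add0r !eqxx.
have fS x : normc (f x - S x) <= (2 * del) * W x.
  rewrite (le_trans (normc_le_ReIm _))// -mulrA mulr_natl mulr2n SE.
  by rewrite !raddfB/= lerD// ?H1 ?H2.
have mS : cmeasurable (f - S)%R.
  rewrite addrC -scaleN1r; apply: cmeasurableZD; last exact: cmeasurable_schwartz.
  by apply: cmeasurable_sum => nu; exact: cmeasurable_hermite.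
rewrite -lee_fin -(@rnorm_ae _ _ _ mu _ hp _ (f - S)%R)//.
  apply: le_trans (cLnorm_weight_bound _ mS fS) _; first by rewrite mulr_ge0// ltW.
  rewrite lee_fin mulrAC mulrC /del -mulrAC -mulrA ler_piMr ?(ltW e0)//.
  by rewrite ler_pdivrMr// mul1r lerDl.
pose P nu : E := hermite_coef f nu *: hermite_class nu.
have h1 := cLspace_B_ae F (\sum_(nu <- A) P nu).
have h2 := cLspace_sum_ae A P.
have h3 : {ae mu, forall x, forall nu, nu \in A -> P nu x = hermite_coef f nu * cPhi nu x}.
  elim: (A) => [|nu s IH]; first exact: nearW.
  apply: (filterS _ (filterI IH (filterI (cLspace_Z_ae (hermite_coef f nu)
    (hermite_class nu)) (hermite_classP nu)))) => x [{}IH [e1 e2]] kappa.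
  rewrite inE => /predU1P[->|/IH//].
  by rewrite /P e1// e2.
apply: (filterS _ (filterI (filterI h1 h2) (filterI h3 Ff))) => x [[e1 e2] [e3 e4]] xI.
rewrite e1// e2// e4//; congr (_ - _).
by rewrite /S !big_seq; apply: eq_bigr => nu /e3.
Qed.

Lemma pairing_hermite_class q (hq : (1 <= q)%E) (g : cLspace mu hq) nu :
  cintegral mu (fun x => g x * hermite_class nu x) = hermite_coef g nu.
Proof.
apply: cintegral_ae.
- exact: (cmeasurableM (cmeasurable_cLspace g) (cmeasurable_cLspace _)).
- exact: (cmeasurableM (cmeasurable_cLspace g) (cmeasurable_hermite nu)).
by apply: filterS (hermite_classP nu) => x e1 xI; rewrite e1.
Qed.

Variables (q : \bar R) (hq : (1 <= q)%E) (hpq : (p%:E^-1 + q^-1 = 1)%E).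

(** Since the weight [W] dominates all Hermite functions, each of them is [W] times
    a bounded function, and the Riesz representation applies. *)
Lemma functional_hermite (e : {linear E -> R[i]^o}) : continuous e ->
  exists2 g : cLspace mu hq, rnorm g <= 2 * dual_norm e &
  forall nu, e (hermite_class nu) = hermite_coef g nu.
Proof.
move=> ce; have [g gN gP] := complex_riesz_representation hq hpq
  (@weight_gt0 R n) (@weight_le1 R n) (integrable_weight R n) ce.
exists g => // nu; pose s x := Phi nu x * W x `^ (-1).
have sW x : (W x * s x)%:C%C = cPhi nu x.
  rewrite /s mulrCA powR_inv1 ?weight_ge0// mulfV ?mulr1//.
  by rewrite gt_eqF ?weight_gt0.
have bs : bounded_measurable s.
  split.
    apply: measurable_funM; first exact: measurable_hermite.
    by apply: (measurableT_comp (measurable_powR _)); exact: measurable_weight.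
  exists (hermite_cst R nu) => x; rewrite normrM powR_inv1 ?weight_ge0//.
  rewrite [`|_^-1|]gtr0_norm ?invr_gt0 ?weight_gt0// ler_pdivrMr ?weight_gt0//.
  exact: hermite_decay.
rewrite (gP s _ bs).
  by congr cintegral; apply/funext => x; rewrite sW.
by apply: filterS (hermite_classP nu) => x e1 xI; rewrite e1// sW.
Qed.

End hermite_Lp.

(** * Nuclear operators *)

From mathcomp Require Import finmap summability.

(** The terms [a k ^ r] are at most their sum [S], so that
    [a k = (a k ^ r)^((1 - r) / r) * a k ^ r <= S^((1 - r) / r) * a k ^ r]. *)
Lemma powR_summable (R : realType) (a : nat -> R) (r : R) : 0 < r <= 1 ->
  (forall k, 0 <= a k) -> (\sum_(k <oo) (a k `^ r)%:E < +oo)%E ->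
  (\sum_(k <oo) (a k)%:E < +oo)%E.
Proof.
move=> /andP[r0 r1] a0; set S := (\sum_(k <oo) (a k `^ r)%:E)%E => Sfin.
have ar0 k : (0 <= (a k `^ r)%:E)%E by rewrite lee_fin powR_ge0.
have S0 : (0 <= S)%E by apply: nneseries_ge0.
have fS : S \is a fin_num by rewrite ge0_fin_numE.
pose c := fine S `^ ((1 - r) / r).
have ac k : a k <= c * a k `^ r.
  have arS : a k `^ r <= fine S.
    rewrite -lee_fin fineK//.
    apply: le_trans (nneseries_lim_ge k.+1 (fun i _ _ => ar0 i)).
    rewrite big_nat_recr//= leeDr// sumEFin lee_fin.
    by apply: sumr_ge0 => i _; exact: powR_ge0.
  have [->|ak0] := eqVneq (a k) 0; first by rewrite mulr_ge0// powR_ge0.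
  have e : a k = a k `^ (1 - r) * a k `^ r.
    by rewrite -powRD ?subrK ?powRr1// ak0 implybT.
  rewrite [leLHS]e ler_wpM2r ?powR_ge0//.
  have -> : a k `^ (1 - r) = (a k `^ r) `^ ((1 - r) / r).
    by rewrite -powRrM mulrCA mulfV ?gt_eqF// mulr1.
  apply: ge0_ler_powR; rewrite ?nnegrE ?powR_ge0 ?fine_ge0//.
  by rewrite divr_ge0 ?subr_ge0// ltW.
apply: (@le_lt_trans _ _ (c%:E * S)%E).
  rewrite -nneseriesZl//; apply: lee_nneseries => k _; rewrite lee_fin//.
by rewrite lte_mul_pinfty// ?lee_fin ?powR_ge0.
Qed.

#[local] Existing Instance totally_filter.

(** Once a finite set contains [i], the sum over it is [u i]. *)
Lemma totally_at (I : choiceType) (V : zmodType) (u : I -> V) i :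
  (forall j, j != i -> u j = 0) -> \forall A \near totally, partial_sum u A = u i.
Proof.
move=> u0; exists (fset1 i) => // A /= iA.
have iA' : i \in A by apply: (fsubsetP iA); rewrite in_fset1.
rewrite /partial_sum (bigD1 [` iA']%fset)//= big1 ?addr0// => j ji.
by apply: u0; apply: contraNneq ji => ji; apply/eqP/val_inj.
Qed.

Section pairing.
Context d (T : measurableType d) (R : realType).
Variables (mu : {measure set T -> \bar R}) (p : R) (q : \bar R).
Hypotheses (hp : (1 <= p%:E)%E) (hq : (1 <= q)%E) (hpq : (p%:E^-1 + q^-1 = 1)%E).

Lemma pairing_functional (g : cLspace mu hq) :
  exists e : {linear cLspace mu hp -> R[i]^o},
    forall F : cLspace mu hp, e F = cintegral mu (fun x => g x * F x).
Proof.
pose e (F : cLspace mu hp) : R[i]^o := cintegral mu (fun x => g x * F x).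
have lin : linear e.
  move=> a F G; rewrite /e -(cintegral_ZD a (cintegrable_pairing hpq g F)
    (cintegrable_pairing hpq g G)).
  have mM (H : cLspace mu hp) : cmeasurable (fun x => g x * H x).
    by apply: cmeasurableM; exact: cmeasurable_cLspace.
  apply: cintegral_ae; [exact: mM|exact: (cmeasurableZD a (mM F) (mM G))|].
  apply: filterS (cLspace_ZD_ae a F G) => x e1 xI; rewrite e1//.
  by rewrite mulrDr mulrCA.
pose L := GRing.isLinear.Build _ _ _ _ e lin.
pose e' : {linear cLspace mu hp -> R[i]^o} := HB.pack e L.
by exists e'.
Qed.

End pairing.

Section nuclear_series.
Context (R : realType) (E F : normedModType R[i]).
Variables (e : nat -> {linear E -> R[i]^o}) (y : nat -> F) (C : R).

(** The sum of the [a k] bounds the partial sums of the series uniformly on the unit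
    ball, hence also the limit operator. *)
Lemma series_operator (a : nat -> R) :
  (forall k, 0 <= a k) -> (\sum_(k <oo) (a k)%:E < +oo)%E ->
  (forall k x, normc (e k x) * rnorm (y k) <= a k * rnorm x) ->
  (forall x, exists l : F, series (fun k => e k x *: y k) @ \oo --> l) ->
  exists2 S : {linear E -> F}, continuous S &
    forall x, series (fun k => e k x *: y k) @ \oo --> S x.
Proof.
move=> a0 sa ea /choice[S SP].
have uniq (u : nat -> F) (l l' : F) : u @ \oo --> l -> u @ \oo --> l' -> l = l'.
  exact: norm_cvg_unique.
have lin : linear S.
  move=> c x z; apply: (uniq _ _ _ (SP _)).
  have -> : series (fun k => e k (c *: x + z) *: y k) =
     (fun n => c *: series (fun k => e k x *: y k) n + series (fun k => e k z *: y k) n).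
    apply/funext => n; rewrite /series /= scaler_sumr -big_split/=.
    by apply: eq_bigr => k _; rewrite linearP scalerDl scalerA.
  by apply: cvgD; [apply: cvgZr|exact: SP]; exact: SP.
pose L := GRing.isLinear.Build _ _ _ _ S lin.
pose S' : {linear E -> F} := HB.pack S L.
exists S' => //; apply: (@continuous_bounded_linear _ _ _ S' (fine (\sum_(k <oo) (a k)%:E))) => x.
have a0' k : (0 <= (a k)%:E)%E by rewrite lee_fin.
have fa : (\sum_(k <oo) (a k)%:E)%E \is a fin_num by rewrite ge0_fin_numE// nneseries_ge0.
apply/ler_addgt0Pl => eps e0.
have /cvg_rnormP/(_ _ e0)[N _ /(_ N (leqnn N)) HN] := SP x.
rewrite -[S' x](subrK (series (fun k => e k x *: y k) N)) (le_trans (rnormD _ _))// lerD//.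
apply: (@le_trans _ _ (\sum_(0 <= k < N) a k * rnorm x)).
  rewrite /series /=; elim: N {HN} => [|n IH]; first by rewrite !big_geq// rnorm0.
  rewrite !big_nat_recr//= (le_trans (rnormD _ _))// lerD// rnormZ.
  exact: ea.
rewrite -mulr_suml ler_wpM2r ?rnorm_ge0// -lee_fin fineK// -sumEFin.
exact: nneseries_lim_ge.
Qed.

End nuclear_series.

(** * Nuclear pseudo-multipliers *)

Section characterization.
Context (R : realType) (n : nat).
Variables (p1 p2 r : R) (q1 : \bar R).
Hypotheses (hp1 : (1 <= p1%:E)%E) (hp2 : (1 <= p2%:E)%E) (hq1 : (1 <= q1)%E).
Hypotheses (hr : 0 < r <= 1) (hconj : (p1%:E^-1 + q1^-1 = 1)%E).
Variable m : 'rV[R]_n -> {ffun 'I_n -> nat} -> R[i].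
Local Notation mu := (lebesgue_rV R n).
Local Notation P := (@hermite_class R n p1 hp1).
Local Notation cPhi nu := (fun x => (hermite_fun nu x)%:C%C).

Let r_gt0 : 0 < r. Proof. by case/andP: hr. Qed.

(** The operator with kernel [sum_k h_k(x) g_k(y)] maps the Hermite function of
    index [nu] to [m(., nu)] times itself. *)
Definition hermite_kernel (g : nat -> Lp n hq1) (h : nat -> Lp n hp2) :=
  forall nu : {ffun 'I_n -> nat},
      {ae mu, forall x,
        series (fun k => h k x * hermite_coef (g k) nu : R[i]^o) @ \oo -->
          (m x nu * (hermite_fun nu x)%:C%C : R[i]^o)}.

Let summableM (C : R) (a b : nat -> R) : 0 <= C -> (forall k, 0 <= a k) ->
  (forall k, 0 <= b k) ->
  (forall k, a k <= C * b k) -> (\sum_(k <oo) (b k)%:E < +oo)%E ->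
  (\sum_(k <oo) (a k)%:E < +oo)%E.
Proof.
move=> C0 a0 b0 ab fin; apply: (@le_lt_trans _ _ (C%:E * \sum_(k <oo) (b k)%:E)%E).
  rewrite -nneseriesZl; last by move=> k _; rewrite lee_fin.
  by apply: lee_nneseries => k _; rewrite lee_fin// ab.
by rewrite lte_mul_pinfty// ?lee_fin.
Qed.

Let summable_scale (a b : nat -> R) : (forall k, 0 <= a k) -> (forall k, 0 <= b k) ->
  (forall k, a k <= 2 * b k) -> forall c : nat -> R, (forall k, 0 <= c k) ->
  (\sum_(k <oo) (b k `^ r * c k `^ r)%:E < +oo)%E ->
  (\sum_(k <oo) (a k `^ r * c k `^ r)%:E < +oo)%E.
Proof.
move=> a0 b0 ab c c0; apply: (summableM (powR_ge0 2 r)) => k;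
  rewrite ?mulr_ge0 ?powR_ge0//.
rewrite mulrA -[2 `^ r * b k `^ r]powRM// ler_wpM2r ?powR_ge0//.
by rewrite ge0_ler_powR ?nnegrE ?mulr_ge0 ?(ltW r_gt0).
Qed.

Let summable1 (a c : nat -> R) : (forall k, 0 <= a k) -> (forall k, 0 <= c k) ->
  (\sum_(k <oo) (a k `^ r * c k `^ r)%:E < +oo)%E ->
  (\sum_(k <oo) (a k * c k)%:E < +oo)%E.
Proof.
move=> a0 c0 fin; apply: (powR_summable hr); first by move=> k; rewrite mulr_ge0.
by under eq_eseriesr do rewrite powRM//.
Qed.

Let cLp2_unique (u : nat -> Lp n hp2) (l l' : Lp n hp2) :
  u @ \oo --> l -> u @ \oo --> l' -> l = l'.
Proof. exact: norm_cvg_unique. Qed.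

(** The functionals [e k] of a nuclear decomposition are integrations against
    functions [g k]. Applied to a Hermite function, the series defining [T_m] has a
    single nonzero term, so that [T] maps [phi_nu] to [m(., nu) phi_nu]; on the other
    hand [T phi_nu] is the sum of the [e k phi_nu *: y k], which converges almost
    everywhere as well as in norm because [r <= 1]. *)
Lemma nuclear_hermite_kernel : extends_to_nuclear hp1 hp2 r m ->
  exists (g : nat -> Lp n hq1) (h : nat -> Lp n hp2),
    (\sum_(k <oo) (rnorm (g k) `^ r * rnorm (h k) `^ r)%:E < +oo)%E /\
    hermite_kernel g h.
Proof.
move=> [T [e [y [ce Te fin]]] Text].
have /choice[g gP] : forall k, exists g : Lp n hq1, rnorm g <= 2 * dual_norm (e k) /\
    forall nu, e k (P nu) = hermite_coef g nu.
  by move=> k; have [g ? ?] := functional_hermite hq1 hconj (ce k); exists g.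
exists g, y; split.
  apply: summable_scale fin => k; rewrite ?rnorm_ge0 ?dual_norm_ge0//.
  exact: (gP k).1.
move=> nu.
have [u uE ucvg] := Text _ (P nu) (schwartz_hermite R nu) (hermite_classP hp1 nu).
(* orthogonality kills all terms of the series but one *)
have u0 kappa : kappa != nu -> u kappa = 0.
  move=> kn; apply: cLspace_ae_eq.
  apply: filterS2 (uE kappa) (cLspace0_ae mu hp2) => x e1 e2 xI.
  rewrite e1// e2// /pseudo_multiplier_term hermite_coef_hermite (negPf kn).
  by rewrite mulr0 mul0r.
have TP : T (P nu) = u nu.
  have := @norm_cvg_unique _ (Lp n hp2) _ (fmap_proper_filter (partial_sum u) totally_filter)
    (T (P nu)) (u nu) ucvg; apply.
  apply/cvg_rnormP => eps e0; apply: filterS (totally_at u0) => A ->.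
  by rewrite subrr rnorm0 ltW.
pose v k : Lp n hp2 := e k (P nu) *: y k.
have sv : (\sum_(k <oo) (rnorm (v k))%:E < +oo)%E.
  apply: (summableM (rnorm_ge0 (P nu)) (b := fun k => dual_norm (e k) * rnorm (y k))).
  - by move=> k; exact: rnorm_ge0.
  - by move=> k; rewrite mulr_ge0 ?dual_norm_ge0 ?rnorm_ge0.
  - by move=> k; rewrite rnormZ mulrA ler_wpM2r ?rnorm_ge0// mulrC le_dual_norm.
  - by apply: summable1 fin => k; rewrite ?dual_norm_ge0 ?rnorm_ge0.
have [l [vl vae]] := absolutely_convergent_series sv.
have lE : l = u nu by rewrite -TP; exact: cLp2_unique vl (Te _).
have vE : {ae mu, forall x, forall k,
    v k x = (y k : Lp n hp2) x * hermite_coef (g k) nu}.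
  apply/ae_foralln => k.
  by apply: filterS (cLspace_Z_ae (e k (P nu)) (y k)) => x e1; rewrite e1// (gP k).2 mulrC.
apply: (filterS _ (filterI vae (filterI vE (uE nu)))) => x [vx [vEx ux]].
have lx : l x = m x nu * cPhi nu x.
  have -> : l x = pseudo_multiplier_term m (cPhi nu) nu x by rewrite lE; exact: ux I.
  by rewrite /pseudo_multiplier_term hermite_coef_hermite eqxx mulr1.
have se : (fun k => v k x : R[i]^o) =
    (fun k => (y k : Lp n hp2) x * hermite_coef (g k) nu : R[i]^o).
  by apply/funext => k; exact: vEx.
by rewrite -lx -se.
Qed.

(** The pairings with [g k] and the [h k] define a nuclear operator [T], and the
    hypothesis says that [T] maps [phi_nu] to [m(., nu) phi_nu]. The Hermite expansion
    of a Schwartz function converges unconditionally in L^p1; its image by the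
    continuous operator [T] is the series defining [T_m]. *)
Lemma hermite_kernel_nuclear (g : nat -> Lp n hq1) (h : nat -> Lp n hp2) :
  (\sum_(k <oo) (rnorm (g k) `^ r * rnorm (h k) `^ r)%:E < +oo)%E ->
  hermite_kernel g h -> extends_to_nuclear hp1 hp2 r m.
Proof.
move=> fin gh.
have /choice[e eP] := fun k => pairing_functional hp1 hconj (g k).
have ebound k F : normc (e k F) <= 2 * rnorm (g k) * rnorm F.
  by rewrite eP; exact: normc_pairing_le.
have ce k : continuous (e k).
  by apply: (@continuous_bounded_linear _ _ R[i]^o (e k) (2 * rnorm (g k))); exact: ebound.
pose a k := 2 * rnorm (g k) * rnorm (h k).
have a0 k : 0 <= a k by rewrite !mulr_ge0 ?rnorm_ge0.
have sa : (\sum_(k <oo) (a k)%:E < +oo)%E.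
  apply: (summableM (ler0n R 2) a0 (b := fun k => rnorm (g k) * rnorm (h k))).
  - by move=> k; rewrite mulr_ge0 ?rnorm_ge0.
  - by move=> k; rewrite /a mulrA.
  - by apply: summable1 fin => k; rewrite rnorm_ge0.
have ea k F : normc (e k F) * rnorm (h k) <= a k * rnorm F.
  by rewrite /a mulrAC ler_wpM2r ?rnorm_ge0.
have series_F F : exists l : Lp n hp2, series (fun k => e k F *: h k) @ \oo --> l /\
    {ae mu, forall x, series (fun k => (e k F *: h k : Lp n hp2) x : R[i]^o) @ \oo --> (l x : R[i]^o)}.
  apply: absolutely_convergent_series.
  apply: (summableM (rnorm_ge0 F) _ a0 _ sa) => k; first exact: rnorm_ge0.
  by rewrite rnormZ mulrC [_ * a k]mulrC -[leLHS]mulrC ea.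
have [T cT TP] := series_operator a0 sa ea (fun F => let: ex_intro l H := series_F F in ex_intro _ l H.1).
have TPhi nu : cLspace_fun (T (P nu)) = (fun x => m x nu * cPhi nu x) %[ae mu].
  have [l [lT lae]] := series_F (P nu).
  have -> : T (P nu) = l by exact: cLp2_unique (TP _) lT.
  have hE : {ae mu, forall x, forall k, (e k (P nu) *: h k : Lp n hp2) x = h k x * hermite_coef (g k) nu}.
    apply/ae_foralln => k.
    apply: filterS (cLspace_Z_ae (e k (P nu)) (h k)) => x e1; rewrite e1//.
    by rewrite eP pairing_hermite_class mulrC.
  apply: (filterS _ (filterI lae (filterI hE (gh nu)))) => x [lx [hx ghx]] xI.
  have se : (fun k => (e k (P nu) *: h k : Lp n hp2) x : R[i]^o) =
      (fun k => h k x * hermite_coef (g k) nu : R[i]^o).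
    by apply/funext => k; rewrite hx.
  by rewrite se in lx; exact: (@norm_cvg_unique _ (R[i]^o) _ _ _ _ lx ghx).
exists T.
  exists e, h; split.
  - exact: ce.
  - exact: TP.
  - apply: summable_scale fin => k; rewrite ?rnorm_ge0//; last first.
      by apply: dual_norm_le => // ; rewrite mulr_ge0 ?rnorm_ge0.
    exact: dual_norm_ge0.
move=> f F sf Ff.
pose u nu : Lp n hp2 := hermite_coef f nu *: T (P nu).
exists u.
  move=> nu; apply: filterS2 (cLspace_Z_ae (hermite_coef f nu) (T (P nu))) (TPhi nu) => x e1 e2 xI.
  by rewrite e1// e2// /pseudo_multiplier_term mulrA [_ * m x nu]mulrC.
have PF : partial_sum (fun nu => hermite_coef f nu *: P nu) @ totally --> F.
  apply/cvg_rnormP => eps /(schwartz_expansion_Lp sf Ff)[N HN].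
  exists [fset nu in enum_upto {ffun 'I_n -> nat} N]%fset => // A /= NA.
  rewrite /partial_sum -(big_seq_fsetE _ A xpredT (fun nu => hermite_coef f nu *: P nu)).
  apply: HN => [|nu nuN]; first exact: fset_uniq.
  by apply: (fsubsetP NA); rewrite !inE /= mem_enum_upto.
rewrite /unconditional_sum.
have -> : partial_sum u = T \o partial_sum (fun nu => hermite_coef f nu *: P nu).
  by apply/funext => A /=; rewrite linear_sum; apply: eq_bigr => nu _; rewrite linearZ.
exact: (cvg_comp _ _ PF (cT F)).
Qed.

End characterization.

Theorem theorem1p1 (R : realType) (n : nat) (n_ge1 : (1 <= n)%N)
  (p1 p2 r : R) (q1 : \bar R)
  (hp1 : (1 <= p1%:E)%E) (hp2 : (1 <= p2%:E)%E) (hq1 : (1 <= q1)%E)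
  (hr : 0 < r <= 1) (hconj : (p1%:E^-1 + q1^-1 = 1)%E)
  (m : 'rV[R]_n -> {ffun 'I_n -> nat} -> R[i])
  (hm : forall nu, lebesgue_measurable (fun x => m x nu)) :
  extends_to_nuclear hp1 hp2 r m <->
  exists (g : nat -> Lp n hq1) (h : nat -> Lp n hp2),
    (\sum_(k <oo) (rnorm (g k) `^ r * rnorm (h k) `^ r)%:E < +oo)%E /\
    forall nu : {ffun 'I_n -> nat},
      {ae lebesgue_rV R n, forall x,
        series (fun k => h k x * hermite_coef (g k) nu : R[i]^o) @ \oo -->
          (m x nu * (hermite_fun nu x)%:C%C : R[i]^o)}.
Proof.
split; first exact: nuclear_hermite_kernel.
by move=> [g [h [fin gh]]]; exact: hermite_kernel_nuclear fin gh.
Qed.
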